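(* For every $p_0>2$, letting $q_0$ be defined by $\frac{1}{q_0}+\frac{1}{p_0}=1$, there exists a function $g$ holomorphic on $\mathbb{D}$, continuous on $\overline{\mathbb{D}}$ and without zeros in $\mathbb{D}$ such that, with $\mu=|g|^2$, the weighted Szegő projection $\mathbf{S}_{\mu}$ is bounded on $L^p(\mathbb{T},\mu)$ if and only if $q_0<p<p_0$.
   Context: $\mathbb{D}$ is the unit disc, $\mathbb{T}$ the unit circle with arc-length measure $d\theta$. For $g$ holomorphic on $\mathbb{D}$, continuous on $\overline{\mathbb{D}}$, without zeros in $\mathbb{D}$, set $\mu=|g|^2$. For $1\le p<\infty$, $L^p(\mathbb{T},\mu)$ is the space of measurable $f$ on $\mathbb{T}$ with $\|f\|_{p,\mu}^p=\int_{\mathbb{T}}|f|^p\mu\,d\theta<\infty$, and $\mathcal{H}^p(\mathbb{T},\mu)$ is the space of holomorphic $f$ on $\mathbb{D}$ with $\sup_{0\le r<1}\int_0^{2\pi}|f(re^{i\theta})|^p|g(re^{i\theta})|^2d\theta<\infty$, identified with its (a.e. existing) boundary values, a closed subspace of $L^p(\mathbb{T},\mu)$. The weighted Szegő projection $\mathbf{S}_\mu$ is the orthogonal projection of $L^2(\mathbb{T},\mu)$ onto $\mathcal{H}^2(\mathbb{T},\mu)$; it is given by $\mathbf{S}_\mu f(z)=\int_{\mathbb{T}}S_\mu(z,w)f(w)\mu(w)d\theta$ where $S_\mu(z,w)=\sum_n f_n(z)\overline{f_n(w)}$ for any orthonormal basis $(f_n)$ of $\mathcal{H}^2(\mathbb{T},\mu)$.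 ''$\mathbf{S}_\mu$ is bounded on $L^p(\mathbb{T},\mu)$'' means there is $C$ with $\|\mathbf{S}_\mu f\|_{p,\mu}\le C\|f\|_{p,\mu}$ for all $f\in L^2(\mathbb{T},\mu)\cap L^p(\mathbb{T},\mu)$. *)

(* Defs.v *)
From HB Require Import structures.
From mathcomp Require Import all_boot all_order all_algebra.
From mathcomp Require Import all_classical all_reals all_analysis.
From mathcomp Require Import Rstruct Rstruct_topology.
From Stdlib Require Import Reals.
From Coquelicot Require Coquelicot.

Set Implicit Arguments.
Unset Strict Implicit.
Unset Printing Implicit Defensive.

Import Order.TTheory GRing.Theory Num.Theory.

Notation cplx := Coquelicot.Complex.C.
Notation Cmod := Coquelicot.Complex.Cmod.
Notation Cmult := Coquelicot.Complex.Cmult.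
Notation Cminus := Coquelicot.Complex.Cminus.
Notation Cconj := Coquelicot.Complex.Cconj.

Definition polar (r θ : R) : cplx := (Rmult r (cos θ), Rmult r (sin θ)).

Definition holo_on_disc (f : cplx -> cplx) : Prop :=
  forall z : cplx, Rlt (Cmod z) 1%R ->
    @Coquelicot.Derive.ex_derive Coquelicot.Complex.C_AbsRing
      Coquelicot.Complex.C_NormedModule f z.

Definition cont_on_closed_disc (f : cplx -> cplx) : Prop :=
  forall z : cplx, Rle (Cmod z) 1%R ->
    forall eps : R, Rlt 0%R eps -> exists delta : R, Rlt 0%R delta /\
      forall w : cplx, Rle (Cmod w) 1%R -> Rlt (Cmod (Cminus w z)) delta ->
        Rlt (Cmod (Cminus (f w) (f z))) eps.

Definition admissible_weight (g : cplx -> cplx) : Prop :=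
  [/\ holo_on_disc g, cont_on_closed_disc g &
      forall z : cplx, Rlt (Cmod z) 1%R -> g z <> (0%R, 0%R)].

Local Open Scope classical_set_scope.
Local Open Scope ring_scope.

(* The unit circle T, parametrized by theta in [0, 2 pi], with arc length
   measure d theta = Lebesgue measure. *)
Notation Rm := (measurableTypeR R).
Definition Tpar : set Rm := `[0%R, (2 * PI)%R].

Definition mu (g : cplx -> cplx) (θ : R) : R := (Cmod (g (polar 1 θ))) ^+ 2.

(* boundary functions on T are functions of theta *)
Definition cmeasurable (f : R -> cplx) : Prop :=
  measurable_fun Tpar ((fun θ => (f θ).1) : Rm -> Rm) /\
  measurable_fun Tpar ((fun θ => (f θ).2) : Rm -> Rm).

Definition pnorm_pow (g : cplx -> cplx) (p : R) (f : R -> cplx) : \bar R :=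
  (\int[@lebesgue_measure R]_(θ in Tpar) ((Cmod (f θ)) `^ p * mu g θ)%:E)%E.

Definition Lp (g : cplx -> cplx) (p : R) (f : R -> cplx) : Prop :=
  cmeasurable f /\ (pnorm_pow g p f < +oo)%E.

(* weighted Hardy space H^p(T, mu), identified with boundary values:
   h is the a.e. radial boundary function of some holomorphic F on D with
   sup_{0<=r<1} \int_0^{2pi} |F(r e^{i theta})|^p |g(r e^{i theta})|^2 < oo. *)
Definition Hp (g : cplx -> cplx) (p : R) (h : R -> cplx) : Prop :=
  Lp g p h /\
  exists F : cplx -> cplx, holo_on_disc F /\
    (exists M : R, forall r : R, 0 <= r < 1 ->
      (\int[@lebesgue_measure R]_(θ in Tpar)
         ((Cmod (F (polar r θ))) `^ p * (Cmod (g (polar r θ))) ^+ 2)%:E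
       <= M%:E)%E) /\
    {ae @lebesgue_measure R, forall θ, Tpar θ ->
       ((fun r => (F (polar r θ)).1) @ (1%R)^'- --> (h θ).1) /\
       ((fun r => (F (polar r θ)).2) @ (1%R)^'- --> (h θ).2)}.

Definition orth (g : cplx -> cplx) (u v : R -> cplx) : Prop :=
  (\int[@lebesgue_measure R]_(θ in Tpar)
     ((Cmult (u θ) (Cconj (v θ))).1 * mu g θ)%:E = 0)%E /\
  (\int[@lebesgue_measure R]_(θ in Tpar)
     ((Cmult (u θ) (Cconj (v θ))).2 * mu g θ)%:E = 0)%E.

Definition szego_proj (g : cplx -> cplx) (f h : R -> cplx) : Prop :=
  Hp g 2 h /\
  forall k : R -> cplx, Hp g 2 k -> orth g (fun θ => Cminus (f θ) (h θ)) k.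

(* S_mu bounded on L^p(T,mu):  ||S_mu f||_{p,mu} <= C ||f||_{p,mu}
   for all f in L^2 \cap L^p (stated with p-th powers of the norms). *)
Definition szego_bounded (g : cplx -> cplx) (p : R) : Prop :=
  exists K : R, 0 <= K /\
    forall f h : R -> cplx, Lp g 2 f -> Lp g p f -> szego_proj g f h ->
      (pnorm_pow g p h <= (K `^ p)%:E * pnorm_pow g p f)%E.

(* Main.v *)
(* With [a = 1 / (p0 - 2)] and [g = (1 - z)^a], the projection of [f] is [C(f g) / g], where [C] is
   the unweighted Cauchy-Szego transform, and [|f|^p |g|^2 = |f g|^p |1 - z|^(a (2 - p))] on the
   circle. Hence the question is whether [C] is bounded on [L^p] with the weight
   [|1 - z|^(a (2 - p))], and [q0 < p < p0] says exactly that this is an A_p weight.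

   For [q0 < p < 2] put [al = a (2 - p) < p - 1]. If [v >= 0] and [H = u + i w] is holomorphic with
   real part the Poisson integral [u] of [v], then [H^p (1 - z)^al] is holomorphic, and a pointwise
   inequality [1 <= A cos(x)^p - B cos(p x + al y)] on [|x|, |y| < pi/2] bounds [|H|^p |1 - z|^al]
   by [A u^p |1 - z|^al] minus [B Re(H^p (1 - z)^al)], whose mean over a circle is known (Stein's proof of
   the theorem of M. Riesz). The Poisson integral is controlled by Jensen's inequality, because
   the Poisson integral of [|1 - z|^al] is at most a multiple of [Re (1 - z)^al]. For [2 < p < p0] one
   uses duality.

   For [p >= p0] the function [conj g / g] is bounded but its projection [1 / g] is not in [L^p].
   For [p <= q0] the functions [P_r / g], with [P_r] the Poisson kernel at [r], have the projections
   [1 / (g (1 - r z))], and the ratio of the norms is unbounded as [r -> 1]. *)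
Require Import Defs.
From Stdlib Require Import Reals.
From Stdlib Require Lra Lia ClassicalEpsilon.
From Coquelicot Require Coquelicot.
From mathcomp Require all_boot all_order all_algebra all_classical all_reals all_analysis.
From mathcomp Require Rstruct Rstruct_topology measurable_realfun lra.

(** The elements of the weighted Hardy space are known only through radial limits almost everywhere
    and a bound on the circular means of [|F g|^2]. The upper estimates are therefore proved on
    circles of radius [r < 1] with the weight [|1 - r e^(it)|^al] and constants independent of [r],
    and [r] then tends to 1. Identities pass to the limit because pointwise convergence together
    with bounded mean squares gives convergence of integrals; inequalities pass by Fatou's lemma.

    The direct estimate is made below 2 because only there is [al = a (2 - p)] positive. Then
    [|1 - z|^al] is bounded and, as [al < 1], the modulus of [(1 - z)^al] is comparable with its
    real part. Above 2 the weight is unbounded, and duality avoids it.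

    The choice of [a] gives [a (p0 - 2) = 1] and, the exponents being conjugate,
    [a (2 - q0) = q0 - 1]. Both endpoints thus meet the same borderline density [1 / |1 - z|], which
    fails to be integrable only by a logarithm; this is why they are excluded along with the
    exponents beyond them. *)

Module CplxAnalysis.
Import Lra Lia ClassicalEpsilon Coquelicot.Coquelicot.
Local Open Scope C_scope.

(** * Continuity and complex differentiability *)

Definition Ccont (f : C -> C) (z : C) : Prop :=
  forall e : R, (0 < e)%R -> exists d : R, (0 < d)%R /\
    forall w, (Cmod (w - z) < d)%R -> (Cmod (f w - f z) < e)%R.

(* Caratheodory's form of complex differentiability. *)
Definition Cder (f : C -> C) (z l : C) : Prop :=
  exists phi : C -> C, phi z = l /\ Ccont phi z /\
    exists d : R, (0 < d)%R /\
      forall w, (Cmod (w - z) < d)%R -> f w - f z = phi w * (w - z).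

Lemma Cmod_sub_sym (a b : C) : Cmod (a - b) = Cmod (b - a).
Proof. rewrite <- Cmod_opp. f_equal. ring. Qed.

Lemma Cmod_le_abs (z : C) : (Cmod z <= Rabs (fst z) + Rabs (snd z))%R.
Proof.
destruct z as [x y]; simpl.
replace (x, y) with (RtoC x + RtoC y * Ci) by (unfold RtoC, Ci, Cplus, Cmult; simpl; f_equal; ring).
eapply Rle_trans; [apply Cmod_triangle|].
rewrite Cmod_mult, !Cmod_R, Cmod_Ci; lra.
Qed.

Lemma im_le_Cmod (z : C) : (Rabs (snd z) <= Cmod z)%R.
Proof. eapply Rle_trans; [|apply Rmax_Cmod]. apply Rmax_r. Qed.

Lemma Ccont_ext_loc (f g : C -> C) (z : C) (d : R) : (0 < d)%R ->
  (forall w, (Cmod (w - z) < d)%R -> f w = g w) -> Ccont f z -> Ccont g z.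
Proof.
intros Hd H Hf e He. destruct (Hf e He) as [d1 [Hd1 H1]].
exists (Rmin d d1). split; [apply Rmin_pos; auto|]. intros w Hw.
rewrite <- !H; [apply H1| | ].
- eapply Rlt_le_trans; [exact Hw|apply Rmin_r].
- replace (z - z) with (RtoC 0) by ring. rewrite Cmod_0; auto.
- eapply Rlt_le_trans; [exact Hw|apply Rmin_l].
Qed.

Lemma Ccont_const (c z : C) : Ccont (fun _ => c) z.
Proof.
intros e He. exists 1%R; split; [lra|]. intros w _.
replace (c - c) with (RtoC 0) by ring. rewrite Cmod_0; auto.
Qed.

Lemma Ccont_id (z : C) : Ccont (fun w => w) z.
Proof. intros e He. exists e; split; auto. Qed.

Lemma Ccont_plus (f g : C -> C) (z : C) :
  Ccont f z -> Ccont g z -> Ccont (fun w => f w + g w) z.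
Proof.
intros Hf Hg e He.
destruct (Hf (e / 2)%R ltac:(lra)) as [d1 [Hd1 H1]].
destruct (Hg (e / 2)%R ltac:(lra)) as [d2 [Hd2 H2]].
exists (Rmin d1 d2). split; [apply Rmin_pos; auto|]. intros w Hw.
assert (A1 := H1 w (Rlt_le_trans _ _ _ Hw (Rmin_l _ _))).
assert (A2 := H2 w (Rlt_le_trans _ _ _ Hw (Rmin_r _ _))).
replace (f w + g w - (f z + g z)) with ((f w - f z) + (g w - g z)) by ring.
eapply Rle_lt_trans; [apply Cmod_triangle|]. lra.
Qed.

Lemma Ccont_mult (f g : C -> C) (z : C) :
  Ccont f z -> Ccont g z -> Ccont (fun w => f w * g w) z.
Proof.
intros Hf Hg e He.
set (A := Cmod (f z)). set (B := Cmod (g z)).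
assert (HA : (0 <= A)%R) by apply Cmod_ge_0.
assert (HB : (0 <= B)%R) by apply Cmod_ge_0.
assert (Hk : (0 < e / (A + B + 1))%R) by (apply Rdiv_lt_0_compat; lra).
set (k := Rmin 1 (e / (A + B + 1))).
assert (Hk0 : (0 < k)%R) by (apply Rmin_pos; lra).
destruct (Hf k Hk0) as [d1 [Hd1 H1]].
destruct (Hg k Hk0) as [d2 [Hd2 H2]].
exists (Rmin d1 d2). split; [apply Rmin_pos; auto|]. intros w Hw.
assert (A1 := H1 w (Rlt_le_trans _ _ _ Hw (Rmin_l _ _))).
assert (A2 := H2 w (Rlt_le_trans _ _ _ Hw (Rmin_r _ _))).
replace (f w * g w - f z * g z) with
  ((f w - f z) * (g w - g z) + (f z * (g w - g z) + g z * (f w - f z))) by ring.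
eapply Rle_lt_trans; [apply Cmod_triangle|].
eapply Rle_lt_trans; [apply Rplus_le_compat_l; apply Cmod_triangle|].
rewrite !Cmod_mult. fold A B.
assert (K1 : (k <= 1)%R) by apply Rmin_l.
assert (K2 : (k * (A + B + 1) <= e)%R).
{ apply Rle_trans with (e / (A + B + 1) * (A + B + 1))%R.
  - apply Rmult_le_compat_r; [lra|apply Rmin_r].
  - right; field; lra. }
assert (P1 := Cmod_ge_0 (f w - f z)). assert (P2 := Cmod_ge_0 (g w - g z)).
nra.
Qed.

Lemma Ccont_comp (f g : C -> C) (z : C) :
  Ccont g z -> Ccont f (g z) -> Ccont (fun w => f (g w)) z.
Proof.
intros Hg Hf e He. destruct (Hf e He) as [d1 [Hd1 H1]].
destruct (Hg d1 Hd1) as [d2 [Hd2 H2]]. exists d2; split; auto.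
Qed.

Lemma Ccont_inv (z : C) : z <> 0 -> Ccont Cinv z.
Proof.
intros Hz e He.
assert (Hm : (0 < Cmod z)%R) by (apply Cmod_gt_0; auto).
set (m := Cmod z) in *.
exists (Rmin (m / 2) (e * m * m / 2)). split.
{ apply Rmin_pos; [lra|]. assert (0 < e * m)%R by (apply Rmult_lt_0_compat; auto).
  assert (0 < e * m * m)%R by (apply Rmult_lt_0_compat; auto). lra. }
intros w Hw.
assert (W1 := Rlt_le_trans _ _ _ Hw (Rmin_l _ _)).
assert (W2 := Rlt_le_trans _ _ _ Hw (Rmin_r _ _)).
assert (Hwm : (m / 2 < Cmod w)%R).
{ assert (T := Cmod_triangle (z - w) w). replace (z - w + w) with z in T by ring.
  rewrite Cmod_sub_sym in T. fold m in T. lra. }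
assert (Hw0 : w <> 0) by (apply Cmod_gt_0; lra).
replace (/ w - / z) with ((z - w) / (w * z)) by (field; auto).
rewrite Cmod_div by (apply Cmult_neq_0; auto).
rewrite Cmod_mult, Cmod_sub_sym. fold m.
assert (Hp : (0 < Cmod w * m)%R) by (apply Rmult_lt_0_compat; lra).
apply (Rmult_lt_reg_r (Cmod w * m)); auto.
unfold Rdiv. rewrite Rmult_assoc, Rinv_l, Rmult_1_r by lra.
eapply Rlt_trans; [exact W2|].
assert (0 < e * m)%R by (apply Rmult_lt_0_compat; auto). nra.
Qed.

Lemma Cder_cont (f : C -> C) (z l : C) : Cder f z l -> Ccont f z.
Proof.
intros [phi [_ [Hc [d [Hd H]]]]].
apply (Ccont_ext_loc (fun w => f z + phi w * (w - z)) f z d); auto.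
- intros w Hw. rewrite <- H; auto. ring.
- apply Ccont_plus; [apply Ccont_const|].
  apply Ccont_mult; auto.
  apply (Ccont_plus (fun w => w) (fun _ => - z)); [apply Ccont_id|apply Ccont_const].
Qed.

Lemma Cder_const (c z : C) : Cder (fun _ => c) z 0.
Proof.
exists (fun _ => 0). split; auto. split; [apply Ccont_const|].
exists 1%R; split; [lra|]. intros; ring.
Qed.

Lemma Cder_id (z : C) : Cder (fun w => w) z 1.
Proof.
exists (fun _ => 1). split; auto. split; [apply Ccont_const|].
exists 1%R; split; [lra|]. intros; ring.
Qed.

Lemma Cder_plus (f g : C -> C) (z l m : C) :
  Cder f z l -> Cder g z m -> Cder (fun w => f w + g w) z (l + m).
Proof.
intros [p [<- [Hp [d1 [Hd1 H1]]]]] [q [<- [Hq [d2 [Hd2 H2]]]]].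
exists (fun w => p w + q w). split; auto. split; [apply Ccont_plus; auto|].
exists (Rmin d1 d2); split; [apply Rmin_pos; auto|]. intros w Hw.
rewrite Cmult_plus_distr_r, <- H1, <- H2; [ring| |];
  eapply Rlt_le_trans; [exact Hw|apply Rmin_r|exact Hw|apply Rmin_l].
Qed.

Lemma Cder_mult (f g : C -> C) (z l m : C) :
  Cder f z l -> Cder g z m -> Cder (fun w => f w * g w) z (l * g z + f z * m).
Proof.
intros Df Dg. assert (Cf := Cder_cont _ _ _ Df).
destruct Df as [p [<- [Hp [d1 [Hd1 H1]]]]]. destruct Dg as [q [<- [Hq [d2 [Hd2 H2]]]]].
exists (fun w => p w * g z + f w * q w). split; auto. split.
{ apply Ccont_plus; apply Ccont_mult; auto. apply Ccont_const. }
exists (Rmin d1 d2); split; [apply Rmin_pos; auto|]. intros w Hw.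
replace (f w * g w - f z * g z) with ((f w - f z) * g z + f w * (g w - g z)) by ring.
rewrite H1, H2; [ring| |];
  eapply Rlt_le_trans; [exact Hw|apply Rmin_r|exact Hw|apply Rmin_l].
Qed.

Lemma Cder_comp (f g : C -> C) (z l m : C) :
  Cder g z m -> Cder f (g z) l -> Cder (fun w => f (g w)) z (l * m).
Proof.
intros Dg Df. assert (Cg := Cder_cont _ _ _ Dg).
destruct Df as [p [<- [Hp [d1 [Hd1 H1]]]]]. destruct Dg as [q [<- [Hq [d2 [Hd2 H2]]]]].
exists (fun w => p (g w) * q w). split; auto. split.
{ apply Ccont_mult; auto. apply (Ccont_comp p g); auto. }
destruct (Cg d1 Hd1) as [d3 [Hd3 H3]].
exists (Rmin d2 d3); split; [apply Rmin_pos; auto|]. intros w Hw.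
rewrite H1, H2; [ring| |].
- eapply Rlt_le_trans; [exact Hw|apply Rmin_l].
- apply H3. eapply Rlt_le_trans; [exact Hw|apply Rmin_r].
Qed.

Lemma Cder_inv (z : C) : z <> 0 -> Cder Cinv z (- / (z * z)).
Proof.
intros Hz. exists (fun w => - / z * / w). split; [field; auto|]. split.
{ apply Ccont_mult; [apply Ccont_const|apply Ccont_inv; auto]. }
assert (Hm : (0 < Cmod z)%R) by (apply Cmod_gt_0; auto).
exists (Cmod z); split; auto. intros w Hw.
assert (w <> 0).
{ intros ->. rewrite Cmod_sub_sym in Hw. replace (z - 0) with z in Hw by ring. lra. }
field; auto.
Qed.

(** Links Caratheodory's form to the derivative in [holo_on_disc]: the slope function is the
    difference quotient, completed by [l] at [z]. *)
Lemma Cder_is_derive (f : C -> C) (z l : C) :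
  Cder f z l <-> @is_derive C_AbsRing C_NormedModule f z l.
Proof.
split.
- intros [phi [<- [Hc [d [Hd H]]]]]. split; [apply is_linear_scal_l|].
  intros x Hx eps.
  assert (x = z) as -> by (symmetry; apply is_filter_lim_locally_unique; auto).
  destruct (Hc eps (cond_pos eps)) as [d2 [Hd2 H2]].
  assert (Hm : (0 < Rmin d d2)%R) by (apply Rmin_pos; auto).
  exists (mkposreal _ Hm). intros w Hw.
  change (Cmod (w - z) < Rmin d d2)%R in Hw.
  change (Cmod (f w - f z - (w - z) * phi z) <= eps * Cmod (w - z))%R.
  rewrite H by (eapply Rlt_le_trans; [exact Hw|apply Rmin_l]).
  replace (phi w * (w - z) - (w - z) * phi z) with ((phi w - phi z) * (w - z)) by ring.
  rewrite Cmod_mult. apply Rmult_le_compat_r; [apply Cmod_ge_0|].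
  apply Rlt_le, H2. eapply Rlt_le_trans; [exact Hw|apply Rmin_r].
- intros [_ Hd].
  assert (Hd' := Hd z (fun P HP => HP)). clear Hd.
  exists (fun w => if Ceq_dec w z then l else (f w - f z) / (w - z)).
  split; [destruct (Ceq_dec z z); congruence|]. split.
  + intros e He.
    assert (He2 : (0 < e / 2)%R) by lra.
    destruct (Hd' (mkposreal _ He2)) as [d Hdd].
    exists d; split; [apply cond_pos|]. intros w Hw.
    destruct (Ceq_dec z z) as [_|]; [|congruence].
    destruct (Ceq_dec w z) as [->|Hwz].
    * replace (l - l) with (RtoC 0) by ring. rewrite Cmod_0; auto.
    * assert (A := Hdd w Hw).
      change (Cmod (f w - f z - (w - z) * l) <= e / 2 * Cmod (w - z))%R in A.
      assert (N : w - z <> 0) by (intros E; apply Hwz; replace w with (w - z + z) by ring; rewrite E; ring).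
      replace ((f w - f z) / (w - z) - l) with ((f w - f z - (w - z) * l) / (w - z)) by (field; auto).
      rewrite Cmod_div by auto.
      assert (Hp : (0 < Cmod (w - z))%R) by (apply Cmod_gt_0; auto).
      apply Rle_lt_trans with (e / 2)%R; [|lra].
      apply (Rmult_le_reg_r (Cmod (w - z))); auto.
      unfold Rdiv at 1. rewrite Rmult_assoc, Rinv_l, Rmult_1_r by lra. exact A.
  + exists 1%R; split; [lra|]. intros w _.
    destruct (Ceq_dec w z) as [->|Hwz]; [ring|].
    assert (N : w - z <> 0) by (intros E; apply Hwz; replace w with (w - z + z) by ring; rewrite E; ring).
    field; auto.
Qed.

(** * Exponential, logarithm and real powers of a complex number *)

Definition cexp (z : C) : C := (exp (fst z) * cos (snd z), exp (fst z) * sin (snd z))%R.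
(** [atan (y / x)] is the argument only for a positive real part; the bases of the powers taken
    later lie in that half plane. *)
Definition carg (z : C) : R := atan (snd z / fst z).
Definition clog (z : C) : C := (ln (Cmod z), carg z).

Lemma C_ext (z w : C) : fst z = fst w -> snd z = snd w -> z = w.
Proof. destruct z, w; simpl; intros; subst; auto. Qed.

Lemma cexp_plus (a b : C) : cexp (a + b) = cexp a * cexp b.
Proof.
apply C_ext; simpl; rewrite exp_plus, ?cos_plus, ?sin_plus; ring.
Qed.

Lemma cexp_0 : cexp 0 = 1.
Proof. apply C_ext; simpl; rewrite exp_0, ?cos_0, ?sin_0; ring. Qed.

Lemma Cmod_cexp (z : C) : Cmod (cexp z) = exp (fst z).
Proof.
unfold Cmod, cexp; simpl.
replace (exp (fst z) * cos (snd z) * (exp (fst z) * cos (snd z) * 1) +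
  exp (fst z) * sin (snd z) * (exp (fst z) * sin (snd z) * 1))%R with
  ((exp (fst z) * exp (fst z)) * (Rsqr (sin (snd z)) + Rsqr (cos (snd z))))%R by (unfold Rsqr; ring).
rewrite sin2_cos2, Rmult_1_r. apply sqrt_square, Rlt_le, exp_pos.
Qed.

Lemma cexp_neq_0 (z : C) : cexp z <> 0.
Proof. apply Cmod_gt_0. rewrite Cmod_cexp. apply exp_pos. Qed.

Lemma Cmod_cos_carg (z : C) : (0 < fst z)%R -> (Cmod z * cos (carg z) = fst z)%R.
Proof.
destruct z as [x y]; simpl; intros Hx. unfold carg, Cmod; simpl.
rewrite cos_atan. rewrite !Rmult_1_r.
replace (x * x + y * y)%R with (x * x * (1 + Rsqr (y / x)))%R by (unfold Rsqr; field; lra).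
assert (0 < 1 + Rsqr (y / x))%R by (generalize (Rle_0_sqr (y/x)); lra).
rewrite sqrt_mult, sqrt_square by nra.
field. apply Rgt_not_eq, sqrt_lt_R0; auto.
Qed.

Lemma Cmod_sin_carg (z : C) : (0 < fst z)%R -> (Cmod z * sin (carg z) = snd z)%R.
Proof.
destruct z as [x y]; simpl; intros Hx. unfold carg, Cmod; simpl.
rewrite sin_atan. rewrite !Rmult_1_r.
replace (x * x + y * y)%R with (x * x * (1 + Rsqr (y / x)))%R by (unfold Rsqr; field; lra).
assert (0 < 1 + Rsqr (y / x))%R by (generalize (Rle_0_sqr (y/x)); lra).
rewrite sqrt_mult, sqrt_square by nra.
field. split; [lra|]. apply Rgt_not_eq, sqrt_lt_R0; auto.
Qed.

Lemma carg_bound (z : C) : (- PI / 2 < carg z < PI / 2)%R.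
Proof. unfold carg; apply atan_bound. Qed.

Lemma Cmod_pos_of_re (z : C) : (0 < fst z)%R -> (0 < Cmod z)%R.
Proof. intros H. eapply Rlt_le_trans; [exact H|]. eapply Rle_trans; [apply Rle_abs|apply re_le_Cmod]. Qed.

Lemma cexp_clog (z : C) : (0 < fst z)%R -> cexp (clog z) = z.
Proof.
intros H. apply C_ext; simpl; rewrite exp_ln by (apply Cmod_pos_of_re; auto).
- apply Cmod_cos_carg; auto.
- apply Cmod_sin_carg; auto.
Qed.

(** The real derivatives of [exp], [sin] and [cos] at 0 give the differentiability of [cexp] there;
    the addition formula then carries it to every point. *)
Lemma cexp_sub1_bound (e : R) : (0 < e)%R -> exists d, (0 < d)%R /\
  forall h, (Cmod h < d)%R -> (Cmod (cexp h - 1 - h) <= e * Cmod h)%R.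
Proof.
intros He.
(* With [m = |h|], the real part of the error is at most [3 k m] and the imaginary part at most
   [5 k m]. *)
set (k := Rmin 1 (e / 8)).
assert (Hk : (0 < k)%R) by (apply Rmin_pos; lra).
assert (Hk1 : (k <= 1)%R) by apply Rmin_l.
assert (Hk2 : (k <= e / 8)%R) by apply Rmin_r.
assert (D1 := derivable_pt_lim_exp 0). rewrite exp_0 in D1.
assert (D2 := derivable_pt_lim_sin 0). rewrite cos_0 in D2.
assert (D3 := derivable_pt_lim_cos 0). rewrite sin_0, Ropp_0 in D3.
assert (G : forall f l, derivable_pt_lim f 0 l -> exists d, (0 < d)%R /\
  forall h, (Rabs h < d -> Rabs (f h - f 0 - l * h) <= k * Rabs h)%R).
{ intros f l D. destruct (D k Hk) as [d Hd]. exists d; split; [apply cond_pos|].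
  intros h Hh. destruct (Req_dec h 0) as [->|N].
  - replace (f 0 - f 0 - l * 0)%R with 0%R by ring. rewrite Rabs_R0; lra.
  - assert (A := Hd h N Hh). rewrite Rplus_0_l in A.
    replace (f h - f 0 - l * h)%R with (((f h - f 0) / h - l) * h)%R by (field; auto).
    rewrite Rabs_mult. apply Rmult_le_compat_r; [apply Rabs_pos|lra]. }
destruct (G _ _ D1) as [d1 [Hd1 B1]]. destruct (G _ _ D2) as [d2 [Hd2 B2]].
destruct (G _ _ D3) as [d3 [Hd3 B3]]. rewrite exp_0 in B1. rewrite sin_0 in B2. rewrite cos_0 in B3.
exists (Rmin (Rmin d1 1) (Rmin (Rmin d2 d3) k)). split; [repeat apply Rmin_pos; lra|].
intros [x y] Hh.
assert (Hx := re_le_Cmod (x, y)). assert (Hy := im_le_Cmod (x, y)).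
simpl in Hx, Hy.
set (m := Cmod (x, y)) in *.
assert (M1 : (m < d1 /\ m < 1 /\ m < d2 /\ m < d3 /\ m < k)%R).
{ assert (T1 := Rmin_l (Rmin d1 1) (Rmin (Rmin d2 d3) k)).
  assert (T2 := Rmin_r (Rmin d1 1) (Rmin (Rmin d2 d3) k)).
  assert (T3 := Rmin_l d1 1). assert (T4 := Rmin_r d1 1).
  assert (T5 := Rmin_l (Rmin d2 d3) k). assert (T6 := Rmin_r (Rmin d2 d3) k).
  assert (T7 := Rmin_l d2 d3). assert (T8 := Rmin_r d2 d3). lra. }
destruct M1 as [M1 [M2 [M3 [M4 M5]]]].
assert (E1 := B1 x ltac:(lra)). assert (E2 := B2 y ltac:(lra)). assert (E3 := B3 y ltac:(lra)).
rewrite Rmult_1_l in E1, E2. rewrite Rmult_0_l in E3.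
eapply Rle_trans; [apply Cmod_le_abs|]. simpl.
assert (Hm : (0 <= m)%R) by apply Cmod_ge_0.
assert (Ax := Rabs_pos x). assert (Ay := Rabs_pos y).
assert (C1 : (Rabs (cos y) <= 1)%R) by (apply Rabs_le; generalize (COS_bound y); lra).
assert (C2 : (Rabs (sin y) <= 2 * Rabs y)%R).
{ replace (sin y) with ((sin y - 0 - y) + y)%R by ring.
  eapply Rle_trans; [apply Rabs_triang|]. nra. }
replace (exp x * cos y + - (1) + - x)%R with
  ((exp x - 1 - x) * cos y + (1 + x) * (cos y - 1 - 0))%R by ring.
replace (exp x * sin y + - 0 + - y)%R with
  ((exp x - 1 - x) * sin y + x * sin y + (sin y - 0 - y))%R by ring.
assert (F1 : (Rabs ((exp x - 1 - x) * cos y + (1 + x) * (cos y - 1 - 0)) <= k * m + 2 * (k * m))%R).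
{ eapply Rle_trans; [apply Rabs_triang|]. rewrite !Rabs_mult.
  assert (Rabs (1 + x) <= 2)%R by (eapply Rle_trans; [apply Rabs_triang|]; rewrite Rabs_R1; lra).
  assert (P1 := Rabs_pos (exp x - 1 - x)). assert (P2 := Rabs_pos (cos y)).
  assert (P3 := Rabs_pos (cos y - 1 - 0)). assert (P4 := Rabs_pos (1 + x)).
  assert (Rabs (exp x - 1 - x) * Rabs (cos y) <= Rabs (exp x - 1 - x) * 1)%R by (apply Rmult_le_compat_l; auto).
  assert (Rabs (1 + x) * Rabs (cos y - 1 - 0) <= 2 * (k * m))%R by (apply Rmult_le_compat; try nra).
  nra. }
assert (F2 : (Rabs ((exp x - 1 - x) * sin y + x * sin y + (sin y - 0 - y)) <= 5 * (k * m))%R).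
{ eapply Rle_trans; [apply Rabs_triang|].
  eapply Rle_trans; [apply Rplus_le_compat_r, Rabs_triang|]. rewrite !Rabs_mult.
  assert (P1 := Rabs_pos (exp x - 1 - x)). assert (P2 := Rabs_pos (sin y)).
  assert (Rabs (exp x - 1 - x) * Rabs (sin y) <= (k * m) * 2)%R by (apply Rmult_le_compat; nra).
  assert (Rabs x * Rabs (sin y) <= k * (2 * m))%R by (apply Rmult_le_compat; nra).
  nra. }
nra.
Qed.

Lemma Cder_cexp (z : C) : Cder cexp z (cexp z).
Proof.
exists (fun w => if Ceq_dec w z then cexp z else (cexp w - cexp z) / (w - z)).
split; [destruct (Ceq_dec z z); congruence|]. split.
- intros e He.
  assert (Hm : (0 < Cmod (cexp z))%R) by (rewrite Cmod_cexp; apply exp_pos).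
  destruct (cexp_sub1_bound (e / (2 * Cmod (cexp z)))) as [d [Hd B]].
  { apply Rdiv_lt_0_compat; lra. }
  exists d; split; auto. intros w Hw.
  destruct (Ceq_dec z z) as [_|]; [|congruence].
  destruct (Ceq_dec w z) as [->|Hwz].
  + replace (cexp z - cexp z) with (RtoC 0) by ring. rewrite Cmod_0; auto.
  + assert (N : w - z <> 0) by (intros E; apply Hwz; replace w with (w - z + z) by ring; rewrite E; ring).
    replace (cexp w) with (cexp z * cexp (w - z)) by (rewrite <- cexp_plus; f_equal; ring).
    replace ((cexp z * cexp (w - z) - cexp z) / (w - z) - cexp z) with
      (cexp z * (cexp (w - z) - 1 - (w - z)) / (w - z)) by (field; auto).
    rewrite Cmod_div, Cmod_mult by auto.
    assert (Hp : (0 < Cmod (w - z))%R) by (apply Cmod_gt_0; auto).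
    apply Rle_lt_trans with (e / 2)%R; [|lra].
    apply (Rmult_le_reg_r (Cmod (w - z))); auto.
    unfold Rdiv at 1. rewrite Rmult_assoc, Rinv_l, Rmult_1_r by lra.
    eapply Rle_trans; [apply Rmult_le_compat_l; [lra|apply B; auto]|].
    right. field. lra.
- exists 1%R; split; [lra|]. intros w _.
  destruct (Ceq_dec w z) as [->|Hwz]; [ring|].
  assert (N : w - z <> 0) by (intros E; apply Hwz; replace w with (w - z + z) by ring; rewrite E; ring).
  field; auto.
Qed.

Lemma continuity_pt_C (f : R -> R) (g : C -> R) (z : C) :
  (forall e, (0 < e)%R -> exists d, (0 < d)%R /\ forall w, (Cmod (w - z) < d)%R -> (Rabs (g w - g z) < e)%R) ->
  continuity_pt f (g z) ->
  forall e, (0 < e)%R -> exists d, (0 < d)%R /\ forall w, (Cmod (w - z) < d)%R -> (Rabs (f (g w) - f (g z)) < e)%R.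
Proof.
intros Hg Hf e He. destruct (Hf e He) as [d1 [Hd1 H1]].
destruct (Hg d1 Hd1) as [d2 [Hd2 H2]]. exists d2; split; auto. intros w Hw.
(* [continuity_pt] speaks only of points different from [g z]. *)
destruct (Req_dec (g w) (g z)) as [E|N].
- rewrite E. replace (f (g z) - f (g z))%R with 0%R by ring. rewrite Rabs_R0; auto.
- apply (H1 (g w)). split; [split; [exact I|auto]|]. apply H2; auto.
Qed.

Lemma Ccont_clog (z : C) : (0 < fst z)%R -> Ccont clog z.
Proof.
intros Hz.
assert (Hm := Cmod_pos_of_re z Hz).
assert (A1 : forall e, (0 < e)%R -> exists d, (0 < d)%R /\
   forall w, (Cmod (w - z) < d)%R -> (Rabs (ln (Cmod w) - ln (Cmod z)) < e)%R).
{ apply (continuity_pt_C ln Cmod).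
  - intros e He. exists e; split; auto. intros w Hw. eapply Rle_lt_trans; [|exact Hw].
    apply Rabs_le. assert (T1 := Cmod_triangle (w - z) z). assert (T2 := Cmod_triangle (z - w) w).
    replace (w - z + z) with w in T1 by ring. replace (z - w + w) with z in T2 by ring.
    rewrite Cmod_sub_sym in T2. lra.
  - apply derivable_continuous_pt. exists (/ Cmod z)%R. apply derivable_pt_lim_ln; auto. }
assert (A2 : forall e, (0 < e)%R -> exists d, (0 < d)%R /\
   forall w, (Cmod (w - z) < d)%R -> (Rabs (carg w - carg z) < e)%R).
{ apply (continuity_pt_C atan (fun w : C => (snd w / fst w)%R)).
  - intros e He.
    assert (Q : Ccont (fun w => RtoC (snd w) * / RtoC (fst w)) z).
    { apply Ccont_mult.
      - intros e' He'. exists e'; split; auto. intros w Hw. rewrite <- RtoC_minus, Cmod_R.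
        eapply Rle_lt_trans; [|exact Hw]. exact (im_le_Cmod (w - z)).
      - apply (Ccont_comp Cinv (fun w => RtoC (fst w))).
        + intros e' He'. exists e'; split; auto. intros w Hw. rewrite <- RtoC_minus, Cmod_R.
          eapply Rle_lt_trans; [|exact Hw]. exact (re_le_Cmod (w - z)).
        + apply Ccont_inv. intros E. apply (f_equal fst) in E. simpl in E. lra. }
    destruct (Q e He) as [d [Hd H]].
    exists (Rmin d (fst z)). split; [apply Rmin_pos; auto|]. intros w Hw.
    assert (W1 := Rlt_le_trans _ _ _ Hw (Rmin_l _ _)).
    assert (W2 := Rlt_le_trans _ _ _ Hw (Rmin_r _ _)).
    assert (Hw0 : (0 < fst w)%R).
    { assert (T := re_le_Cmod (w - z)). simpl in T.
      assert (Rabs (fst w + - fst z) < fst z)%R by (unfold Re in T; simpl in T; lra).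
      apply Rabs_def2 in H0. lra. }
    assert (K := H w W1).
    rewrite <- !RtoC_inv, <- !RtoC_mult, <- RtoC_minus, Cmod_R in K by lra. exact K.
  - apply derivable_continuous_pt, derivable_pt_atan. }
intros e He.
destruct (A1 (e / 2)%R ltac:(lra)) as [d1 [Hd1 H1]].
destruct (A2 (e / 2)%R ltac:(lra)) as [d2 [Hd2 H2]].
exists (Rmin d1 d2). split; [apply Rmin_pos; auto|]. intros w Hw.
eapply Rle_lt_trans; [apply Cmod_le_abs|]. simpl.
assert (B1 := H1 w (Rlt_le_trans _ _ _ Hw (Rmin_l _ _))).
assert (B2 := H2 w (Rlt_le_trans _ _ _ Hw (Rmin_r _ _))).
unfold Rminus in *. lra.
Qed.

(** Caratheodory's form makes the rule for inverse functions algebraic: if [phi] is the slope of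
    [cexp] at [clog z], then [/ phi (clog w)] is the slope of [clog] at [z]. *)
Lemma Cder_clog (z : C) : (0 < fst z)%R -> Cder clog z (/ z).
Proof.
intros Hz. assert (Hc := Ccont_clog z Hz).
destruct (Cder_cexp (clog z)) as [phi [E [Hp [d [Hd H]]]]].
rewrite cexp_clog in E by auto.
assert (Hz0 : z <> 0) by (intros ->; simpl in Hz; lra).
exists (fun w => / phi (clog w)). split; [rewrite E; auto|].
assert (Hpc : Ccont (fun w => phi (clog w)) z) by (apply (Ccont_comp phi clog); auto).
split.
{ apply (Ccont_comp Cinv (fun w => phi (clog w))); auto. apply Ccont_inv. rewrite E; auto. }
destruct (Hc d Hd) as [d1 [Hd1 H1]].
assert (Hm := Cmod_pos_of_re z Hz).
(* Within [d2] the slope differs from [z] by less than [|z|], so it does not vanish. *)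
destruct (Hpc (Cmod z) Hm) as [d2 [Hd2 H2]].
exists (Rmin (fst z) (Rmin d1 d2)). split; [repeat apply Rmin_pos; auto|]. intros w Hw.
assert (W1 := Rlt_le_trans _ _ _ Hw (Rmin_l _ _)).
assert (W := Rlt_le_trans _ _ _ Hw (Rmin_r _ _)).
assert (W2 := Rlt_le_trans _ _ _ W (Rmin_l _ _)).
assert (W3 := Rlt_le_trans _ _ _ W (Rmin_r _ _)).
assert (Hw0 : (0 < fst w)%R).
{ assert (T := re_le_Cmod (w - z)). unfold Re in T; simpl in T.
  assert (Rabs (fst w + - fst z) < fst z)%R by lra.
  apply Rabs_def2 in H0. lra. }
assert (K := H (clog w) (H1 w W2)).
rewrite !cexp_clog in K by auto. rewrite K.
assert (phi (clog w) <> 0).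
{ intros Z. assert (K2 := H2 w W3). rewrite E, Z in K2.
  rewrite Cmod_sub_sym in K2. replace (z - 0) with z in K2 by ring. lra. }
field; auto.
Qed.

Definition cpow (w : C) (s : R) : C := cexp (RtoC s * clog w).

Lemma Cder_cpow (f : C -> C) (z l : C) (s : R) : (0 < fst (f z))%R ->
  Cder f z l -> exists m, Cder (fun w => cpow (f w) s) z m.
Proof.
intros Hp Df. eexists. unfold cpow.
apply (Cder_comp cexp (fun w => RtoC s * clog (f w))); [|apply Cder_cexp].
apply (Cder_mult (fun _ => RtoC s) (fun w => clog (f w))); [apply Cder_const|].
apply (Cder_comp clog f); [exact Df|apply Cder_clog; auto].
Qed.

Lemma Cmod_cpow (w : C) (s : R) : Cmod (cpow w s) = exp (s * ln (Cmod w)).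
Proof. unfold cpow. rewrite Cmod_cexp. simpl. f_equal. ring. Qed.

Lemma re_cpow (w : C) (s : R) :
  fst (cpow w s) = (exp (s * ln (Cmod w)) * cos (s * carg w))%R.
Proof. unfold cpow, cexp, clog. simpl. f_equal; f_equal; ring. Qed.

Lemma re_cpow_mult (w v : C) (s t : R) :
  fst (cpow w s * cpow v t) =
  (exp (s * ln (Cmod w)) * exp (t * ln (Cmod v)) * cos (s * carg w + t * carg v))%R.
Proof.
unfold cpow. rewrite <- cexp_plus. unfold cexp, clog. simpl.
rewrite <- exp_plus. f_equal; f_equal; ring.
Qed.

Lemma cpow_neq_0 (w : C) (s : R) : cpow w s <> 0.
Proof. apply cexp_neq_0. Qed.

(** * Continuity and integration of complex functions of a real variable *)

Definition Rcont (u : R -> C) (t : R) : Prop :=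
  forall e : R, (0 < e)%R -> exists d : R, (0 < d)%R /\
    forall s, (Rabs (s - t) < d)%R -> (Cmod (u s - u t) < e)%R.

Lemma Rcont_fst (u : R -> C) (t : R) : Rcont u t -> continuous (fun s => fst (u s)) t.
Proof.
intros H. apply continuity_pt_filterlim. intros e He.
destruct (H e He) as [d [Hd K]]. exists d; split; auto. intros s [_ Hs].
eapply Rle_lt_trans; [exact (re_le_Cmod (u s - u t))|]. apply K, Hs.
Qed.

Lemma Rcont_snd (u : R -> C) (t : R) : Rcont u t -> continuous (fun s => snd (u s)) t.
Proof.
intros H. apply continuity_pt_filterlim. intros e He.
destruct (H e He) as [d [Hd K]]. exists d; split; auto. intros s [_ Hs].
eapply Rle_lt_trans; [exact (im_le_Cmod (u s - u t))|]. apply K, Hs.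
Qed.

Lemma Rcont_comp (f : C -> C) (u : R -> C) (t : R) :
  Rcont u t -> Ccont f (u t) -> Rcont (fun s => f (u s)) t.
Proof.
intros Hu Hf e He. destruct (Hf e He) as [d1 [Hd1 H1]].
destruct (Hu d1 Hd1) as [d [Hd K]]. exists d; split; auto.
Qed.

Lemma Rcont_const (c : C) (t : R) : Rcont (fun _ => c) t.
Proof.
intros e He. exists 1%R; split; [lra|]. intros w _.
replace (c - c) with (RtoC 0) by ring. rewrite Cmod_0; auto.
Qed.

Lemma Rcont_plus (u v : R -> C) (t : R) : Rcont u t -> Rcont v t -> Rcont (fun s => u s + v s) t.
Proof.
intros Hf Hg e He.
destruct (Hf (e / 2)%R ltac:(lra)) as [d1 [Hd1 H1]].
destruct (Hg (e / 2)%R ltac:(lra)) as [d2 [Hd2 H2]].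
exists (Rmin d1 d2). split; [apply Rmin_pos; auto|]. intros w Hw.
assert (A1 := H1 w (Rlt_le_trans _ _ _ Hw (Rmin_l _ _))).
assert (A2 := H2 w (Rlt_le_trans _ _ _ Hw (Rmin_r _ _))).
replace (u w + v w - (u t + v t)) with ((u w - u t) + (v w - v t)) by ring.
eapply Rle_lt_trans; [apply Cmod_triangle|]. lra.
Qed.

Lemma Rcont_scal (c : C) (u : R -> C) (t : R) : Rcont u t -> Rcont (fun s => c * u s) t.
Proof.
intros Hu. apply (Rcont_comp (fun z => c * z) u); auto.
apply Ccont_mult; [apply Ccont_const|apply Ccont_id].
Qed.

Lemma Rcont_hor (y t : R) : Rcont (fun x => (x, y)) t.
Proof.
intros e He. exists e; split; auto. intros s Hs.
replace ((s, y) - (t, y)) with (RtoC (s - t)); [rewrite Cmod_R; auto|].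
apply C_ext; simpl; ring.
Qed.

Lemma Rcont_ver (x t : R) : Rcont (fun y => (x, y)) t.
Proof.
intros e He. exists e; split; auto. intros s Hs.
replace ((x, s) - (x, t)) with (Ci * RtoC (s - t)) by (apply C_ext; simpl; ring).
rewrite Cmod_mult, Cmod_Ci, Cmod_R, Rmult_1_l; auto.
Qed.

Definition cInt (u : R -> C) (a b : R) : C :=
  (RInt (fun t => fst (u t)) a b, RInt (fun t => snd (u t)) a b).

Definition Rcont_on (u : R -> C) (a b : R) := forall t, (a <= t <= b)%R -> Rcont u t.

Lemma Rcont_on_sub (u : R -> C) (a b c d : R) :
  Rcont_on u a b -> (a <= c)%R -> (d <= b)%R -> Rcont_on u c d.
Proof. intros H H1 H2 t Ht. apply H; lra. Qed.

Lemma ex_RInt_fst (u : R -> C) (a b : R) : (a <= b)%R -> Rcont_on u a b ->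
  ex_RInt (fun t => fst (u t)) a b.
Proof.
intros Hab H. apply (@ex_RInt_continuous R_CompleteNormedModule). intros t Ht.
rewrite Rmin_left, Rmax_right in Ht by auto. apply Rcont_fst; auto.
Qed.

Lemma ex_RInt_snd (u : R -> C) (a b : R) : (a <= b)%R -> Rcont_on u a b ->
  ex_RInt (fun t => snd (u t)) a b.
Proof.
intros Hab H. apply (@ex_RInt_continuous R_CompleteNormedModule). intros t Ht.
rewrite Rmin_left, Rmax_right in Ht by auto. apply Rcont_snd; auto.
Qed.

Lemma cInt_ext (u v : R -> C) (a b : R) : (a <= b)%R ->
  (forall t, (a <= t <= b)%R -> u t = v t) -> cInt u a b = cInt v a b.
Proof.
intros Hab H. unfold cInt; f_equal; apply RInt_ext; intros t Ht;
  rewrite Rmin_left, Rmax_right in Ht by auto; rewrite H; auto; lra.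
Qed.

Lemma cInt_Chasles (u : R -> C) (a b c : R) : (a <= b)%R -> (b <= c)%R ->
  Rcont_on u a c -> cInt u a b + cInt u b c = cInt u a c.
Proof.
intros Hab Hbc H. unfold cInt. apply C_ext; simpl.
- apply (RInt_Chasles (fun t => fst (u t))); apply ex_RInt_fst; auto; eapply Rcont_on_sub; eauto; lra.
- apply (RInt_Chasles (fun t => snd (u t))); apply ex_RInt_snd; auto; eapply Rcont_on_sub; eauto; lra.
Qed.

Lemma cInt_plus (u v : R -> C) (a b : R) : (a <= b)%R ->
  Rcont_on u a b -> Rcont_on v a b ->
  cInt (fun t => u t + v t) a b = cInt u a b + cInt v a b.
Proof.
intros Hab Hu Hv. unfold cInt. apply C_ext; simpl.
- apply (RInt_plus (fun t => fst (u t)) (fun t => fst (v t))); apply ex_RInt_fst; auto.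
- apply (RInt_plus (fun t => snd (u t)) (fun t => snd (v t))); apply ex_RInt_snd; auto.
Qed.

(** The two components are estimated separately, whence the factor 2. *)
Lemma cInt_bound (u : R -> C) (a b M : R) : (a <= b)%R -> Rcont_on u a b ->
  (forall t, (a <= t <= b)%R -> (Cmod (u t) <= M)%R) ->
  (Cmod (cInt u a b) <= 2 * ((b - a) * M))%R.
Proof.
intros Hab Hu HM. eapply Rle_trans; [apply Cmod_le_abs|]. simpl.
assert (A1 : (Rabs (RInt (fun t => fst (u t)) a b) <= (b - a) * M)%R).
{ apply abs_RInt_le_const; auto; [apply ex_RInt_fst; auto|].
  intros t Ht. eapply Rle_trans; [exact (re_le_Cmod (u t))|auto]. }
assert (A2 : (Rabs (RInt (fun t => snd (u t)) a b) <= (b - a) * M)%R).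
{ apply abs_RInt_le_const; auto; [apply ex_RInt_snd; auto|].
  intros t Ht. eapply Rle_trans; [exact (im_le_Cmod (u t))|auto]. }
lra.
Qed.

Lemma RInt_affine (al be a b : R) :
  RInt (fun t => al + be * t)%R a b = (al * (b - a) + be * (b * b - a * a) / 2)%R.
Proof.
apply is_RInt_unique.
replace (al * (b - a) + be * (b * b - a * a) / 2)%R with
  (minus (al * b + be * (b * b) / 2) (al * a + be * (a * a) / 2))%R
  by (unfold minus, plus, opp; simpl; field).
apply (is_RInt_derive (fun t => al * t + be * (t * t) / 2)%R).
- intros t _. auto_derive; auto. field.
- intros t _. apply (continuous_plus (fun _ => al) (fun t => be * t)%R).
  + apply continuous_const.
  + apply (continuous_mult (fun _ => be) (fun t => t)); [apply continuous_const|apply continuous_id].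
Qed.

Lemma cInt_affine (p q : C) (a b : R) :
  cInt (fun t => p + RtoC t * q) a b = RtoC (b - a) * p + RtoC ((b * b - a * a) / 2) * q.
Proof.
unfold cInt. apply C_ext; simpl.
- rewrite (RInt_ext _ (fun t => fst p + fst q * t)%R) by (intros; simpl; ring).
  rewrite RInt_affine. field.
- rewrite (RInt_ext _ (fun t => snd p + snd q * t)%R) by (intros; simpl; ring).
  rewrite RInt_affine. field.
Qed.

Lemma cInt_const (p : C) (a b : R) : cInt (fun t => p) a b = RtoC (b - a) * p.
Proof.
assert (H := cInt_affine p 0 a b).
replace (cInt (fun t => p) a b) with (cInt (fun t => p + RtoC t * 0) a b).
- rewrite H. ring.
- unfold cInt; f_equal; apply RInt_ext; intros; simpl; ring.
Qed.

(* The integral of [psi] along the boundary of [x1,x2] x [y1,y2], counterclockwise. *)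
Definition bdInt (psi : C -> C) (x1 x2 y1 y2 : R) : C :=
  cInt (fun x => psi (x, y1)) x1 x2 - cInt (fun x => psi (x, y2)) x1 x2
  + Ci * (cInt (fun y => psi (x2, y)) y1 y2 - cInt (fun y => psi (x1, y)) y1 y2).

(** * Goursat's theorem for rectangles in a vertical strip *)

(** Under [cexp] a vertical strip corresponds to an annulus, the region in which integrals over
    circles are compared below. *)
Definition Ccont_strip (psi : C -> C) (s1 s2 : R) :=
  forall z, (s1 < fst z < s2)%R -> Ccont psi z.

Lemma strip_hor (psi : C -> C) (s1 s2 x1 x2 y : R) : Ccont_strip psi s1 s2 ->
  (s1 < x1)%R -> (x2 < s2)%R -> Rcont_on (fun x => psi (x, y)) x1 x2.
Proof.
intros H H1 H2 t Ht. apply (Rcont_comp psi (fun x => (x, y))); [apply Rcont_hor|].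
apply H; simpl; lra.
Qed.

Lemma strip_ver (psi : C -> C) (s1 s2 x y1 y2 : R) : Ccont_strip psi s1 s2 ->
  (s1 < x < s2)%R -> Rcont_on (fun y => psi (x, y)) y1 y2.
Proof.
intros H H1 t Ht. apply (Rcont_comp psi (fun y => (x, y))); [apply Rcont_ver|].
apply H; simpl; lra.
Qed.

Lemma bdInt_split (psi : C -> C) (s1 s2 x1 xm x2 y1 ym y2 : R) : Ccont_strip psi s1 s2 ->
  (s1 < x1)%R -> (x1 <= xm <= x2)%R -> (x2 < s2)%R -> (y1 <= ym <= y2)%R ->
  bdInt psi x1 x2 y1 y2 =
  bdInt psi x1 xm y1 ym + bdInt psi xm x2 y1 ym + bdInt psi x1 xm ym y2 + bdInt psi xm x2 ym y2.
Proof.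
intros H H1 H2 H3 H4. unfold bdInt.
rewrite <- (cInt_Chasles (fun x => psi (x, y1)) x1 xm x2) by (try lra; eapply strip_hor; eauto).
rewrite <- (cInt_Chasles (fun x => psi (x, y2)) x1 xm x2) by (try lra; eapply strip_hor; eauto).
rewrite <- (cInt_Chasles (fun y => psi (x1, y)) y1 ym y2) by (try lra; eapply strip_ver; eauto; lra).
rewrite <- (cInt_Chasles (fun y => psi (x2, y)) y1 ym y2) by (try lra; eapply strip_ver; eauto; lra).
ring.
Qed.

Lemma bdInt_affine (c l : C) (x1 x2 y1 y2 : R) :
  bdInt (fun z => c + l * z) x1 x2 y1 y2 = 0.
Proof.
unfold bdInt.
assert (A : forall y, cInt (fun x => c + l * (x, y)) x1 x2 =
  RtoC (x2 - x1) * (c + l * (0, y)%R) + RtoC ((x2 * x2 - x1 * x1) / 2) * l).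
{ intros y. rewrite <- cInt_affine. unfold cInt; f_equal; apply RInt_ext; intros; simpl; ring. }
assert (B : forall x, cInt (fun y => c + l * (x, y)) y1 y2 =
  RtoC (y2 - y1) * (c + l * (x, 0)%R) + RtoC ((y2 * y2 - y1 * y1) / 2) * (l * Ci)).
{ intros y. rewrite <- cInt_affine. unfold cInt; f_equal; apply RInt_ext; intros; simpl; ring. }
rewrite !A, !B. apply C_ext; simpl; ring.
Qed.

(** Subtracting an affine function, whose boundary integral is 0, leaves an integrand bounded by [e]
    on a path of length [2 ((x2 - x1) + (y2 - y1))]; the remaining factor 2 is that of
    [cInt_bound]. *)
Lemma bdInt_small (psi : C -> C) (s1 s2 x1 x2 y1 y2 e : R) (c l : C) : Ccont_strip psi s1 s2 ->
  (s1 < x1)%R -> (x1 <= x2)%R -> (x2 < s2)%R -> (y1 <= y2)%R ->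
  (forall z, (x1 <= fst z <= x2)%R -> (y1 <= snd z <= y2)%R -> (Cmod (psi z - (c + l * z)) <= e)%R) ->
  (Cmod (bdInt psi x1 x2 y1 y2) <= 4 * ((x2 - x1) + (y2 - y1)) * e)%R.
Proof.
intros H H1 H2 H3 H4 He.
set (rho := fun z => psi z - (c + l * z)).
assert (Ha : Ccont_strip (fun z => c + l * z) s1 s2).
{ intros z Hz. apply Ccont_plus; [apply Ccont_const|]. apply Ccont_mult; [apply Ccont_const|apply Ccont_id]. }
assert (Hr : Ccont_strip rho s1 s2).
{ intros z Hz. apply (Ccont_plus psi (fun z => - (c + l * z))); [auto|].
  apply (Ccont_ext_loc (fun z => - (1) * (c + l * z)) _ z 1); [lra|intros; ring|].
  apply Ccont_mult; [apply Ccont_const|apply Ha; auto]. }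
assert (E : bdInt psi x1 x2 y1 y2 = bdInt rho x1 x2 y1 y2 + bdInt (fun z => c + l * z) x1 x2 y1 y2).
{ unfold bdInt.
  assert (A : forall y, cInt (fun x => psi (x, y)) x1 x2 =
     cInt (fun x => rho (x, y)) x1 x2 + cInt (fun x => c + l * (x, y)) x1 x2).
  { intros y. rewrite <- (cInt_plus (fun x => rho (x, y)) (fun x => c + l * (x, y))); auto.
    - apply cInt_ext; auto. intros; unfold rho; ring.
    - eapply strip_hor; eauto.
    - apply (strip_hor (fun z => c + l * z) s1 s2); auto. }
  assert (B : forall x, (s1 < x < s2)%R -> cInt (fun y => psi (x, y)) y1 y2 =
     cInt (fun y => rho (x, y)) y1 y2 + cInt (fun y => c + l * (x, y)) y1 y2).
  { intros x Hx. rewrite <- (cInt_plus (fun y => rho (x, y)) (fun y => c + l * (x, y))); auto.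
    - apply cInt_ext; auto. intros; unfold rho; ring.
    - eapply strip_ver; eauto.
    - apply (strip_ver (fun z => c + l * z) s1 s2); auto. }
  rewrite !A, !B by lra. ring. }
rewrite E, bdInt_affine, Cplus_0_r. unfold bdInt.
assert (N : forall a b, (Cmod (a - b) <= Cmod a + Cmod b)%R).
{ intros a b. eapply Rle_trans; [apply Cmod_triangle|]. rewrite Cmod_opp. lra. }
eapply Rle_trans; [apply Cmod_triangle|]. rewrite Cmod_mult, Cmod_Ci, Rmult_1_l.
eapply Rle_trans; [apply Rplus_le_compat; apply N|].
assert (B1 := cInt_bound (fun x => rho (x, y1)) x1 x2 e H2 (strip_hor rho s1 s2 x1 x2 y1 Hr H1 H3)).
assert (B2 := cInt_bound (fun x => rho (x, y2)) x1 x2 e H2 (strip_hor rho s1 s2 x1 x2 y2 Hr H1 H3)).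
assert (B3 := cInt_bound (fun y => rho (x1, y)) y1 y2 e H4 (strip_ver rho s1 s2 x1 y1 y2 Hr ltac:(lra))).
assert (B4 := cInt_bound (fun y => rho (x2, y)) y1 y2 e H4 (strip_ver rho s1 s2 x2 y1 y2 Hr ltac:(lra))).
assert (C1 := B1 ltac:(intros; apply He; simpl; lra)).
assert (C2 := B2 ltac:(intros; apply He; simpl; lra)).
assert (C3 := B3 ltac:(intros; apply He; simpl; lra)).
assert (C4 := B4 ltac:(intros; apply He; simpl; lra)).
lra.
Qed.

(** The supremum of the left ends of nested intervals stays below every right end. *)
Lemma nested_point (x : nat -> R) (L : R) : (0 <= L)%R ->
  (forall n, (x n <= x (S n))%R /\ (x (S n) + L / 2 ^ (S n) <= x n + L / 2 ^ n)%R) ->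
  exists c, forall n, (x n <= c <= x n + L / 2 ^ n)%R.
Proof.
intros HL H.
assert (M : forall n k, (x n <= x (n + k)%nat)%R /\ (x (n + k)%nat + L / 2 ^ (n + k) <= x n + L / 2 ^ n)%R).
{ intros n k. induction k.
  - rewrite Nat.add_0_r. lra.
  - rewrite Nat.add_succ_r. destruct (H (n + k)%nat). lra. }
assert (Pos : forall n, (0 <= L / 2 ^ n)%R).
{ intros n. apply Rmult_le_pos; auto. apply Rlt_le, Rinv_0_lt_compat, pow_lt; lra. }
assert (U : forall n m, (x n <= x m + L / 2 ^ m)%R).
{ intros n m. destruct (Nat.le_ge_cases n m) as [Hnm|Hnm].
  - destruct (M n (m - n)%nat) as [A _]. replace (n + (m - n))%nat with m in A by lia.
    assert (P := Pos m). lra.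
  - destruct (M m (n - m)%nat) as [_ A]. replace (m + (n - m))%nat with n in A by lia.
    assert (P := Pos n). lra. }
destruct (completeness (fun r => exists n, r = x n)) as [c [Hc1 Hc2]].
- exists (x 0%nat + L / 2 ^ 0)%R. intros r [n ->]. apply U.
- exists (x 0%nat). exists 0%nat; auto.
- exists c. intros n. split; [apply Hc1; exists n; auto|].
  apply Hc2. intros r [m ->]. apply U.
Qed.

(** Bisection: one of the four quarters carries at least a quarter of the integral. At the common
    point of the nested rectangles, differentiability makes the integral small compared with the
    square of the side lengths. *)
Lemma goursat (psi : C -> C) (s1 s2 x1 x2 y1 y2 : R) :
  (forall z, (s1 < fst z < s2)%R -> exists l, Cder psi z l) ->
  (s1 < x1)%R -> (x1 <= x2)%R -> (x2 < s2)%R -> (y1 <= y2)%R ->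
  bdInt psi x1 x2 y1 y2 = 0.
Proof.
intros D H1 H2 H3 H4.
assert (Hc : Ccont_strip psi s1 s2).
{ intros z Hz. destruct (D z Hz) as [l Hl]. eapply Cder_cont; eauto. }
set (L := (x2 - x1)%R). set (H := (y2 - y1)%R).
set (Q := fun (n : nat) (p : R * R) =>
  bdInt psi (fst p) (fst p + L / 2 ^ n) (snd p) (snd p + H / 2 ^ n)).
(* Only the abscissas are tracked, since the strip is unbounded vertically. *)
set (inside := fun (n : nat) (p : R * R) => (x1 <= fst p)%R /\ (fst p + L / 2 ^ n <= x2)%R).
assert (Pos : forall n K, (0 <= K)%R -> (0 <= K / 2 ^ n)%R).
{ intros n K HK. apply Rmult_le_pos; auto. apply Rlt_le, Rinv_0_lt_compat, pow_lt; lra. }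
assert (Half : forall n K, (K / 2 ^ n = K / 2 ^ (S n) + K / 2 ^ (S n))%R).
{ intros n K. simpl. field. apply pow_nonzero; lra. }
assert (HL : (0 <= L)%R) by (unfold L; lra). assert (HH : (0 <= H)%R) by (unfold H; lra).
assert (Step : forall n p, inside n p -> exists p', inside (S n) p' /\
  (Cmod (Q n p) <= 4 * Cmod (Q (S n) p'))%R /\
  (fst p <= fst p')%R /\ (fst p' + L / 2 ^ (S n) <= fst p + L / 2 ^ n)%R /\
  (snd p <= snd p')%R /\ (snd p' + H / 2 ^ (S n) <= snd p + H / 2 ^ n)%R).
{ intros n [x y] [I1 I2]. simpl fst in I1, I2.
  assert (PL := Pos (S n) L HL). assert (PH := Pos (S n) H HH).
  assert (EL := Half n L). assert (EH := Half n H).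
  set (a := (L / 2 ^ S n)%R) in *. set (b := (H / 2 ^ S n)%R) in *.
  assert (Sp := bdInt_split psi s1 s2 x (x + a) (x + L / 2 ^ n) y (y + b) (y + H / 2 ^ n) Hc
    ltac:(lra) ltac:(lra) ltac:(lra) ltac:(lra)).
  set (q := Q n (x, y)). assert (Eq : q = bdInt psi x (x + L / 2 ^ n) y (y + H / 2 ^ n)) by reflexivity.
  rewrite <- Eq in Sp.
  destruct (Rle_dec (Cmod q) (4 * Cmod (Q (S n) (x, y)))) as [Y|N1].
  { exists (x, y). unfold inside; cbn [fst snd]; fold a; fold b. repeat split; auto; try lra. }
  destruct (Rle_dec (Cmod q) (4 * Cmod (Q (S n) (x + a, y)%R))) as [Y|N2].
  { exists (x + a, y)%R. unfold inside; cbn [fst snd]; fold a; fold b. repeat split; auto; try lra. }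
  destruct (Rle_dec (Cmod q) (4 * Cmod (Q (S n) (x, y + b)%R))) as [Y|N3].
  { exists (x, y + b)%R. unfold inside; cbn [fst snd]; fold a; fold b. repeat split; auto; try lra. }
  destruct (Rle_dec (Cmod q) (4 * Cmod (Q (S n) (x + a, y + b)%R))) as [Y|N4].
  { exists (x + a, y + b)%R. unfold inside; cbn [fst snd]; fold a; fold b. repeat split; auto; try lra. }
  exfalso.
  assert (Sp' : q = Q (S n) (x, y) + Q (S n) (x + a, y)%R + Q (S n) (x, y + b)%R + Q (S n) (x + a, y + b)%R).
  { rewrite Sp. unfold Q. simpl fst; simpl snd. fold a; fold b.
    replace (x + a + a)%R with (x + L / 2 ^ n)%R by lra.
    replace (y + b + b)%R with (y + H / 2 ^ n)%R by lra. reflexivity. }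
  assert (T : (Cmod q <= Cmod (Q (S n) (x, y)) + Cmod (Q (S n) (x + a, y)%R) + Cmod (Q (S n) (x, y + b)%R)
     + Cmod (Q (S n) (x + a, y + b)%R))%R).
  { rewrite Sp'. eapply Rle_trans; [apply Cmod_triangle|]. apply Rplus_le_compat_r.
    eapply Rle_trans; [apply Cmod_triangle|]. apply Rplus_le_compat_r. apply Cmod_triangle. }
  lra. }
assert (Ch : exists p : nat -> R * R, p 0%nat = (x1, y1) /\ forall n, inside n (p n) /\
  (Cmod (Q n (p n)) <= 4 * Cmod (Q (S n) (p (S n))))%R /\
  (fst (p n) <= fst (p (S n)))%R /\ (fst (p (S n)) + L / 2 ^ (S n) <= fst (p n) + L / 2 ^ n)%R /\
  (snd (p n) <= snd (p (S n)))%R /\ (snd (p (S n)) + H / 2 ^ (S n) <= snd (p n) + H / 2 ^ n)%R).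
(* A choice function has to be total, so pairs that violate [inside] are sent to themselves. *)
{ assert (Step' : forall np : nat * (R * R), exists p', inside (fst np) (snd np) ->
    inside (S (fst np)) p' /\
    (Cmod (Q (fst np) (snd np)) <= 4 * Cmod (Q (S (fst np)) p'))%R /\
    (fst (snd np) <= fst p')%R /\ (fst p' + L / 2 ^ (S (fst np)) <= fst (snd np) + L / 2 ^ (fst np))%R /\
    (snd (snd np) <= snd p')%R /\ (snd p' + H / 2 ^ (S (fst np)) <= snd (snd np) + H / 2 ^ (fst np))%R).
  { intros [n p]. destruct (classic (inside n p)) as [I|N].
    - destruct (Step n p I) as [p' K]. exists p'; auto.
    - exists p. intros I; contradiction. }
  set (nx := fun np => proj1_sig (constructive_indefinite_description _ (Step' np))).
  assert (Hnx := fun np => proj2_sig (constructive_indefinite_description _ (Step' np))).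
  exists (fix p n := match n with O => (x1, y1) | S n => nx (n, p n) end).
  set (p := fix p n := match n with O => (x1, y1) | S n => nx (n, p n) end).
  split; [reflexivity|].
  assert (I : forall n, inside n (p n)).
  { induction n as [|n IH].
    - unfold inside, p, L; simpl. lra.
    - exact (proj1 (Hnx (n, p n) IH)). }
  intros n. split; [apply I|]. exact (proj2 (Hnx (n, p n) (I n))). }
destruct Ch as [p [p0 Hp]].
destruct (nested_point (fun n => fst (p n)) L HL) as [cx Hcx].
{ intros n. destruct (Hp n) as (_ & _ & K1 & K2 & _). lra. }
destruct (nested_point (fun n => snd (p n)) H HH) as [cy Hcy].
{ intros n. destruct (Hp n) as (_ & _ & _ & _ & K1 & K2). lra. }
assert (G : forall n, (Cmod (bdInt psi x1 x2 y1 y2) <= 4 ^ n * Cmod (Q n (p n)))%R).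
{ induction n as [|n IH].
  - rewrite p0. unfold Q, L, H; simpl. right. rewrite Rmult_1_l. f_equal. f_equal; field.
  - destruct (Hp n) as (_ & K & _). eapply Rle_trans; [exact IH|]. simpl.
    assert (0 < 4 ^ n)%R by (apply pow_lt; lra). nra. }
assert (Hcin : (s1 < fst (cx, cy) < s2)%R).
{ destruct (Hp 0%nat) as ((I1 & I2) & _). assert (K := Hcx 0%nat). simpl fst. lra. }
destruct (D _ Hcin) as [l [phi [El [Hphi [d0 [Hd0 Hf]]]]]].
(* On the [n]-th rectangle the deviation from an affine function is at most [e * w] and the
   perimeter is of order [w]. The product is of order [e / 4^n], which compensates the factor [4^n]
   of [G]. *)
assert (Small : forall e, (0 < e)%R -> (Cmod (bdInt psi x1 x2 y1 y2) <= 4 * (L + H) * (L + H) * e)%R).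
{ intros e He. destruct (Hphi e He) as [d1 [Hd1 Hp1]].
  assert (Hn : exists n, ((L + H) / 2 ^ n < Rmin d0 d1)%R).
  { assert (Hm : (0 < Rmin d0 d1)%R) by (apply Rmin_pos; auto).
    destruct (pow_lt_1_zero (/ 2) ltac:(rewrite Rabs_pos_eq; lra) (Rmin d0 d1 / (L + H + 1))%R) as [n Hn].
    { apply Rdiv_lt_0_compat; lra. }
    exists n. assert (K := Hn n (le_n n)). rewrite pow_inv in K.
    rewrite Rabs_pos_eq in K by (apply Rlt_le, Rinv_0_lt_compat, pow_lt; lra).
    assert (P : (0 < / 2 ^ n)%R) by (apply Rinv_0_lt_compat, pow_lt; lra).
    unfold Rdiv.
    apply Rle_lt_trans with ((L + H + 1) * / 2 ^ n)%R; [nra|].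
    apply Rlt_le_trans with ((L + H + 1) * (Rmin d0 d1 / (L + H + 1)))%R.
    - apply Rmult_lt_compat_l; lra.
    - right; field; lra. }
  destruct Hn as [n Hn].
  assert (PL := Pos n L HL). assert (PH := Pos n H HH).
  set (w := ((L + H) / 2 ^ n)%R) in *.
  assert (Ew : (w = L / 2 ^ n + H / 2 ^ n)%R) by (unfold w, Rdiv; ring).
  destruct (Hp n) as ((I1 & I2) & _).
  assert (B : (Cmod (Q n (p n)) <= 4 * w * (e * w))%R).
  { unfold Q. assert (Hx := Hcx n). assert (Hy := Hcy n). simpl in Hx, Hy.
    eapply Rle_trans; [apply (bdInt_small psi s1 s2 _ _ _ _ (e * w) (psi (cx, cy) - l * (cx, cy)) l Hc); try lra|].
    - intros z Z1 Z2.
      assert (Zw : (Cmod (z - (cx, cy)) <= w)%R).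
      { eapply Rle_trans; [apply Cmod_le_abs|]. simpl. rewrite Ew.
        apply Rplus_le_compat; apply Rabs_le; lra. }
      assert (M1 := Rmin_l d0 d1). assert (M2 := Rmin_r d0 d1).
      replace (psi z - (psi (cx, cy) - l * (cx, cy) + l * z)) with
        ((psi z - psi (cx, cy)) - l * (z - (cx, cy))) by ring.
      rewrite Hf by lra.
      replace (phi z * (z - (cx, cy)) - l * (z - (cx, cy))) with ((phi z - l) * (z - (cx, cy))) by ring.
      rewrite Cmod_mult. apply Rmult_le_compat; try apply Cmod_ge_0; auto.
      rewrite <- El. apply Rlt_le, Hp1. lra.
    - right. rewrite Ew. ring. }
  eapply Rle_trans; [apply (G n)|].
  assert (P4 : (0 < 4 ^ n)%R) by (apply pow_lt; lra).
  eapply Rle_trans; [apply Rmult_le_compat_l; [lra|exact B]|].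
  right. unfold w. replace (4 ^ n)%R with (2 ^ n * 2 ^ n)%R.
  - field. apply pow_nonzero; lra.
  - rewrite <- Rpow_mult_distr. replace (2 * 2)%R with 4%R by ring. reflexivity. }
apply Cmod_eq_0. apply Rle_antisym; [|apply Cmod_ge_0].
apply Rnot_lt_le. intros Hlt.
set (m := Cmod (bdInt psi x1 x2 y1 y2)) in *.
set (K := (4 * (L + H) * (L + H))%R) in *.
assert (HK : (0 <= K)%R) by (unfold K; apply Rmult_le_pos; lra).
assert (Sm := Small (m / (2 * (K + 1)))%R ltac:(apply Rdiv_lt_0_compat; lra)).
assert (K * (m / (2 * (K + 1))) <= m / 2)%R; [|lra].
apply (Rmult_le_reg_r (2 * (K + 1))); [lra|].
replace (K * (m / (2 * (K + 1))) * (2 * (K + 1)))%R with (K * m)%R by (field; lra). nra.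
Qed.

(** * Mean values over circles and Cauchy's formula *)

Lemma Cmod_polar (r t : R) : (0 <= r)%R -> Cmod (polar r t) = r.
Proof.
intros Hr. unfold Cmod, polar; simpl.
replace (r * cos t * (r * cos t * 1) + r * sin t * (r * sin t * 1))%R with
  ((r * r) * (Rsqr (sin t) + Rsqr (cos t)))%R by (unfold Rsqr; ring).
rewrite sin2_cos2, Rmult_1_r. apply sqrt_square; auto.
Qed.

Lemma polar_mult (r s t : R) : polar (r * s) t = RtoC r * polar s t.
Proof. apply C_ext; simpl; ring. Qed.

Lemma Ccont_circle (f : C -> C) (r t : R) : (0 <= r)%R ->
  Ccont f (polar r t) -> Rcont (fun s => f (polar r s)) t.
Proof.
intros Hr Hf. destruct (Rle_lt_or_eq_dec 0 r Hr) as [Hp|<-].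
- apply (Rcont_comp f (fun s => polar r s)); auto.
  assert (K : Rcont (fun s => cexp (ln r, s)) t).
  { apply (Rcont_comp cexp (fun s => (ln r, s))); [apply Rcont_ver|].
    eapply Cder_cont, Cder_cexp. }
  unfold cexp in K; simpl in K. rewrite exp_ln in K by auto. exact K.
- intros e He. exists 1%R; split; [lra|]. intros s _.
  replace (polar 0 s) with (polar 0 t) by (unfold polar; f_equal; ring).
  replace (_ - _) with (RtoC 0) by ring. rewrite Cmod_0; auto.
Qed.

Lemma cInt_scal (c : C) (u : R -> C) (a b : R) : (a <= b)%R -> Rcont_on u a b ->
  cInt (fun t => c * u t) a b = c * cInt u a b.
Proof.
intros Hab Hu. unfold cInt.
assert (E1 := ex_RInt_fst u a b Hab Hu). assert (E2 := ex_RInt_snd u a b Hab Hu).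
assert (S1 : forall k, RInt (fun t => k * fst (u t))%R a b = (k * RInt (fun t => fst (u t)) a b)%R)
  by (intros k; apply (RInt_scal (fun t => fst (u t)) a b k E1)).
assert (S2 : forall k, RInt (fun t => k * snd (u t))%R a b = (k * RInt (fun t => snd (u t)) a b)%R)
  by (intros k; apply (RInt_scal (fun t => snd (u t)) a b k E2)).
assert (X1 : forall k, ex_RInt (fun t => k * fst (u t))%R a b)
  by (intros k; apply (ex_RInt_scal (fun t => fst (u t)) a b k E1)).
assert (X2 : forall k, ex_RInt (fun t => k * snd (u t))%R a b)
  by (intros k; apply (ex_RInt_scal (fun t => snd (u t)) a b k E2)).
apply C_ext; simpl.
- rewrite <- S1, <- S2.
  apply (RInt_minus (fun t => fst c * fst (u t))%R (fun t => snd c * snd (u t))%R); auto.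
- rewrite <- S1, <- S2.
  apply (RInt_plus (fun t => fst c * snd (u t))%R (fun t => snd c * fst (u t))%R); auto.
Qed.

Lemma cInt_conj (u : R -> C) (a b : R) : (a <= b)%R -> Rcont_on u a b ->
  cInt (fun t => Cconj (u t)) a b = Cconj (cInt u a b).
Proof.
intros Hab Hu. unfold cInt, Cconj; simpl. f_equal.
apply (RInt_opp (fun t => snd (u t))). apply ex_RInt_snd; auto.
Qed.

(** In the coordinate [log w] the annulus becomes a rectangle. Its horizontal sides, at heights 0
    and [2 * PI], carry the same values and cancel, which leaves the two circles. *)
Lemma annulus_const (f : C -> C) (r1 r2 r r' : R) :
  (forall z, (r1 < Cmod z < r2)%R -> exists l, Cder f z l) ->
  (0 <= r1)%R -> (r1 < r)%R -> (r <= r')%R -> (r' < r2)%R ->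
  cInt (fun t => f (polar r t)) 0 (2 * PI) = cInt (fun t => f (polar r' t)) 0 (2 * PI).
Proof.
intros D H0 H1 H2 H3.
(* [r1] may be 0, so the strip is bounded on the left by the logarithm of a positive radius between
   [r1] and [r]. *)
set (m := ((r1 + r) / 2)%R).
assert (Hm : (0 < m)%R) by (unfold m; lra).
assert (Hm1 : (r1 < m < r)%R) by (unfold m; lra).
assert (PIp := PI_RGT_0).
assert (G := goursat (fun z => f (cexp z)) (ln m) (ln r2) (ln r) (ln r') 0 (2 * PI)).
assert (E : bdInt (fun z => f (cexp z)) (ln r) (ln r') 0 (2 * PI) = 0).
{ apply G.
  - intros z [Z1 Z2]. destruct (D (cexp z)) as [l Hl].
    + rewrite Cmod_cexp. split.
      * apply Rlt_trans with (exp (ln m)); [rewrite exp_ln; lra|apply exp_increasing; auto].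
      * apply Rlt_le_trans with (exp (ln r2)); [apply exp_increasing; auto|rewrite exp_ln; lra].
    + eexists. apply (Cder_comp f cexp); [apply Cder_cexp|exact Hl].
  - apply ln_increasing; lra.
  - destruct (Rle_lt_or_eq_dec _ _ H2) as [Hlt|<-]; [apply Rlt_le, ln_increasing; lra|lra].
  - apply ln_increasing; lra.
  - lra. }
unfold bdInt in E.
assert (P : forall x, cexp (x, 2 * PI)%R = cexp (x, 0)%R).
{ intros x. unfold cexp; simpl. rewrite cos_2PI, sin_2PI, cos_0, sin_0; auto. }
rewrite (cInt_ext (fun x => f (cexp (x, 2 * PI)%R)) (fun x => f (cexp (x, 0)%R))) in E.
2:{ destruct (Rle_lt_or_eq_dec _ _ H2) as [Hlt|<-]; [apply Rlt_le, ln_increasing; lra|lra]. }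
2:{ intros; rewrite P; auto. }
assert (Hpol : forall s, (0 < s)%R -> forall t, cexp (ln s, t) = polar s t).
{ intros s Hs t. unfold cexp, polar; simpl. rewrite exp_ln; auto. }
assert (Aux : forall A X Y : C, A - A + Ci * (X - Y) = 0 -> Y = X).
{ intros A X Y K. apply (f_equal (fun w => Ci * w + X)) in K.
  replace (Ci * (A - A + Ci * (X - Y)) + X) with Y in K by (apply C_ext; simpl; ring).
  rewrite K. ring. }
apply Aux in E.
rewrite (cInt_ext _ (fun t => f (cexp (ln r, t)))) by (try lra; intros; rewrite Hpol; auto; lra).
rewrite E. apply cInt_ext; [lra|]. intros; rewrite Hpol; auto; lra.
Qed.

(** The mean does not depend on the radius, and by continuity at the centre it tends to [f 0] as the
    circle shrinks. *)
Lemma mean_value (f : C -> C) (rho r : R) :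
  (forall z, (Cmod z < rho)%R -> exists l, Cder f z l) -> (0 <= r < rho)%R ->
  cInt (fun t => f (polar r t)) 0 (2 * PI) = RtoC (2 * PI) * f 0.
Proof.
intros D [H0 H1]. assert (PIp := PI_RGT_0).
assert (P0 : forall t, polar 0 t = 0) by (intros t; apply C_ext; simpl; ring).
destruct (Rle_lt_or_eq_dec 0 r H0) as [Hr|<-].
2:{ rewrite (cInt_ext _ (fun _ => f 0)) by (try lra; intros; rewrite P0; auto).
    rewrite cInt_const, Rminus_0_r. auto. }
assert (Cf : forall s, (0 <= s < rho)%R -> Rcont_on (fun t => f (polar s t)) 0 (2 * PI)).
{ intros s Hs t _. apply Ccont_circle; [lra|].
  destruct (D (polar s t)) as [l Hl]; [rewrite Cmod_polar; lra|]. eapply Cder_cont; eauto. }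
set (J := cInt (fun t => f (polar r t)) 0 (2 * PI)).
assert (Small : forall e, (0 < e)%R -> (Cmod (J - RtoC (2 * PI) * f 0) <= 4 * PI * e)%R).
{ intros e He. destruct (D 0) as [l Hl]; [rewrite Cmod_0; lra|].
  destruct (Cder_cont _ _ _ Hl e He) as [d [Hd K]].
  set (s := Rmin r (d / 2)).
  assert (S1 : (0 < s)%R) by (apply Rmin_pos; lra).
  assert (S2 : (s <= r)%R) by apply Rmin_l.
  assert (S3 : (s <= d / 2)%R) by apply Rmin_r.
  unfold J. rewrite <- (annulus_const f 0 rho s r) by (try lra; intros; apply D; lra).
  replace (cInt (fun t => f (polar s t)) 0 (2 * PI) - RtoC (2 * PI) * f 0)
    with (cInt (fun t => f (polar s t) + - f 0) 0 (2 * PI)).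
  - assert (B := cInt_bound (fun t => f (polar s t) + - f 0) 0 (2 * PI) e ltac:(lra)).
    eapply Rle_trans; [apply B|lra].
    + intros t Ht. apply Rcont_plus; [apply Cf; lra|apply Rcont_const].
    + intros t _. apply Rlt_le, K. replace (polar s t - 0) with (polar s t) by ring.
      rewrite Cmod_polar; lra.
  - rewrite cInt_plus by (try lra; try (apply Cf; lra); intros t Ht; apply Rcont_const).
    rewrite cInt_const, Rminus_0_r. ring. }
assert (Z : J - RtoC (2 * PI) * f 0 = 0).
{ apply Cmod_eq_0. apply Rle_antisym; [|apply Cmod_ge_0].
  apply Rnot_lt_le. intros Hlt.
  set (m := Cmod _) in Hlt, Small.
  assert (S := Small (m / (8 * PI))%R ltac:(apply Rdiv_lt_0_compat; lra)).
  replace (4 * PI * (m / (8 * PI)))%R with (m / 2)%R in S by (field; lra). lra. }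
replace J with (J - RtoC (2 * PI) * f 0 + RtoC (2 * PI) * f 0) by ring. rewrite Z; ring.
Qed.

Lemma cont_2d_of_Ccont (psi : C -> C) (s t : R) : Ccont psi (s, t) ->
  continuity_2d_pt (fun u v => fst (psi (v, u))) t s /\
  continuity_2d_pt (fun u v => snd (psi (v, u))) t s.
Proof.
intros H.
assert (K : forall eps : posreal, locally_2d (fun u v => (Cmod (psi (v, u) - psi (s, t)) < eps)%R) t s).
{ intros eps. destruct (H eps (cond_pos eps)) as [d [Hd K]].
  assert (Hd2 : (0 < d / 2)%R) by lra.
  exists (mkposreal _ Hd2). simpl. intros u v Hu Hv. apply K.
  eapply Rle_lt_trans; [apply Cmod_le_abs|]. simpl. unfold Rminus in *. lra. }
split; intros eps; destruct (K eps) as [d Hd]; exists d; intros u v Hu Hv;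
  eapply Rle_lt_trans; try apply (Hd u v Hu Hv).
- exact (re_le_Cmod (psi (v, u) - psi (s, t))).
- exact (im_le_Cmod (psi (v, u) - psi (s, t))).
Qed.

(** Uniform continuity on a compact segment is enough. This serves to cross a circle on which only
    continuity of the integrand is known. *)
Lemma cInt_ver_cont (psi : C -> C) (s1 s2 s0 a b : R) : Ccont_strip psi s1 s2 -> (s1 < s0 < s2)%R ->
  (a <= b)%R -> Rcont (fun s => cInt (fun y => psi (s, y)) a b) s0.
Proof.
intros H Hs Hab e He.
set (k := (e / (4 * (b - a) + 1))%R).
assert (Hk : (0 < k)%R) by (apply Rdiv_lt_0_compat; lra).
assert (H1 : forall t, (a <= t <= b)%R -> Ccont psi (s0, t)) by (intros; apply H; auto).
destruct (uniform_continuity_2d_1d (fun u v => fst (psi (v, u))) a b s0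
  (fun t Ht => proj1 (cont_2d_of_Ccont psi s0 t (H1 t Ht))) (mkposreal _ Hk)) as [d1 K1].
destruct (uniform_continuity_2d_1d (fun u v => snd (psi (v, u))) a b s0
  (fun t Ht => proj2 (cont_2d_of_Ccont psi s0 t (H1 t Ht))) (mkposreal _ Hk)) as [d2 K2].
simpl in K1, K2.
assert (P1 := cond_pos d1). assert (P2 := cond_pos d2).
exists (Rmin (Rmin d1 d2) (Rmin (s0 - s1) (s2 - s0))).
split; [repeat apply Rmin_pos; lra|]. intros s Hsd.
assert (T1 := Rmin_l (Rmin d1 d2) (Rmin (s0 - s1) (s2 - s0))).
assert (T2 := Rmin_r (Rmin d1 d2) (Rmin (s0 - s1) (s2 - s0))).
assert (T3 := Rmin_l d1 d2). assert (T4 := Rmin_r d1 d2).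
assert (T5 := Rmin_l (s0 - s1) (s2 - s0)). assert (T6 := Rmin_r (s0 - s1) (s2 - s0)).
apply Rabs_def2 in Hsd.
replace (cInt (fun y => psi (s, y)) a b - cInt (fun y => psi (s0, y)) a b) with
  (cInt (fun y => psi (s, y) + -(1) * psi (s0, y)) a b).
- eapply Rle_lt_trans; [apply (cInt_bound _ a b (2 * k) Hab)|].
  + intros t Ht. apply Rcont_plus; [|apply Rcont_scal]; eapply strip_ver; eauto; lra.
  + intros t Ht. eapply Rle_trans; [apply Cmod_le_abs|].
    replace (psi (s, t) + - (1) * psi (s0, t)) with (psi (s, t) - psi (s0, t)) by ring. simpl.
    assert (A1 := K1 t s0 t s Ht ltac:(lra) Ht ltac:(lra) ltac:(rewrite Rminus_diag, Rabs_R0; lra)).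
    assert (A2 := K2 t s0 t s Ht ltac:(lra) Ht ltac:(lra) ltac:(rewrite Rminus_diag, Rabs_R0; lra)).
    unfold Rminus in *. lra.
  + assert ((4 * (b - a) + 1) * k = e)%R by (unfold k; field; lra). lra.
- rewrite cInt_plus; [|auto| |intros t Ht; apply Rcont_scal]; try (eapply strip_ver; eauto; lra).
  rewrite cInt_scal; [ring|auto|]. eapply strip_ver; eauto; lra.
Qed.

Lemma Cconj_polar (t : R) : Cconj (polar 1 t) * polar 1 t = 1.
Proof.
apply C_ext; simpl.
- transitivity (Rsqr (sin t) + Rsqr (cos t))%R; [unfold Rsqr; ring|apply sin2_cos2].
- ring.
Qed.

Lemma one_minus_neq_0 (w : C) : (Cmod w < 1)%R -> 1 - w <> 0.
Proof.
intros H E. assert (w = 1) by (replace w with (1 - (1 - w)) by ring; rewrite E; ring).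
subst. rewrite Cmod_1 in H; lra.
Qed.

Lemma Cder_kernel (c z : C) : (Cmod (c * z) < 1)%R -> exists l, Cder (fun w => / (1 - c * w)) z l.
Proof.
intros H. eexists. apply (Cder_comp Cinv (fun w => 1 - c * w)); [|apply Cder_inv, one_minus_neq_0; auto].
apply (Cder_plus (fun _ => 1) (fun w => - (c * w))); [apply Cder_const|].
instantiate (1 := - c).
exists (fun _ => - c). split; auto. split; [apply Ccont_const|].
exists 1%R; split; [lra|]. intros; ring.
Qed.

Lemma cauchy_kernel (z : C) (t : R) : (Cmod z < 1)%R ->
  / (1 - z * Cconj (polar 1 t)) = Cconj (/ (1 - Cconj z * polar 1 t)).
Proof.
intros Hz.
assert (1 - Cconj z * polar 1 t <> 0).
{ apply one_minus_neq_0. rewrite Cmod_mult, Cmod_conj, Cmod_polar by lra. lra. }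
rewrite Cinv_conj by auto. f_equal. apply C_ext; simpl; ring.
Qed.

Lemma Rcont_conj (u : R -> C) (t : R) : Rcont u t -> Rcont (fun s => Cconj (u s)) t.
Proof.
intros H e He. destruct (H e He) as [d [Hd K]]. exists d; split; auto. intros s Hs.
replace (Cconj (u s) - Cconj (u t)) with (Cconj (u s - u t)) by (apply C_ext; simpl; ring).
rewrite Cmod_conj; auto.
Qed.

(** On the circle the kernel is the conjugate of [/ (1 - Cconj z * w)], which is holomorphic past
    the closed disc and has value 1 at the centre. *)
Lemma cInt_cauchy_kernel (z : C) : (Cmod z < 1)%R ->
  cInt (fun t => / (1 - z * Cconj (polar 1 t))) 0 (2 * PI) = RtoC (2 * PI).
Proof.
intros Hz. assert (PIp := PI_RGT_0).
rewrite (cInt_ext _ (fun t => Cconj (/ (1 - Cconj z * polar 1 t))))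
  by (try lra; intros; apply cauchy_kernel; auto).
set (rho := (/ ((Cmod z + 1) / 2))%R).
assert (P := Cmod_ge_0 z).
assert (Hrho : (1 < rho)%R).
{ unfold rho. rewrite <- Rinv_1 at 1. apply Rinv_lt_contravar; lra. }
assert (K : forall w, (Cmod w < rho)%R -> exists l, Cder (fun w => / (1 - Cconj z * w)) w l).
{ intros w Hw. apply Cder_kernel. rewrite Cmod_mult, Cmod_conj.
  apply Rle_lt_trans with (Cmod z * rho)%R; [apply Rmult_le_compat_l; lra|].
  unfold rho. apply (Rmult_lt_reg_r ((Cmod z + 1) / 2)); [lra|].
  rewrite Rmult_assoc, Rinv_l by lra. lra. }
rewrite (cInt_conj (fun t => / (1 - Cconj z * polar 1 t))).
- rewrite (mean_value (fun w => / (1 - Cconj z * w)) rho 1 K) by lra.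
  replace (/ (1 - Cconj z * 0)) with (RtoC 1).
  + apply C_ext; simpl; ring.
  + replace (1 - Cconj z * 0) with (RtoC 1) by ring. apply C_ext; simpl; field.
- lra.
- intros t _. apply (Ccont_circle (fun w => / (1 - Cconj z * w))); [lra|].
  destruct (K (polar 1 t)) as [l Hl]; [rewrite Cmod_polar; lra|]. eapply Cder_cont; eauto.
Qed.

Lemma Cder_sub_const (c z : C) : Cder (fun w => w - c) z 1.
Proof.
exists (fun _ => 1). split; auto. split; [apply Ccont_const|].
exists 1%R; split; [lra|]. intros; ring.
Qed.

Lemma Cder_ext_loc (f g : C -> C) (z l : C) (d : R) : (0 < d)%R ->
  (forall w, (Cmod (w - z) < d)%R -> f w = g w) -> Cder f z l -> Cder g z l.
Proof.
intros Hd H [p [E [Hp [d1 [Hd1 H1]]]]].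
exists p. split; auto. split; auto. exists (Rmin d d1). split; [apply Rmin_pos; auto|].
intros w Hw. rewrite <- !H, H1; auto.
- eapply Rlt_le_trans; [exact Hw|apply Rmin_r].
- replace (z - z) with (RtoC 0) by ring. rewrite Cmod_0; auto.
- eapply Rlt_le_trans; [exact Hw|apply Rmin_l].
Qed.

Lemma Cmod_sub_pos (w z : C) : w <> z -> (0 < Cmod (w - z))%R.
Proof.
intros H. apply Cmod_gt_0. intros E. apply H.
replace w with (w - z + z) by ring. rewrite E; ring.
Qed.

(* The difference quotient has a removable singularity at [z], so its circular means are
   constant on both sides of the circle through [z] and continuous across it. *)
Lemma cauchy_formula (F : C -> C) (rho : R) (z : C) : (1 < rho)%R ->
  (forall w, (Cmod w < rho)%R -> exists l, Cder F w l) -> (Cmod z < 1)%R ->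
  cInt (fun t => F (polar 1 t) * / (1 - z * Cconj (polar 1 t))) 0 (2 * PI) = RtoC (2 * PI) * F z.
Proof.
intros Hrho DF Hz. assert (PIp := PI_RGT_0).
destruct (Ceq_dec z 0) as [->|Hz0].
{ rewrite <- (mean_value F rho 1) by (auto; lra). apply cInt_ext; [lra|]. intros t _.
  replace (1 - 0 * Cconj (polar 1 t)) with (RtoC 1) by ring.
  replace (/ 1) with (RtoC 1) by (apply C_ext; simpl; field). ring. }
assert (Hm : (0 < Cmod z)%R) by (apply Cmod_gt_0; auto).
set (m := Cmod z) in *.
destruct (DF z) as [l [phi [El [Hphi [d [Hd Hq]]]]]]; [fold m; lra|].
(* On the unit circle [w / (w - z)] equals [1 / (1 - z * Cconj w)], so the factor [w] turns the
   difference quotient into the integrand of the formula. It also gives [D 0 = 0], which makes the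
   inner means vanish. *)
set (D := fun w => if Ceq_dec w z then z * l else w * (F w - F z) / (w - z)).
assert (D1 : forall w, (Cmod w < rho)%R -> w <> z -> exists k, Cder D w k).
{ intros w Hw Hwz. destruct (DF w Hw) as [k Hk]. eexists.
  assert (Hp := Cmod_sub_pos w z Hwz).
  apply (Cder_ext_loc (fun w => (w * (F w - F z)) * / (w - z)) D w _ (Cmod (w - z))); auto.
  - intros v Hv. unfold D. destruct (Ceq_dec v z) as [->|]; [|reflexivity].
    exfalso. rewrite Cmod_sub_sym in Hv. lra.
  - apply (Cder_mult (fun w => w * (F w - F z)) (fun w => / (w - z))).
    + apply (Cder_mult (fun w => w) (fun w => F w - F z)); [apply Cder_id|].
      apply (Cder_plus F (fun _ => - F z)); [exact Hk|apply Cder_const].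
    + apply (Cder_comp Cinv (fun w => w - z)); [apply Cder_sub_const|].
      apply Cder_inv. apply Cmod_gt_0; auto. }
assert (D2 : Ccont D z).
{ apply (Ccont_ext_loc (fun w => w * phi w) D z d); auto.
  - intros w Hw. unfold D. destruct (Ceq_dec w z) as [->|Hwz]; [rewrite El; auto|].
    rewrite Hq by auto. field. apply Cmod_gt_0, Cmod_sub_pos; auto.
  - apply Ccont_mult; [apply Ccont_id|auto]. }
assert (D3 : forall w, (Cmod w < rho)%R -> Ccont D w).
{ intros w Hw. destruct (Ceq_dec w z) as [->|Hwz]; auto.
  destruct (D1 w Hw Hwz) as [k Hk]. eapply Cder_cont; eauto. }
set (J := fun s => cInt (fun y => D (cexp (s, y))) 0 (2 * PI)).
assert (JE : forall s, J s = cInt (fun t => D (polar (exp s) t)) 0 (2 * PI)) by reflexivity.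
assert (Jlo : forall s, (s < ln m)%R -> J s = 0).
{ intros s Hs. rewrite JE.
  rewrite (mean_value D m).
  - unfold D. destruct (Ceq_dec 0 z) as [E|N]; [congruence|].
    unfold Cdiv. ring.
  - intros w Hw. apply D1; [lra|]. intros ->. fold m in Hw. lra.
  - split; [apply Rlt_le, exp_pos|]. rewrite <- (exp_ln m) by auto. apply exp_increasing; auto. }
assert (Jhi : forall s, (ln m < s <= 0)%R -> J s = J 0).
{ intros s Hs. rewrite !JE. apply (annulus_const D m rho).
  - intros w Hw. apply D1; [lra|]. intros ->. fold m in Hw. lra.
  - lra.
  - rewrite <- (exp_ln m) at 1 by auto. apply exp_increasing; lra.
  - destruct (Rle_lt_or_eq_dec s 0) as [L|E]; [lra| |rewrite E; lra].
    apply Rlt_le, exp_increasing; auto.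
  - rewrite exp_0; auto. }
assert (Lm : (ln m < 0)%R) by (rewrite <- ln_1; apply ln_increasing; auto).
assert (Lr : (0 < ln rho)%R) by (rewrite <- ln_1; apply ln_increasing; lra).
assert (JC : Rcont J (ln m)).
{ apply (cInt_ver_cont (fun w => D (cexp w)) (ln m - 1) (ln rho)); [|lra|lra].
  intros w Hw. apply (Ccont_comp D cexp).
  - eapply Cder_cont, Cder_cexp.
  - apply D3. rewrite Cmod_cexp. rewrite <- (exp_ln rho) by lra. apply exp_increasing; lra. }
assert (J0 : J 0%R = 0).
{ apply Cmod_eq_0. apply Rle_antisym; [|apply Cmod_ge_0].
  apply Rnot_lt_le. intros Hlt.
  destruct (JC (Cmod (J 0%R) / 2)%R ltac:(lra)) as [k [Hk K]].
  assert (A1 := K (ln m - k / 2)%R).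
  set (s := Rmin 0 (ln m + k / 2)).
  assert (S1 : (s <= 0)%R) by apply Rmin_l.
  assert (S2 : (s <= ln m + k / 2)%R) by apply Rmin_r.
  assert (S3 : (ln m < s)%R) by (unfold s; apply Rmin_glb_lt; lra).
  assert (A2 := K s).
  rewrite (Jlo (ln m - k / 2)%R) in A1 by lra.
  rewrite (Jhi s) in A2 by lra.
  assert (B1 := A1 ltac:(apply Rabs_def1; lra)). assert (B2 := A2 ltac:(apply Rabs_def1; lra)).
  rewrite Cmod_sub_sym in B1. replace (J (ln m) - 0) with (J (ln m)) in B1 by ring.
  assert (T := Cmod_triangle (J 0%R - J (ln m)) (J (ln m))).
  replace (J 0%R - J (ln m) + J (ln m)) with (J 0%R) in T by ring. lra. }
rewrite JE, exp_0 in J0.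
set (k := fun t => / (1 - z * Cconj (polar 1 t))).
assert (Kc : Rcont_on k 0 (2 * PI)).
{ intros t _. unfold k.
  apply (Rcont_comp Cinv (fun t => 1 - z * Cconj (polar 1 t))).
  - apply (Rcont_plus (fun _ => 1) (fun t => - (z * Cconj (polar 1 t)))); [apply Rcont_const|].
    apply (Rcont_comp (fun w => - (z * w)) (fun t => Cconj (polar 1 t))).
    + apply Rcont_conj. apply (Ccont_circle (fun w => w)); [lra|apply Ccont_id].
    + apply (Ccont_ext_loc (fun w => (- z) * w) _ _ 1); [lra|intros; ring|].
      apply Ccont_mult; [apply Ccont_const|apply Ccont_id].
  - apply Ccont_inv, one_minus_neq_0. rewrite Cmod_mult, Cmod_conj, Cmod_polar by lra. fold m; lra. }
assert (Fc : Rcont_on (fun t => D (polar 1 t)) 0 (2 * PI)).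
{ intros t _. apply Ccont_circle; [lra|]. apply D3. rewrite Cmod_polar; lra. }
rewrite (cInt_ext _ (fun t => D (polar 1 t) + F z * k t)).
- rewrite (cInt_plus (fun t => D (polar 1 t)) (fun t => F z * k t)); [|lra|auto|].
  + rewrite J0, cInt_scal by (auto; lra). unfold k. rewrite cInt_cauchy_kernel by auto. ring.
  + intros t Ht. apply Rcont_scal; auto.
- lra.
- intros t _. unfold D, k.
  assert (Hn : polar 1 t - z <> 0).
  { apply Cmod_gt_0, Cmod_sub_pos. intros E. apply (f_equal Cmod) in E.
    rewrite Cmod_polar in E by lra. fold m in E. lra. }
  destruct (Ceq_dec (polar 1 t) z) as [E|_].
  { exfalso. apply Hn. rewrite E. ring. }
  assert (Hp0 : polar 1 t <> 0) by (apply Cmod_gt_0; rewrite Cmod_polar; lra).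
  assert (Hc : Cconj (polar 1 t) = / polar 1 t).
  { rewrite <- (Cmult_1_r (Cconj _)), <- (Cinv_r (polar 1 t)) by auto.
    rewrite Cmult_assoc, Cconj_polar. ring. }
  rewrite Hc.
  assert (1 - z * / polar 1 t <> 0).
  { intros E. apply Hn. replace (polar 1 t - z) with (polar 1 t * (1 - z * / polar 1 t)) by (field; auto).
    rewrite E; ring. }
  field; auto.
Qed.

(** [F w / (1 - z w)] is holomorphic past the unit circle, so the mean value property applies. This
    will be the conjugate half of the Poisson kernel. *)
Lemma mean_kernel (F : C -> C) (rho : R) (z : C) : (1 < rho)%R ->
  (forall w, (Cmod w < rho)%R -> exists l, Cder F w l) -> (Cmod z < 1)%R ->
  cInt (fun t => F (polar 1 t) * / (1 - z * polar 1 t)) 0 (2 * PI) = RtoC (2 * PI) * F 0.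
Proof.
intros Hrho DF Hz. assert (P := Cmod_ge_0 z).
(* The second radius is [2 / (|z| + 1) > 1], within which [|z w| < 1]. *)
set (r2 := Rmin rho (/ ((Cmod z + 1) / 2))).
assert (Hr2 : (1 < r2)%R).
{ unfold r2. apply Rmin_glb_lt; auto. rewrite <- Rinv_1 at 1. apply Rinv_lt_contravar; lra. }
assert (M1 := Rmin_l rho (/ ((Cmod z + 1) / 2))). assert (M2 := Rmin_r rho (/ ((Cmod z + 1) / 2))).
fold r2 in M1, M2.
rewrite (mean_value (fun w => F w * / (1 - z * w)) r2 1).
- replace (1 - z * 0) with (RtoC 1) by ring. field.
- intros w Hw. destruct (DF w) as [l Hl]; [lra|].
  destruct (Cder_kernel z w) as [k Hk].
  + rewrite Cmod_mult. apply Rle_lt_trans with (Cmod z * (/ ((Cmod z + 1) / 2)))%R.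
    * apply Rmult_le_compat_l; lra.
    * apply (Rmult_lt_reg_r ((Cmod z + 1) / 2)); [lra|].
      rewrite Rmult_assoc, Rinv_l by lra. lra.
  + eexists. apply (Cder_mult F (fun w => / (1 - z * w))); eauto.
- lra.
Qed.

(** An explicit primitive is what the Riemann integral and the Lebesgue integral have in common. *)
Lemma RInt_primitive (f : R -> R) : (forall x, continuity_pt f x) ->
  exists Phi : R -> R, (forall x, derivable_pt_lim Phi x (f x)) /\
    forall a b, RInt f a b = (Phi b - Phi a)%R.
Proof.
intros H.
assert (Hc : forall x, continuous f x) by (intros x; apply continuity_pt_filterlim, H).
assert (Hi : forall a b, ex_RInt f a b) by (intros a b; apply (@ex_RInt_continuous R_CompleteNormedModule); auto).
exists (fun x => RInt f 0 x). split.
- intros x. apply is_derive_Reals.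
  apply (is_derive_RInt f (fun x => RInt f 0 x) 0 x); auto.
  exists (mkposreal 1 Rlt_0_1). intros y _. apply (@RInt_correct R_CompleteNormedModule); auto.
- intros a b.
  assert (E := RInt_Chasles f 0 a b (Hi _ _) (Hi _ _)).
  unfold plus in E; simpl in E. lra.
Qed.

Lemma two_PI_pos : (0 < 2 * PI)%R.
Proof. generalize PI_RGT_0. lra. Qed.

End CplxAnalysis.

(** * Lebesgue measurability and integration over the parameter interval of the circle *)

Module CircleIntegral.
Import all_boot all_order all_algebra all_classical all_reals all_analysis.
Import Rstruct Rstruct_topology.
Import Reals.
Import Order.TTheory GRing.Theory Num.Theory numFieldNormedType.Exports.
Import measurable_realfun lra.
Local Open Scope classical_set_scope.
Local Open Scope ring_scope.

Notation leb := (@lebesgue_measure R).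

Definition mT (f : R -> R) : Prop := measurable_fun Tpar (f : Rm -> Rm).
Definition intg (f : R -> R) : Prop := leb.-integrable Tpar (EFin \o (f : Rm -> R)).
Definition I (f : R -> R) : R := Rintegral leb Tpar (f : Rm -> R).
Definition aeT (P : R -> Prop) : Prop := {ae leb, forall t, Tpar t -> P t}.
Definition inT (t : R) : Prop := (0 <= t <= 2 * PI)%coqR.

Lemma Tpar_inT t : Tpar t <-> inT t.
Proof.
rewrite /Tpar /inT /= in_itv /=; split.
- by move=> /andP[/RleP H1 /RleP H2]; split.
- by move=> [/RleP H1 /RleP H2]; apply/andP; split.
Qed.

Lemma measurable_Tpar : measurable Tpar.
Proof. exact: measurable_itv. Qed.

Lemma leb_Tpar : leb Tpar = (2 * PI)%:E.
Proof.
have PIp : 0 <= 2 * PI :> R by exact/RleP/Rlt_le/CplxAnalysis.two_PI_pos.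
rewrite /Tpar lebesgue_measure_itv /= lte_fin; case: ltP => [_|].
  by rewrite -EFinB subr0.
by move=> h; have -> : 2 * PI = 0 by apply/eqP; rewrite eq_le h PIp.
Qed.

Lemma leb_Tpar_fin : (leb Tpar < +oo)%E.
Proof. by rewrite leb_Tpar ltry. Qed.

Lemma mT_cont f : (forall x, continuity_pt f x) -> mT f.
Proof.
move=> H; apply: (@measurable_funS _ _ _ _ setT) => //.
apply: continuous_measurable_fun => x; exact/continuity_pt_cvg.
Qed.

Lemma mT_ext f g : (forall t, inT t -> f t = g t) -> mT f -> mT g.
Proof.
move=> H; apply: eq_measurable_fun => t /set_mem /Tpar_inT; exact: H.
Qed.

Lemma mT_const c : mT (fun _ => c).
Proof. exact: measurable_cst. Qed.

Lemma mT_add f g : mT f -> mT g -> mT (fun t => f t + g t)%coqR.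
Proof. exact: measurable_funD. Qed.

Lemma mT_sub f g : mT f -> mT g -> mT (fun t => f t - g t)%coqR.
Proof. exact: measurable_funB. Qed.

Lemma mT_mul f g : mT f -> mT g -> mT (fun t => f t * g t)%coqR.
Proof. exact: measurable_funM. Qed.

Lemma mT_opp f : mT f -> mT (fun t => - f t)%coqR.
Proof. exact: measurable_funN. Qed.

Lemma mT_max f g : mT f -> mT g -> mT (fun t => Rmax (f t) (g t)).
Proof.
move=> mf mg; apply: (@mT_ext (fun t => Num.max (f t) (g t))); first by move=> t _; rewrite RmaxE.
exact: measurable_maxr.
Qed.

Lemma mT_min f g : mT f -> mT g -> mT (fun t => Rmin (f t) (g t)).
Proof.
move=> mf mg; apply: (@mT_ext (fun t => Num.min (f t) (g t))); first by move=> t _; rewrite RminE.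
exact: measurable_minr.
Qed.

Lemma mT_powR p f : mT f -> mT (fun t => powR (f t) p).
Proof.
by move=> mf; apply: (@measurableT_comp _ _ _ _ _ _ (fun x : Rm => powR x p : Rm)) => //; exact: measurable_powR.
Qed.

(** [1 / f = f * (f^2)^(-1)] reduces the claim to powers of a nonnegative function, and it also
    holds at the zeros of [f], where the inverse is 0. *)
Lemma mT_inv f : mT f -> mT (fun t => / f t)%coqR.
Proof.
move=> mf; apply: (@mT_ext (fun t => f t * (powR (f t * f t) (-1)))).
  move=> t _; rewrite powR_inv1 ?RinvE -?expr2 ?sqr_ge0 //.
  have [->|nz] := eqVneq (f t) 0; first by rewrite mul0r invr0.
  by rewrite expr2 invfM mulrA mulfV // mul1r.
by apply: mT_mul => //; apply: mT_powR; apply: mT_mul.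
Qed.

Lemma mT_abs f : mT f -> mT (fun t => Rabs (f t)).
Proof.
move=> mf; apply: (@mT_ext (fun t => `|f t|)); first by move=> t _; rewrite RabsE.
apply: (@measurableT_comp _ _ _ _ _ _ (fun x : Rm => `|x| : Rm)) => //.
exact: normr_measurable.
Qed.

Lemma mT_sqrt f : (forall t, inT t -> 0 <= f t)%coqR -> mT f -> mT (fun t => sqrt (f t)).
Proof.
move=> H mf; apply: (@mT_ext (fun t => powR (f t) (2^-1))); last exact: mT_powR.
by move=> t /H /RleP h; rewrite powR12_sqrt // RsqrtE.
Qed.

Lemma intg_mT f : intg f -> mT f.
Proof. by move=> /integrableP[+ _] => /measurable_EFinP. Qed.

Lemma intg_dom f g : mT f -> intg g -> (forall t, inT t -> Rabs (f t) <= g t)%coqR -> intg f.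
Proof.
move=> mf ig H; apply: (le_integrable measurable_Tpar _ _ ig); first exact/measurable_EFinP.
move=> t /Tpar_inT /H /RleP h /=; rewrite lee_fin -RabsE; apply: (le_trans h).
exact: ler_norm.
Qed.

Lemma intg_const c : intg (fun _ => c).
Proof.
apply: (measurable_bounded_integrable measurable_Tpar leb_Tpar_fin) => //.
exists `|c|; split => // x cx t _ /=; exact: ltW.
Qed.

Lemma I_const c : I (fun _ => c) = (2 * PI * c)%coqR.
Proof.
rewrite /I (@Rintegral_cst _ _ _ leb Tpar measurable_Tpar c).
rewrite -[fine _]/(fine (leb Tpar)) leb_Tpar.
exact: mulrC.
Qed.

Lemma intg_add f g : intg f -> intg g -> intg (fun t => f t + g t)%coqR.
Proof. by move=> hf hg; exact: (integrableD measurable_Tpar hf hg). Qed.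

Lemma I_add f g : intg f -> intg g -> I (fun t => f t + g t)%coqR = (I f + I g)%coqR.
Proof. by move=> hf hg; exact: (RintegralD measurable_Tpar hf hg). Qed.

Lemma intg_sub f g : intg f -> intg g -> intg (fun t => f t - g t)%coqR.
Proof. by move=> hf hg; exact: (integrableB measurable_Tpar hf hg). Qed.

Lemma I_sub f g : intg f -> intg g -> I (fun t => f t - g t)%coqR = (I f - I g)%coqR.
Proof. by move=> hf hg; exact: (RintegralB measurable_Tpar hf hg). Qed.

Lemma intg_scal c f : intg f -> intg (fun t => c * f t)%coqR.
Proof. by move=> hf; exact: (integrableZl measurable_Tpar c hf). Qed.

Lemma I_scal c f : intg f -> I (fun t => c * f t)%coqR = (c * I f)%coqR.
Proof. by move=> hf; exact: (RintegralZl c measurable_Tpar hf). Qed.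

Lemma intg_abs f : intg f -> intg (fun t => Rabs (f t)).
Proof.
move=> hf; apply: (@intg_dom _ (fun t => `|f t|)); first by apply: mT_abs; apply: intg_mT.
  exact: integrable_norm.
by move=> t _; rewrite Rabs_Rabsolu RabsE; exact: Rle_refl.
Qed.

Lemma I_le f g : intg f -> intg g -> (forall t, inT t -> f t <= g t)%coqR -> (I f <= I g)%coqR.
Proof.
move=> hf hg H; apply/RleP; apply: (le_Rintegral measurable_Tpar hf hg).
by move=> t /Tpar_inT /H /RleP.
Qed.

Lemma I_ext f g : (forall t, inT t -> f t = g t) -> I f = I g.
Proof. by move=> H; apply: eq_Rintegral => t /set_mem /Tpar_inT /H. Qed.

Lemma intg_ext f g : (forall t, inT t -> f t = g t) -> intg f -> intg g.
Proof.
move=> H; apply: (eq_integrable measurable_Tpar) => t /set_mem /Tpar_inT /H /= -> //.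
Qed.

Lemma I_ge0 f : (forall t, inT t -> 0 <= f t)%coqR -> (0 <= I f)%coqR.
Proof. by move=> H; apply/RleP; apply: Rintegral_ge0 => t /Tpar_inT /H /RleP. Qed.

Lemma Rabs_I f : intg f -> (Rabs (I f) <= I (fun t => Rabs (f t)))%coqR.
Proof.
move=> hf; rewrite RabsE (@I_ext (fun t => Rabs (f t)) (fun t => `|f t|)); last by move=> t _; exact: RabsE.
by apply/RleP; exact: (le_normr_Rintegral measurable_Tpar hf).
Qed.

Lemma aeT_all (P : R -> Prop) : (forall t, inT t -> P t) -> aeT P.
Proof. by move=> H; apply: aeW => t /Tpar_inT; exact: H. Qed.

Lemma aeT_imp (P Q : R -> Prop) : (forall t, inT t -> P t -> Q t) -> aeT P -> aeT Q.
Proof.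
rewrite /aeT => H; apply: filterS => t h Tt; apply: H; first exact/Tpar_inT.
exact: h.
Qed.

Lemma aeT_and (P Q : R -> Prop) : aeT P -> aeT Q -> aeT (fun t => P t /\ Q t).
Proof.
rewrite /aeT => hP hQ; apply: filterS2 hP hQ => t h1 h2 Tt; split; [exact: h1|exact: h2].
Qed.

Lemma aeT_interior : aeT (fun t => 0 < t < 2 * PI)%coqR.
Proof.
have neg1 (x : R) : leb.-negligible ([set x] : set Rm).
  apply/(negligibleP leb (measurable_set1 x)); exact: lebesgue_measure_set1.
apply: (negligibleS _ (negligibleU (neg1 0) (neg1 (2 * PI)))) => t /= /not_implyP[/Tpar_inT Tt nt].
case: Tt => h1 h2; case: (Rle_lt_or_eq_dec _ _ h1) => [h1'|<-]; last by left.
case: (Rle_lt_or_eq_dec _ _ h2) => [h2'|->]; last by right.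
by exfalso; apply: nt.
Qed.

Lemma I_ae_ext f g : mT f -> mT g -> aeT (fun t => f t = g t) -> I f = I g.
Proof.
rewrite /aeT => mf mg H; rewrite /I /Rintegral; congr fine.
apply: ae_eq_integral => //; [exact: measurable_Tpar|exact/measurable_EFinP|exact/measurable_EFinP|].
by apply: filterS H => t h Tt; rewrite h.
Qed.

(** * Limits in epsilon form, dominated convergence and Fatou's lemma *)

Lemma cvg_seqP (K : realType) (u : nat -> K) (l : K) :
  (u @ \oo --> l) <-> (forall e : K, 0 < e -> exists N : nat, forall n : nat, leq N n -> `|u n - l| < e).
Proof.
split=> [/cvgrPdist_lt H e e0|H].
- have [N _ HN] := H e e0; exists N => n Nn; rewrite distrC; exact: HN.
- apply/cvgrPdist_lt => e e0; have [N HN] := H e e0.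
  by exists N => // n /= Nn; rewrite distrC; exact: HN.
Qed.

Lemma cvg_leftP (K : realType) (f : K -> K) (x l : K) :
  (f @ x^'- --> l) <->
  (forall e : K, 0 < e -> exists2 d : K, 0 < d & forall r : K, x - d < r < x -> `|f r - l| < e).
Proof.
split=> [/cvgrPdist_lt H e e0|H].
- have [d /= d0 Hd] := H e e0; exists d => // r /andP[r1 r2]; rewrite distrC; apply: Hd => //=.
  by rewrite ltr_distl; apply/andP; split; lra.
- apply/cvgrPdist_lt => e e0; have [d d0 Hd] := H e e0.
  exists d => //= r /=; rewrite distrC ltr_distl => /andP[r1 r2] rx; rewrite distrC; apply: Hd.
  by apply/andP; split; lra.
Qed.

Lemma Un_cvP (u : nat -> R) (l : R) : Un_cv u l <-> (u @ \oo --> l).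
Proof.
rewrite (cvg_seqP _ u l); split=> H e.
- move=> /RltP e0; have [N HN] := H e e0.
  exists N => n /ssrnat.leP Nn; apply/RltP; rewrite -RdistE; exact: HN.
- move=> /RltP e0; have [N HN] := H e e0.
  exists N => n /ssrnat.leP Nn; rewrite RdistE; apply/RltP; exact: HN.
Qed.

Lemma left_limitP (f : R -> R) (l : R) :
  (f @ (1 : R)^'- --> l) <->
  (forall e, 0 < e -> exists d, 0 < d /\ forall r, 1 - d < r < 1 -> Rabs (f r - l) < e)%coqR.
Proof.
rewrite (cvg_leftP _ f 1 l); split=> H e.
- move=> /RltP e0; have [d d0 Hd] := H e e0.
  exists d; split; first exact/RltP.
  move=> r [/RltP r1 /RltP r2]; rewrite RabsE; apply/RltP/Hd; exact/andP.
- move=> /RltP e0; have [d [/RltP d0 Hd]] := H e e0.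
  exists d => // r /andP[/RltP r1 /RltP r2]; rewrite -RabsE; apply/RltP/Hd; split => //.
Qed.

Lemma dct (f : nat -> R -> R) F g : (forall n, mT (f n)) -> mT F ->
  aeT (fun t => Un_cv (fun n => f n t) (F t)) -> intg g ->
  (forall n t, inT t -> Rabs (f n t) <= g t)%coqR ->
  intg F /\ Un_cv (fun n => I (f n)) (I F).
Proof.
rewrite /aeT => mf mF cf ig H.
have H' : {ae leb, forall (t : Rm) (n : nat), Tpar t -> (`|(EFin \o f n) t| <= (EFin \o g) t)%E}.
  apply: aeW => t n /Tpar_inT Tt /=; rewrite lee_fin -RabsE; apply/RleP; exact: H.
have cf' : {ae leb, forall t : Rm, Tpar t -> (EFin \o f n) t @[n --> \oo] --> (EFin \o F) t}.
  apply: filterS cf => t h Tt; apply/fine_cvgP; split; first by near=> n.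
  exact/Un_cvP/h.
have [iF _ C] := @dominated_convergence _ _ R leb Tpar measurable_Tpar
  (fun n => EFin \o (f n : Rm -> R)) (EFin \o F) (EFin \o g)
  (fun n => (measurable_EFinP _ _).2 (mf n)) ((measurable_EFinP _ _).2 mF) cf' ig H'.
split => //; apply/Un_cvP.
rewrite /I /Rintegral; apply: fine_cvg; rewrite fineK //.
exact: (integrable_fin_num measurable_Tpar iF).
Unshelve. all: by end_near.
Qed.

(** Integrability of the limit is part of the conclusion: this is how uniform bounds on smaller
    circles yield finite norms on the boundary. *)
Lemma fatou_le (f : nat -> R -> R) F (M : R) : (forall n, intg (f n)) -> mT F ->
  (forall n t, inT t -> 0 <= f n t)%coqR ->
  (forall t, inT t -> 0 <= F t)%coqR ->
  aeT (fun t => Un_cv (fun n => f n t) (F t)) -> (forall n, I (f n) <= M)%coqR ->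
  intg F /\ (I F <= M)%coqR.
Proof.
rewrite /aeT => if_ mF f0 F0 cf H.
have mf n : measurable_fun Tpar (EFin \o (f n : Rm -> R)) by apply/measurable_EFinP; exact: intg_mT.
have f0' n (x : Rm) : Tpar x -> (0 <= (EFin \o f n) x)%E.
  by move=> /Tpar_inT /(f0 n) /RleP h; rewrite lee_fin.
have := @fatou _ _ R leb Tpar measurable_Tpar _ mf f0'.
move=> Fa.
have mli : measurable_fun Tpar (fun x : Rm => limn_einf (fun n => (EFin \o f n) x)).
  rewrite /limn_einf; apply: measurableT_comp; first exact: oppe_measurable.
  apply: measurable_fun_limn_esup => n.
  apply: (measurableT_comp (f := @oppe R)); first exact: oppe_measurable.
  exact: mf.
have li0 (x : Rm) : Tpar x -> (0 <= limn_einf (fun n => (EFin \o f n) x))%E.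
  move=> Tx; rewrite limn_einf_lim; apply: lime_ge; first exact: is_cvg_einfs.
  apply: nearW => n; apply: le_ereal_inf_tmp => _ [m _ <-]; exact: f0'.
have F0' (x : Rm) : Tpar x -> (0 <= (EFin \o F) x)%E.
  by move=> /Tpar_inT /(F0) /RleP h; rewrite lee_fin.
have FM : (\int[leb]_(x in Tpar) (EFin \o F) x <= M%:E)%E.
  apply: (@le_trans _ _ (\int[leb]_(x in Tpar) limn_einf (fun n => (EFin \o f n) x))%E).
    apply: ae_ge0_le_integral => //; first exact: measurable_Tpar.
      exact/measurable_EFinP.
    apply: filterS cf => t h Tt.
    have /cvg_limn_einf_sup[-> _] // : (EFin \o f n) t @[n --> \oo] --> (EFin \o F) t.
    apply/fine_cvgP; split; first by near=> n.
    exact/Un_cvP/h.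
  apply: (le_trans Fa); rewrite limn_einf_lim; apply: lime_le; first exact: is_cvg_einfs.
  apply: nearW => n; apply: ge_ereal_inf; exists (\int[leb]_(x in Tpar) (EFin \o f n) x)%E.
    by exists n => //=.
  rewrite -[X in (X <= _)%E]fineK; last exact: (integrable_fin_num measurable_Tpar (if_ n)).
  rewrite lee_fin; apply/RleP; exact: H.
have iF : intg F.
  apply/integrableP; split; first exact/measurable_EFinP.
  apply: le_lt_trans (ltry M); apply: le_trans FM.
  rewrite (@eq_integral _ _ _ leb _ (EFin \o F)) // => x /set_mem Tx.
  by rewrite gee0_abs // F0'.
split => //; apply/RleP; rewrite -lee_fin /I /Rintegral fineK //.
exact: (integrable_fin_num measurable_Tpar iF).
Unshelve. all: by end_near.
Qed.

(** * Agreement of the Lebesgue and Riemann integrals of continuous functions *)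

Lemma is_derive_of_quotient (K : realType) (f : K -> K) (x l : K) :
  (forall e : K, 0 < e -> exists2 d : K, 0 < d &
    forall h : K, h != 0 -> `|h| < d -> `|(f (x + h) - f x) / h - l| < e) ->
  is_derive x 1 f l.
Proof.
move=> H.
have C : (h^-1 *: (f (h *: (1 : K) + x) - f x)) @[h --> 0^'] --> l.
  apply/cvgrPdist_lt => e e0; have [d d0 Hd] := H e e0.
  exists d => //= h /=; rewrite sub0r normrN => hd h0; rewrite distrC.
  have := Hd h h0 hd; by rewrite /GRing.scale /= mulr1 [h + x]addrC mulrC.
apply: DeriveDef; last exact: cvg_lim C.
by apply/cvg_ex; exists l.
Qed.

Lemma integral_primitive (K : realType) (f F : K -> K) (a b : K) : a < b ->
  continuous f -> (forall x : K, is_derive x 1 F (f x)) ->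
  (\int[lebesgue_measure]_(x in `[a, b]) (f x)%:E)%E = ((F b)%:E - (F a)%:E)%E.
Proof.
move=> ab cf dF.
have cF (x : K) : {for x, continuous F}.
  by apply: differentiable_continuous; apply/derivable1_diffP; have [] := dF x.
apply: continuous_FTC2 => //.
- exact: continuous_subspaceT.
- split=> [x _| |]; first by have [] := dF x.
  + exact/cvg_at_right_filter/cF.
  + exact/cvg_at_left_filter/cF.
- by move=> x _; rewrite derive1E; have [] := dF x.
Qed.

(** Both integrals equal [Phi (2 * PI) - Phi 0] for the same primitive [Phi]. *)
Lemma I_RInt f : (forall x, continuity_pt f x) ->
  intg f /\ I f = @Coquelicot.RInt.RInt Coquelicot.Hierarchy.R_CompleteNormedModule f 0%coqR (2 * PI)%coqR.
Proof.
move=> cf; have [Phi [dPhi ->]] := CplxAnalysis.RInt_primitive f cf.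
have PIp : 0 < 2 * PI :> R by exact/RltP/CplxAnalysis.two_PI_pos.
have cf' (x : R) : {for x, continuous f} by exact/continuity_pt_cvg.
have E := @integral_primitive R f Phi 0 (2 * PI) PIp cf' _.
have {}E : (\int[leb]_(x in Tpar) (f x)%:E)%E = ((Phi (2 * PI))%:E - (Phi 0)%:E)%E.
  apply: E => x; apply: is_derive_of_quotient => e /RltP e0.
  have [d Hd] := dPhi x e e0; exists (pos d); first exact/RltP/cond_pos.
  move=> h /eqP h0 /RltP; rewrite -RabsE => hd; apply/RltP; rewrite -RabsE -RdivE; exact: Hd.
split; last by rewrite /I /Rintegral E.
apply: (@continuous_compact_integrable R f Tpar); first exact: segment_compact.
by apply: continuous_subspaceT => x; exact: cf'.
Qed.

(** * Fubini's theorem for convolutions *)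

(** Extension by zero, so that Fubini's theorem can be applied on the whole plane. *)
Definition cut (f : R -> R) (t : R) : R := (f \_ Tpar) t.

Lemma EFin_cut f : EFin \o cut f = ((EFin \o f) \_ Tpar : Rm -> \bar R).
Proof. by apply/funext => t; rewrite /cut /= /patch; case: ifP. Qed.

Lemma intg_cut f : intg f <-> leb.-integrable setT (EFin \o cut f).
Proof. by rewrite EFin_cut; exact: (integrable_mkcond _ measurable_Tpar). Qed.

Lemma integral_cut f : (\int[leb]_x (cut f x)%:E = \int[leb]_(x in Tpar) (f x)%:E)%E.
Proof. by rewrite [RHS]integral_mkcond -EFin_cut. Qed.

Lemma EFin_I f : intg f -> (\int[leb]_(x in Tpar) (f x)%:E)%E = (I f)%:E.
Proof. by move=> hf; rewrite /I /Rintegral fineK //; exact: (integrable_fin_num measurable_Tpar hf). Qed.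

Lemma mT_cut f : mT f -> measurable_fun setT (cut f : Rm -> Rm).
Proof. by move=> mf; apply/(measurable_restrictT _ measurable_Tpar). Qed.

Lemma cut_mul f g t : cut (fun t => f t * g t)%coqR t = (cut f t * g t)%coqR.
Proof. by rewrite /cut /patch; case: ifP => // _; rewrite RmultE mul0r. Qed.

(** [a] is integrable while [b] and [k] are bounded, so the double integrand is dominated on the
    square by [A * B * |a|]. The kernel depends on [x - t] alone, as the Poisson and Cauchy kernels
    at a fixed radius do. *)
Lemma fubini_conv (a b k : R -> R) (A B : R) : intg a -> mT b ->
  (forall t, inT t -> Rabs (b t) <= B)%coqR ->
  (forall x, continuity_pt k x) -> (forall x, Rabs (k x) <= A)%coqR ->
  [/\ intg (fun x => b x * I (fun t => a t * k (x - t)))%coqR,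
      intg (fun t => a t * I (fun x => b x * k (x - t)))%coqR &
      I (fun x => b x * I (fun t => a t * k (x - t)))%coqR =
      I (fun t => a t * I (fun x => b x * k (x - t)))%coqR].
Proof.
move=> ia mb bB ck kA.
have mk : measurable_fun setT (k : Rm -> Rm).
  by apply: continuous_measurable_fun => x; exact/continuity_pt_cvg.
have B0 : 0 <= B.
  apply: (@le_trans _ _ (Rabs (b 0%coqR))); first by rewrite RabsE.
  apply/RleP/bB; split; first exact: Rle_refl.
  exact/Rlt_le/CplxAnalysis.two_PI_pos.
have A0 : 0 <= A.
  by apply: (@le_trans _ _ (Rabs (k 0%coqR))); [rewrite RabsE|exact/RleP/kA].
pose F := fun z : Rm * Rm => (cut b z.1 * (cut a z.2 * k (z.1 - z.2)))%:E.
have mF : measurable_fun setT F.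
  apply/measurable_EFinP; apply: measurable_funM; first exact: (measurableT_comp (mT_cut _ mb)).
  apply: measurable_funM.
    by apply: (measurableT_comp (mT_cut _ (intg_mT _ ia))).
  apply: (measurableT_comp mk); exact: measurable_funB.
have cutb x : `|cut b x| <= B.
  rewrite /cut /patch; case: ifPn => [/set_mem /Tpar_inT /bB /RleP|_]; first by rewrite RabsE.
  by rewrite normr0.
have kA' x : `|k x| <= A by rewrite -RabsE; exact/RleP/kA.
have iak x : intg (fun t => a t * k (x - t))%coqR.
  apply: (@intg_dom _ (fun t => A * Rabs (a t))%coqR).
  - apply: mT_mul; first exact: intg_mT.
    by apply: mT_cont => t; apply: (continuity_pt_comp (fun t => (x - t)%coqR) k) => //; reg.
  - exact/intg_scal/intg_abs.
  - move=> t _; rewrite !RabsE normrM [_ * `|k _|]mulrC; apply/RleP; exact: ler_wpM2r.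
have ibk t : intg (fun x => b x * k (x - t))%coqR.
  apply: (@intg_dom _ (fun _ => B * A)%coqR).
  - apply: mT_mul => //.
    by apply: mT_cont => x; apply: (continuity_pt_comp (fun x => (x - t)%coqR) k) => //; reg.
  - exact: intg_const.
  - move=> x Tx; rewrite RabsE normrM; apply/RleP; apply: ler_pM => //.
    by rewrite -RabsE; apply/RleP/bB.
have FE x : (\int[leb]_y F (x, y))%E = (cut b x * I (fun t => a t * k (x - t))%coqR)%:E.
  transitivity (\int[leb]_y ((cut b x)%:E * (cut (fun t => a t * k (x - t))%coqR y)%:E))%E.
    by apply: eq_integral => y _; rewrite cut_mul -EFinM.
  rewrite integralZl //; last exact/intg_cut.
  by rewrite integral_cut EFin_I.
have GE y : (\int[leb]_x F (x, y))%E = (cut a y * I (fun x => b x * k (x - y))%coqR)%:E.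
  transitivity (\int[leb]_x ((cut a y)%:E * (cut (fun x => b x * k (x - y))%coqR x)%:E))%E.
    by apply: eq_integral => x _; rewrite cut_mul -EFinM /F mulrCA.
  rewrite integralZl //; last exact/intg_cut.
  by rewrite integral_cut EFin_I.
have iF : (leb \x leb)%E.-integrable setT F.
  apply/(@integrable12ltyP _ _ _ _ _ leb leb _ mF).
  pose cc := B * A * I (fun t => Rabs (a t)).
  have cc0 : 0 <= cc.
    by apply: mulr_ge0; [exact: mulr_ge0|apply/RleP/I_ge0 => t _; exact: Rabs_pos].
  have E x : (\int[leb]_y `|F (x, y)| <= (cut (fun=> cc) x)%:E)%E.
    apply: (@le_trans _ _ (\int[leb]_y ((`|cut b x| * A)%:E * (cut (fun t => Rabs (a t)) y)%:E))%E).
      apply: ge0_le_integral => //.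
      + by apply: measurableT_comp => //; exact: (measurableT_comp mF (measurable_pair1 x)).
      + apply: measurable_funeM; apply/measurable_EFinP; apply: mT_cut; apply: mT_abs; exact: intg_mT.
      + move=> y _; rewrite /F /= -EFinM lee_fin !normrM -mulrA; apply: ler_wpM2l => //.
        rewrite mulrC; apply: ler_pM => //.
        by rewrite /cut /patch; case: ifP => _; rewrite ?RabsE ?normr0.
    rewrite integralZl //; last by apply/intg_cut; exact: intg_abs.
    rewrite integral_cut EFin_I; last exact: intg_abs.
    rewrite -EFinM lee_fin /cc /cut /patch; case: ifPn => [/set_mem /Tpar_inT /bB /RleP|_].
      rewrite RabsE => h; apply: ler_wpM2r; first by apply/RleP/I_ge0 => t _; exact: Rabs_pos.
      exact: ler_wpM2r.
    by rewrite normr0 !mul0r.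
  apply: (@le_lt_trans _ _ (\int[leb]_x (cut (fun=> cc) x)%:E)%E).
    apply: ge0_le_integral => //.
    - by move=> x _; apply: integral_ge0.
    - have mFa : measurable_fun setT (fun z => `|F z|)%E by exact: measurableT_comp.
      exact: (@measurable_fun_fubini_tonelli_F _ _ _ _ _ leb _ mFa (fun=> abse_ge0 _)).
    - by apply/measurable_EFinP; apply: mT_cut; exact: mT_const.
  by rewrite integral_cut EFin_I ?ltry //; exact: intg_const.
have bF : intg (fun x => b x * I (fun t => a t * k (x - t)))%coqR.
  apply/intg_cut; have := integrable_fubini_F iF; congr (_.-integrable _ _).
  by apply/funext => x; rewrite /fubini_F FE /= cut_mul.
have bG : intg (fun t => a t * I (fun x => b x * k (x - t)))%coqR.
  apply: (@intg_dom _ (fun t => (2 * PI * (B * A)) * Rabs (a t))%coqR).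
  - apply/(measurable_restrictT _ measurable_Tpar)/measurable_EFinP.
    have := measurable_fubini_G iF; congr measurable_fun.
    by apply/funext => x; rewrite /fubini_G GE; exact: (congr1 EFin (esym (cut_mul _ _ _))).
  - exact/intg_scal/intg_abs.
  - move=> t _; rewrite Rabs_mult Rmult_comm; apply: Rmult_le_compat_r; first exact: Rabs_pos.
    rewrite -I_const; apply: (Rle_trans _ (I (fun x => Rabs (b x * k (x - t))%coqR))).
      exact/Rabs_I.
    apply: I_le; [exact: intg_abs|exact: intg_const|move=> x /bB /RleP; rewrite !RabsE => h].
    by apply/RleP; rewrite normrM; apply: ler_pM.
split => //; apply: EFin_inj; rewrite -!EFin_I // -!integral_cut.
transitivity (\int[leb]_x \int[leb]_y F (x, y))%E.
  by apply: eq_integral => x _; rewrite FE cut_mul.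
by rewrite (Fubini iF); apply: eq_integral => y _; rewrite GE cut_mul.
Qed.

(* A constant of its own, so that [simpl] and unification never see the body of [powR].
   As in [powR], [pw 0 s = 0] unless [s = 0]. *)
Definition pw (x s : R) : R := powR x s.

Lemma pw_exp x s : (0 < x)%coqR -> pw x s = exp (s * Rpower.ln x)%coqR.
Proof. by move=> /RltP x0; rewrite /pw /powR gt_eqF // RexpE RlnE. Qed.

Lemma pw_0 s : s <> 0%coqR -> pw 0%coqR s = 0%coqR.
Proof. by move=> /eqP s0; rewrite /pw powR0. Qed.

Lemma pw_ge0 x s : (0 <= pw x s)%coqR.
Proof. exact/RleP/powR_ge0. Qed.

Lemma mT_pw p f : mT f -> mT (fun t => pw (f t) p).
Proof. exact: mT_powR. Qed.

(** * Norms, Hardy spaces and orthogonality in terms of real-valued integrals *)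

Lemma muE g t : mu g t = (Cmod (g (polar 1%coqR t)) * Cmod (g (polar 1%coqR t)))%coqR.
Proof. by rewrite /mu expr2. Qed.

Lemma intg_lty F : mT F -> (forall t, inT t -> 0 <= F t)%coqR ->
  (\int[leb]_(t in Tpar) (F t)%:E < +oo)%E <-> intg F.
Proof.
move=> mF F0.
have E : (\int[leb]_(t in Tpar) (F t)%:E = \int[leb]_(t in Tpar) `|(EFin \o F) t|)%E.
  by apply: eq_integral => t /set_mem /Tpar_inT /F0 /RleP h; rewrite gee0_abs.
split=> [h|/integrableP[_]]; last by rewrite -E.
by apply/integrableP; split; [exact/measurable_EFinP|rewrite -E].
Qed.

Definition cmT (f : R -> cplx) : Prop := mT (fun t => fst (f t)) /\ mT (fun t => snd (f t)).

Definition pdens (g : cplx -> cplx) (p : R) (f : R -> cplx) (t : R) : R :=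
  (pw (Cmod (f t)) p * (Cmod (g (polar 1 t)) * Cmod (g (polar 1 t))))%coqR.

Lemma pdens_ge0 g p f t : (0 <= pdens g p f t)%coqR.
Proof.
by apply: Rmult_le_pos; [exact: pw_ge0|apply: Rmult_le_pos; exact: Coquelicot.Complex.Cmod_ge_0].
Qed.

Lemma pnorm_powE g p f :
  pnorm_pow g p f = (\int[leb]_(t in Tpar) (pdens g p f t)%:E)%E.
Proof. by rewrite /pnorm_pow; apply: eq_integral => t _; rewrite muE. Qed.

Lemma pnorm_powI g p f : intg (pdens g p f) -> pnorm_pow g p f = (I (pdens g p f))%:E.
Proof. by move=> h; rewrite pnorm_powE EFin_I. Qed.

Lemma mT_Cmod f : cmT f -> mT (fun t => Cmod (f t)).
Proof.
move=> [m1 m2]; apply: (@mT_ext (fun t => sqrt (fst (f t) * fst (f t) + snd (f t) * snd (f t)))%coqR).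
  by move=> t _; rewrite /Cmod /= !Rmult_1_r.
apply: mT_sqrt; last by apply: mT_add; exact: mT_mul.
by move=> t _; apply: Rplus_le_le_0_compat; exact: Rle_0_sqr.
Qed.

Lemma LpP g p f : mT (fun t => Cmod (g (polar 1 t))) ->
  Lp g p f <-> cmT f /\ intg (pdens g p f).
Proof.
move=> mg; have P (h : cmT f) : mT (pdens g p f).
  by apply: mT_mul; [apply: mT_pw; exact: mT_Cmod|exact: mT_mul].
split=> [[cf fi]|[cf fi]]; split => //.
  by apply/intg_lty; [exact: P|move=> t _; exact: pdens_ge0|rewrite -pnorm_powE].
by rewrite pnorm_powE; apply/intg_lty => //; [exact: P|move=> t _; exact: pdens_ge0].
Qed.

Definition left_lim (f : R -> R) (l : R) : Prop :=
  (forall e, 0 < e -> exists d, 0 < d /\ forall r, 1 - d < r < 1 -> Rabs (f r - l) < e)%coqR.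

Definition pdens_r (g F : cplx -> cplx) (r t : R) : R :=
  (Cmod (F (polar r t)) * Cmod (F (polar r t)) * (Cmod (g (polar r t)) * Cmod (g (polar r t))))%coqR.

Lemma pw2 x : (0 <= x)%coqR -> pw x 2%coqR = (x * x)%coqR.
Proof.
by move=> /RleP x0; rewrite /pw; have -> : 2%coqR = 2%:R :> R by []; rewrite powR_mulrn // expr2.
Qed.

(** The integrability hypothesis turns the extended-valued means into real ones; continuity on
    circles of radius less than 1 will supply it. *)
Lemma HpP g h : mT (fun t => Cmod (g (polar 1 t))) ->
  (forall F, holo_on_disc F -> forall r, 0 <= r < 1 -> intg (pdens_r g F r))%coqR ->
  Hp g 2 h <-> [/\ cmT h, intg (pdens g 2 h) &
    exists F, [/\ holo_on_disc F,
      exists M, forall r, (0 <= r < 1)%coqR -> (I (pdens_r g F r) <= M)%coqR &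
      aeT (fun t => left_lim (fun r => fst (F (polar r t))) (fst (h t)) /\
                    left_lim (fun r => snd (F (polar r t))) (snd (h t)))]].
Proof.
move=> mg Hi.
have E F r : (\int[leb]_(t in Tpar) ((Cmod (F (polar r t))) `^ 2 * (Cmod (g (polar r t))) ^+ 2)%:E
    = \int[leb]_(t in Tpar) (pdens_r g F r t)%:E)%E.
  apply: eq_integral => t _; rewrite expr2 -[_ `^ 2]/(pw _ 2%coqR) pw2 //.
  exact: Coquelicot.Complex.Cmod_ge_0.
split=> [[/(LpP _ _ _ mg)[ch ih] [F [hF [[M HM] cF]]]]|[ch ih [F [hF [M HM] cF]]]].
- split => //; exists F; split => //.
    exists M => r hr; apply/RleP; rewrite -lee_fin -EFin_I; last exact: Hi.
    by rewrite -E; apply: HM; case: hr => /RleP -> /RltP ->.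
  rewrite /aeT; apply: filterS cF => t H Tt; have [H1 H2] := H Tt.
  by split; [exact/left_limitP|exact/left_limitP].
- split; first exact/(LpP _ _ _ mg).
  exists F; split => //; split.
    exists M => r /andP[/RleP r0 /RltP r1]; rewrite E EFin_I; last exact: Hi.
    by rewrite lee_fin; apply/RleP/HM.
  rewrite /aeT in cF; apply: filterS cF => t H Tt; have [H1 H2] := H Tt.
  by split; [exact/left_limitP|exact/left_limitP].
Qed.

Definition odens1 (g : cplx -> cplx) (u v : R -> cplx) (t : R) : R :=
  (fst (Cmult (u t) (Cconj (v t))) * (Cmod (g (polar 1 t)) * Cmod (g (polar 1 t))))%coqR.
Definition odens2 (g : cplx -> cplx) (u v : R -> cplx) (t : R) : R :=
  (snd (Cmult (u t) (Cconj (v t))) * (Cmod (g (polar 1 t)) * Cmod (g (polar 1 t))))%coqR.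

Lemma orthP g u v : intg (odens1 g u v) -> intg (odens2 g u v) ->
  orth g u v <-> I (odens1 g u v) = 0%coqR /\ I (odens2 g u v) = 0%coqR.
Proof.
move=> i1 i2; rewrite /orth.
have -> : (\int[leb]_(t in Tpar) ((Cmult (u t) (Cconj (v t))).1 * mu g t)%:E = (I (odens1 g u v))%:E)%E.
  by rewrite -EFin_I //; apply: eq_integral => t _; rewrite muE.
have -> : (\int[leb]_(t in Tpar) ((Cmult (u t) (Cconj (v t))).2 * mu g t)%:E = (I (odens2 g u v))%:E)%E.
  by rewrite -EFin_I //; apply: eq_integral => t _; rewrite muE.
by split=> -[h1 h2]; split; [exact: EFin_inj|exact: EFin_inj|rewrite h1|rewrite h2].
Qed.

Lemma pnorm_leP g p f h K : intg (pdens g p f) -> intg (pdens g p h) ->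
  (pnorm_pow g p h <= (K `^ p)%:E * pnorm_pow g p f)%E <->
  (I (pdens g p h) <= pw K p * I (pdens g p f))%coqR.
Proof.
move=> jf jh; rewrite !pnorm_powI // -EFinM lee_fin; split=> /RleP //.
Qed.

(** A finite right-hand side forces a finite left-hand side. Unboundedness can thus be shown by a
    projection whose density is not integrable. *)
Lemma pnorm_le_intg g p f h K : mT (fun t => Cmod (g (polar 1 t))) -> cmT h -> intg (pdens g p f) ->
  (pnorm_pow g p h <= (K `^ p)%:E * pnorm_pow g p f)%E -> intg (pdens g p h).
Proof.
move=> mg ch jf H; apply/intg_lty.
- by apply: mT_mul; [apply: mT_pw; exact: mT_Cmod|exact: mT_mul].
- by move=> t _; exact: pdens_ge0.
- by rewrite -pnorm_powE; apply: (le_lt_trans H); rewrite pnorm_powI // -EFinM ltry.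
Qed.

Lemma Rle_is_true (x y : R) : (x <= y)%coqR -> is_true (x <= y).
Proof. by move=> /RleP. Qed.

End CircleIntegral.

(** * Complex-valued integrals over the circle *)

Module SzegoProjection.
Import Lra Lia ClassicalEpsilon Coquelicot.Coquelicot.
Import CplxAnalysis CircleIntegral.
Local Open Scope C_scope.

Lemma Rcont_continuity_Cmod (u : R -> C) (t : R) : Rcont u t -> continuity_pt (fun s => Cmod (u s)) t.
Proof.
intros H e He. destruct (H e He) as [d [Hd K]]. exists d; split; auto. intros s [_ Hs].
eapply Rle_lt_trans; [|apply (K s Hs)]. simpl. unfold R_dist. apply Rabs_le.
assert (T1 := Cmod_triangle (u s - u t) (u t)). assert (T2 := Cmod_triangle (u t - u s) (u s)).
replace (u s - u t + u t) with (u s) in T1 by ring. replace (u t - u s + u s) with (u t) in T2 by ring.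
rewrite Cmod_sub_sym in T2. lra.
Qed.

Lemma Rcont_continuity_fst (u : R -> C) (t : R) : Rcont u t -> continuity_pt (fun s => fst (u s)) t.
Proof. intros H. apply continuity_pt_filterlim, Rcont_fst, H. Qed.

Lemma Rcont_continuity_snd (u : R -> C) (t : R) : Rcont u t -> continuity_pt (fun s => snd (u s)) t.
Proof. intros H. apply continuity_pt_filterlim, Rcont_snd, H. Qed.

Definition cintg (u : R -> C) : Prop := intg (fun t => fst (u t)) /\ intg (fun t => snd (u t)).
Definition cI (u : R -> C) : C := (I (fun t => fst (u t)), I (fun t => snd (u t))).

Lemma cmT_cont (u : R -> C) : (forall t, Rcont u t) -> cmT u.
Proof.
intros H. split; apply mT_cont; intros t; [apply Rcont_continuity_fst|apply Rcont_continuity_snd]; auto.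
Qed.

Lemma cmT_mult (u v : R -> C) : cmT u -> cmT v -> cmT (fun t => u t * v t).
Proof.
intros [u1 u2] [v1 v2]. split; simpl; [apply mT_sub|apply mT_add]; apply mT_mul; auto.
Qed.

Lemma cmT_add (u v : R -> C) : cmT u -> cmT v -> cmT (fun t => u t + v t).
Proof. intros [u1 u2] [v1 v2]. split; simpl; apply mT_add; auto. Qed.

Lemma cmT_const (c : C) : cmT (fun _ => c).
Proof. split; apply mT_const. Qed.

Lemma cmT_conj (u : R -> C) : cmT u -> cmT (fun t => Cconj (u t)).
Proof. intros [u1 u2]. split; simpl; auto. apply mT_opp; auto. Qed.

Lemma cmT_RtoC (f : R -> R) : mT f -> cmT (fun t => RtoC (f t)).
Proof. intros H. split; simpl; auto. apply mT_const. Qed.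

Lemma cmT_ext (u v : R -> C) : (forall t, inT t -> u t = v t) -> cmT u -> cmT v.
Proof.
intros H [u1 u2]. split; [apply (mT_ext (fun t => fst (u t)))|apply (mT_ext (fun t => snd (u t)))]; auto;
  intros t Ht; rewrite H; auto.
Qed.

Lemma cintg_cmT (u : R -> C) : cintg u -> cmT u.
Proof. intros [h1 h2]. split; apply intg_mT; auto. Qed.

Lemma cintg_dom (u : R -> C) (g : R -> R) : cmT u -> intg g ->
  (forall t, inT t -> (Cmod (u t) <= g t)%R) -> cintg u.
Proof.
intros [u1 u2] Hg H. split; apply (intg_dom _ g); auto; intros t Ht;
  (eapply Rle_trans; [|apply (H t Ht)]); [exact (re_le_Cmod (u t))|exact (im_le_Cmod (u t))].
Qed.

Lemma intg_Cmod (u : R -> C) : cintg u -> intg (fun t => Cmod (u t)).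
Proof.
intros Hu. apply (intg_dom _ (fun t => Rabs (fst (u t)) + Rabs (snd (u t)))%R).
- apply mT_Cmod, cintg_cmT; auto.
- destruct Hu. apply intg_add; apply intg_abs; auto.
- intros t _. rewrite Rabs_pos_eq by apply Cmod_ge_0. apply Cmod_le_abs.
Qed.

Lemma cI_ext (u v : R -> C) : (forall t, inT t -> u t = v t) -> cI u = cI v.
Proof. intros H. unfold cI. f_equal; apply I_ext; intros t Ht; rewrite H; auto. Qed.

Lemma cintg_add (u v : R -> C) : cintg u -> cintg v -> cintg (fun t => u t + v t).
Proof. intros [u1 u2] [v1 v2]. split; simpl; apply intg_add; auto. Qed.

Lemma cI_add (u v : R -> C) : cintg u -> cintg v -> cI (fun t => u t + v t) = cI u + cI v.
Proof. intros [u1 u2] [v1 v2]. apply C_ext; simpl; apply I_add; auto. Qed.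

Lemma cintg_scal (c : C) (u : R -> C) : cintg u -> cintg (fun t => c * u t).
Proof.
intros [u1 u2]. split; simpl; [apply intg_sub|apply intg_add]; apply intg_scal; auto.
Qed.

Lemma cI_scal (c : C) (u : R -> C) : cintg u -> cI (fun t => c * u t) = c * cI u.
Proof.
intros [u1 u2]. apply C_ext; simpl.
- rewrite (I_sub (fun t => fst c * fst (u t))%R (fun t => snd c * snd (u t))%R) by (apply intg_scal; auto).
  rewrite !I_scal; auto.
- rewrite (I_add (fun t => fst c * snd (u t))%R (fun t => snd c * fst (u t))%R) by (apply intg_scal; auto).
  rewrite !I_scal; auto.
Qed.

Lemma cI_bound (u : R -> C) (g : R -> R) : cintg u -> intg g ->
  (forall t, inT t -> (Cmod (u t) <= g t)%R) -> (Cmod (cI u) <= 2 * I g)%R.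
Proof.
intros [u1 u2] Hg H. eapply Rle_trans; [apply Cmod_le_abs|]. simpl.
assert (A : forall f, intg f -> (forall t, inT t -> (Rabs (f t) <= Cmod (u t))%R) -> (Rabs (I f) <= I g)%R).
{ intros f Hf Hb. eapply Rle_trans; [apply Rabs_I; auto|]. apply I_le; auto; [apply intg_abs; auto|].
  intros t Ht. eapply Rle_trans; [apply Hb; auto|apply H; auto]. }
assert (A1 := A _ u1 (fun t _ => re_le_Cmod (u t))).
assert (A2 := A _ u2 (fun t _ => im_le_Cmod (u t))). lra.
Qed.

Lemma cI_cInt (u : R -> C) : (forall t, Rcont u t) -> cintg u /\ cI u = cInt u 0 (2 * PI).
Proof.
intros H.
destruct (I_RInt (fun t => fst (u t))) as [h1 e1]; [intros; apply Rcont_continuity_fst; auto|].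
destruct (I_RInt (fun t => snd (u t))) as [h2 e2]; [intros; apply Rcont_continuity_snd; auto|].
split; [split; auto|]. unfold cI, cInt. rewrite e1, e2. reflexivity.
Qed.

Lemma intg_cont (f : R -> R) : (forall t, continuity_pt f t) -> intg f.
Proof. intros H. apply I_RInt; auto. Qed.

Lemma Rcont_polar (r t : R) : (0 <= r)%R -> Rcont (fun s => polar r s) t.
Proof. intros Hr. apply (Ccont_circle (fun w => w)); auto. apply Ccont_id. Qed.

Lemma Rcont_mult (u v : R -> C) (t : R) : Rcont u t -> Rcont v t -> Rcont (fun s => u s * v s) t.
Proof.
intros Hf Hg e He.
set (A := Cmod (u t)). set (B := Cmod (v t)).
assert (HA : (0 <= A)%R) by apply Cmod_ge_0.
assert (HB : (0 <= B)%R) by apply Cmod_ge_0.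
assert (Hk : (0 < e / (A + B + 1))%R) by (apply Rdiv_lt_0_compat; lra).
set (k := Rmin 1 (e / (A + B + 1))).
assert (Hk0 : (0 < k)%R) by (apply Rmin_pos; lra).
destruct (Hf k Hk0) as [d1 [Hd1 H1]].
destruct (Hg k Hk0) as [d2 [Hd2 H2]].
exists (Rmin d1 d2). split; [apply Rmin_pos; auto|]. intros w Hw.
assert (A1 := H1 w (Rlt_le_trans _ _ _ Hw (Rmin_l _ _))).
assert (A2 := H2 w (Rlt_le_trans _ _ _ Hw (Rmin_r _ _))).
replace (u w * v w - u t * v t) with
  ((u w - u t) * (v w - v t) + (u t * (v w - v t) + v t * (u w - u t))) by ring.
eapply Rle_lt_trans; [apply Cmod_triangle|].
eapply Rle_lt_trans; [apply Rplus_le_compat_l; apply Cmod_triangle|].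
rewrite !Cmod_mult. fold A B.
assert (K1 : (k <= 1)%R) by apply Rmin_l.
assert (K2 : (k * (A + B + 1) <= e)%R).
{ apply Rle_trans with (e / (A + B + 1) * (A + B + 1))%R.
  - apply Rmult_le_compat_r; [lra|apply Rmin_r].
  - right; field; lra. }
assert (P1 := Cmod_ge_0 (u w - u t)). assert (P2 := Cmod_ge_0 (v w - v t)).
nra.
Qed.

(** * The Cauchy transform and the Poisson kernel *)

(** The unweighted Szego kernel, up to the factor [1 / (2 * PI)]. *)
Definition ker (z : C) (t : R) : C := / (1 - z * Cconj (polar 1 t)).

Lemma Cmod_one_minus (w : C) : (1 - Cmod w <= Cmod (1 - w))%R.
Proof.
assert (T := Cmod_triangle (1 - w) w). replace (1 - w + w) with (RtoC 1) in T by ring.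
rewrite Cmod_1 in T. lra.
Qed.

Lemma Cmod_one_minus_le (w : C) : (Cmod (1 - w) <= 1 + Cmod w)%R.
Proof.
assert (T := Cmod_triangle 1 (- w)). rewrite Cmod_1, Cmod_opp in T. exact T.
Qed.

Lemma Cmod_zconj (z : C) (t : R) : Cmod (z * Cconj (polar 1 t)) = Cmod z.
Proof. rewrite Cmod_mult, Cmod_conj, Cmod_polar by lra. ring. Qed.

Lemma ker_den_neq_0 (z : C) (t : R) : (Cmod z < 1)%R -> 1 - z * Cconj (polar 1 t) <> 0.
Proof. intros Hz. apply one_minus_neq_0. rewrite Cmod_zconj; auto. Qed.

Lemma Cmod_ker_le (z : C) (t : R) : (Cmod z < 1)%R -> (Cmod (ker z t) <= / (1 - Cmod z))%R.
Proof.
intros Hz. unfold ker. rewrite Cmod_inv by (apply ker_den_neq_0; auto).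
apply Rinv_le_contravar; [lra|]. rewrite <- (Cmod_zconj z t). apply Cmod_one_minus.
Qed.

Lemma Rcont_ker (z : C) (t : R) : (Cmod z < 1)%R -> Rcont (ker z) t.
Proof.
intros Hz. unfold ker. apply (Rcont_comp Cinv (fun t => 1 - z * Cconj (polar 1 t))).
- apply (Rcont_plus (fun _ => 1) (fun t => - (z * Cconj (polar 1 t)))); [apply Rcont_const|].
  apply (Rcont_comp (fun w => - (z * w)) (fun t => Cconj (polar 1 t))).
  + apply Rcont_conj, Rcont_polar; lra.
  + apply (Ccont_ext_loc (fun w => (- z) * w) _ _ 1); [lra|intros; ring|].
    apply Ccont_mult; [apply Ccont_const|apply Ccont_id].
- apply Ccont_inv, ker_den_neq_0; auto.
Qed.

Lemma cmT_ker (z : C) : (Cmod z < 1)%R -> cmT (ker z).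
Proof. intros Hz. apply cmT_cont. intros; apply Rcont_ker; auto. Qed.

Lemma cintg_ker (v : R -> C) (z : C) : cintg v -> (Cmod z < 1)%R -> cintg (fun t => v t * ker z t).
Proof.
intros Hv Hz. apply (cintg_dom _ (fun t => / (1 - Cmod z) * Cmod (v t))%R).
- apply cmT_mult; [apply cintg_cmT; auto|apply cmT_ker; auto].
- apply intg_scal, intg_Cmod; auto.
- intros t _. rewrite Cmod_mult, Rmult_comm. apply Rmult_le_compat_r; [apply Cmod_ge_0|].
  apply Cmod_ker_le; auto.
Qed.

Lemma cmT_conj_polar : cmT (fun t => Cconj (polar 1 t)).
Proof. apply (cmT_conj (fun t => polar 1 t)), cmT_cont. intros; apply Rcont_polar; lra. Qed.

(* The Cauchy transform, i.e. the Szego projection of [v] evaluated inside the disc. *)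
Definition Cz (v : R -> C) (z : C) : C := RtoC (/ (2 * PI)) * cI (fun t => v t * ker z t).

Lemma Cz_add (u v : R -> C) (z : C) : cintg u -> cintg v -> (Cmod z < 1)%R ->
  Cz (fun t => u t + v t) z = Cz u z + Cz v z.
Proof.
intros Hu Hv Hz. unfold Cz.
rewrite (cI_ext _ (fun t => u t * ker z t + v t * ker z t)) by (intros; ring).
rewrite cI_add by (apply cintg_ker; auto). ring.
Qed.

Lemma Cz_scal (c : C) (u : R -> C) (z : C) : cintg u -> (Cmod z < 1)%R ->
  Cz (fun t => c * u t) z = c * Cz u z.
Proof.
intros Hu Hz. unfold Cz.
rewrite (cI_ext _ (fun t => c * (u t * ker z t))) by (intros; ring).
rewrite cI_scal by (apply cintg_ker; auto). ring.
Qed.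

(** The divided difference of the kernel, in the form of the slope function of [Cz]. *)
Lemma ker_sub (w z : C) (t : R) : (Cmod w < 1)%R -> (Cmod z < 1)%R ->
  ker w t - ker z t = (w - z) * (Cconj (polar 1 t) * ker w t * ker z t).
Proof.
intros Hw Hz. unfold ker. field. split; apply ker_den_neq_0; auto.
Qed.

(** By [ker_sub] the slope function is again an integral of kernels. A second use of [ker_sub] shows
    that it is continuous, all kernels being bounded by [/ d], where [d] is half the distance from
    [z] to the circle. *)
Lemma Cder_Cz (v : R -> C) (z : C) : cintg v -> (Cmod z < 1)%R -> exists l, Cder (Cz v) z l.
Proof.
intros Hv Hz.
set (d := ((1 - Cmod z) / 2)%R). assert (Hd : (0 < d)%R) by (unfold d; lra).
assert (Hin : forall w, (Cmod (w - z) < d)%R -> (Cmod w < 1 - d)%R).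
{ intros w Hw. assert (T := Cmod_triangle (w - z) z). replace (w - z + z) with w in T by ring.
  unfold d in *. lra. }
assert (Kd : forall w t, (Cmod w < 1 - d)%R -> (Cmod (ker w t) <= / d)%R).
{ intros w t Hw. eapply Rle_trans; [apply Cmod_ker_le; lra|]. apply Rinv_le_contravar; lra. }
assert (Hz' : (Cmod z < 1 - d)%R) by (unfold d; lra).
assert (Ie : forall w, (Cmod w < 1 - d)%R -> cintg (fun t => v t * (Cconj (polar 1 t) * ker w t * ker z t))).
{ intros w Hw. apply (cintg_dom _ (fun t => (/ d * / d) * Cmod (v t))%R).
  - apply cmT_mult; [apply cintg_cmT; auto|].
    apply (cmT_mult (fun t => Cconj (polar 1 t) * ker w t) (ker z)); [|apply cmT_ker; lra].
    apply (cmT_mult (fun t => Cconj (polar 1 t)) (ker w)); [|apply cmT_ker; lra].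
    apply cmT_conj_polar.
  - apply intg_scal, intg_Cmod; auto.
  - intros t _. rewrite !Cmod_mult, Cmod_conj, Cmod_polar by lra. rewrite Rmult_comm, Rmult_1_l.
    apply Rmult_le_compat_r; [apply Cmod_ge_0|]. apply Rmult_le_compat; try apply Cmod_ge_0; auto. }
exists (RtoC (/ (2 * PI)) * cI (fun t => v t * (Cconj (polar 1 t) * ker z t * ker z t))).
exists (fun w => RtoC (/ (2 * PI)) * cI (fun t => v t * (Cconj (polar 1 t) * ker w t * ker z t))).
split; [reflexivity|]. split.
- apply (Ccont_mult (fun _ => RtoC (/ (2 * PI)))); [apply Ccont_const|].
  set (M := (2 * I (fun t => (/ d * / d * / d) * Cmod (v t)))%R).
  assert (HM : (0 <= M)%R).
  { unfold M. apply Rmult_le_pos; [lra|]. apply I_ge0. intros t _.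
    apply Rmult_le_pos; [|apply Cmod_ge_0].
    assert (0 < / d)%R by (apply Rinv_0_lt_compat; auto). repeat apply Rmult_le_pos; lra. }
  intros e He. exists (Rmin d (e / (M + 1))). split; [apply Rmin_pos; auto; apply Rdiv_lt_0_compat; lra|].
  intros w Hw. assert (W1 := Rlt_le_trans _ _ _ Hw (Rmin_l _ _)).
  assert (W2 := Rlt_le_trans _ _ _ Hw (Rmin_r _ _)).
  assert (Hw1 := Hin w W1).
  set (f := fun t => v t * (Cconj (polar 1 t) * Cconj (polar 1 t) * ker w t * ker z t * ker z t)).
  assert (If : cintg f).
  { apply (cintg_dom _ (fun t => (/ d * / d * / d) * Cmod (v t))%R).
    - apply cmT_mult; [apply cintg_cmT; auto|].
      apply (cmT_mult (fun t => Cconj (polar 1 t) * Cconj (polar 1 t) * ker w t * ker z t) (ker z));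
        [|apply cmT_ker; lra].
      apply (cmT_mult (fun t => Cconj (polar 1 t) * Cconj (polar 1 t) * ker w t) (ker z)); [|apply cmT_ker; lra].
      apply (cmT_mult (fun t => Cconj (polar 1 t) * Cconj (polar 1 t)) (ker w)); [|apply cmT_ker; lra].
      apply (cmT_mult (fun t => Cconj (polar 1 t)) (fun t => Cconj (polar 1 t))); apply cmT_conj_polar.
    - apply intg_scal, intg_Cmod; auto.
    - intros t _. unfold f. rewrite !Cmod_mult, Cmod_conj, Cmod_polar by lra. rewrite Rmult_comm, !Rmult_1_l.
      apply Rmult_le_compat_r; [apply Cmod_ge_0|].
      repeat apply Rmult_le_compat; try apply Rmult_le_pos; try apply Cmod_ge_0; auto. }
  replace (cI (fun t => v t * (Cconj (polar 1 t) * ker w t * ker z t)) -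
           cI (fun t => v t * (Cconj (polar 1 t) * ker z t * ker z t)))
    with ((w - z) * cI f).
  + rewrite Cmod_mult. assert (B := cI_bound f (fun t => (/ d * / d * / d) * Cmod (v t))%R If
      (intg_scal _ _ (intg_Cmod v Hv))).
    assert (B' : (Cmod (cI f) <= M)%R).
    { apply B. intros t _. unfold f. rewrite !Cmod_mult, Cmod_conj, Cmod_polar by lra.
      rewrite Rmult_comm, !Rmult_1_l.
      apply Rmult_le_compat_r; [apply Cmod_ge_0|].
      repeat apply Rmult_le_compat; try apply Rmult_le_pos; try apply Cmod_ge_0; auto. }
    apply Rle_lt_trans with (Cmod (w - z) * M)%R; [apply Rmult_le_compat_l; [apply Cmod_ge_0|auto]|].
    apply Rle_lt_trans with (Cmod (w - z) * (M + 1))%R; [assert (P := Cmod_ge_0 (w - z)); nra|].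
    apply (Rmult_lt_compat_r (M + 1)) in W2; [|lra].
    replace (e / (M + 1) * (M + 1))%R with e in W2 by (field; lra). exact W2.
  + rewrite <- cI_scal by auto.
    rewrite (cI_ext (fun t => v t * (Cconj (polar 1 t) * ker w t * ker z t))
       (fun t => (w - z) * f t + v t * (Cconj (polar 1 t) * ker z t * ker z t))).
    * rewrite cI_add; [ring|apply cintg_scal; auto|apply Ie; auto].
    * intros t _. unfold f.
      replace (ker w t) with (ker z t + (w - z) * (Cconj (polar 1 t) * ker w t * ker z t)) at 1
        by (rewrite <- ker_sub by lra; ring). ring.
- exists d; split; auto. intros w Hw. assert (Hw1 := Hin w Hw). unfold Cz.
  rewrite (cI_ext (fun t => v t * ker w t)
    (fun t => v t * ker z t + (w - z) * (v t * (Cconj (polar 1 t) * ker w t * ker z t)))).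
  + rewrite cI_add, cI_scal; [ring|apply Ie; auto|apply cintg_ker; auto; lra|apply cintg_scal, Ie; auto].
  + intros t _. replace (ker w t) with (ker z t + (w - z) * (Cconj (polar 1 t) * ker w t * ker z t)) at 1
      by (rewrite <- ker_sub by lra; ring). ring.
Qed.

(** The Poisson kernel, written so that it is affine in the Cauchy kernel. *)
Definition pois (z : C) (t : R) : R := (2 * fst (ker z t) - 1)%R.

Lemma pois_eq (z : C) (t : R) : (Cmod z < 1)%R ->
  pois z t = ((1 - Cmod z * Cmod z) / (Cmod (1 - z * Cconj (polar 1 t)) * Cmod (1 - z * Cconj (polar 1 t))))%R.
Proof.
intros Hz. unfold pois, ker. assert (N := ker_den_neq_0 z t Hz).
assert (E : forall w, (Cmod w * Cmod w = fst w * fst w + snd w * snd w)%R).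
{ intros w. unfold Cmod. rewrite sqrt_sqrt; [ring|]. apply Rplus_le_le_0_compat; apply pow2_ge_0. }
rewrite <- (Cmod_zconj z t) at 1 2.
revert N. generalize (z * Cconj (polar 1 t)). intros w N.
assert (Np : (0 < Cmod (1 - w))%R) by (apply Cmod_gt_0; auto).
assert (Hp : (Cmod (1 - w) * Cmod (1 - w) <> 0)%R) by nra.
rewrite (E w), (E (1 - w)). rewrite (E (1 - w)) in Hp.
destruct w as [a b]. simpl in Hp |- *. field. intros Z; apply Hp; lra.
Qed.

Lemma pois_pos (z : C) (t : R) : (Cmod z < 1)%R -> (0 < pois z t)%R.
Proof.
intros Hz. rewrite pois_eq by auto. assert (P := Cmod_ge_0 z).
assert (Np : (0 < Cmod (1 - z * Cconj (polar 1 t)))%R) by (apply Cmod_gt_0, ker_den_neq_0; auto).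
apply Rdiv_lt_0_compat; nra.
Qed.

(** The denominator in [pois_eq] is at most 4. The bound is uniform in [t], so the Poisson integral
    of a nonnegative function with positive integral is strictly positive, as real powers of [Hz]
    demand. *)
Lemma pois_ge (z : C) (t : R) : (Cmod z < 1)%R -> ((1 - Cmod z * Cmod z) / 4 <= pois z t)%R.
Proof.
intros Hz. rewrite pois_eq by auto. assert (P := Cmod_ge_0 z).
assert (Np : (0 < Cmod (1 - z * Cconj (polar 1 t)))%R) by (apply Cmod_gt_0, ker_den_neq_0; auto).
assert (U := Cmod_one_minus_le (z * Cconj (polar 1 t))). rewrite Cmod_zconj in U.
apply Rmult_le_compat_l; [nra|]. apply Rinv_le_contravar; nra.
Qed.

Lemma pois_RtoC (z : C) (t : R) : (Cmod z < 1)%R ->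
  RtoC (pois z t) = ker z t + / (1 - Cconj z * polar 1 t) - 1.
Proof.
intros Hz. unfold ker.
assert (E := cauchy_kernel z t Hz).
assert (E2 : / (1 - Cconj z * polar 1 t) = Cconj (ker z t)).
{ unfold ker. rewrite E. apply C_ext; simpl; ring. }
rewrite E2. unfold pois, ker. apply C_ext; simpl; ring.
Qed.

Lemma continuity_pois (z : C) (t : R) : (Cmod z < 1)%R -> continuity_pt (pois z) t.
Proof.
intros Hz. unfold pois.
apply (continuity_pt_minus (fun t => 2 * fst (ker z t))%R (fun _ => 1%R)).
- apply (continuity_pt_scal (fun t => fst (ker z t)) 2 t).
  apply Rcont_continuity_fst, Rcont_ker; auto.
- apply continuity_pt_const. intros x y; auto.
Qed.

Lemma Rcont_circle (F : C -> C) (rho : R) (t : R) : (1 < rho)%R ->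
  (forall w, (Cmod w < rho)%R -> exists l, Cder F w l) -> Rcont (fun s => F (polar 1 s)) t.
Proof.
intros Hr H. apply Ccont_circle; [lra|]. destruct (H (polar 1 t)) as [l Hl].
- rewrite Cmod_polar; lra.
- eapply Cder_cont; eauto.
Qed.

(** The Poisson kernel is the Cauchy kernel plus its conjugate minus 1: the first reproduces [F z],
    the second gives [F 0], and the constant removes it again. *)
Lemma poisson_formula (F : C -> C) (rho : R) (z : C) : (1 < rho)%R ->
  (forall w, (Cmod w < rho)%R -> exists l, Cder F w l) -> (Cmod z < 1)%R ->
  cintg (fun t => F (polar 1 t) * RtoC (pois z t)) /\
  cI (fun t => F (polar 1 t) * RtoC (pois z t)) = RtoC (2 * PI) * F z.
Proof.
intros Hr H Hz. assert (PIp := two_PI_pos).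
assert (Hzc : (Cmod (Cconj z) < 1)%R) by (rewrite Cmod_conj; auto).
assert (C0 := fun t => Rcont_circle F rho t Hr H).
assert (C1 : forall t, Rcont (fun t => F (polar 1 t) * ker z t) t) by (intros; apply Rcont_mult; auto; apply Rcont_ker; auto).
assert (C2 : forall t, Rcont (fun t => F (polar 1 t) * / (1 - Cconj z * polar 1 t)) t).
{ intros t. apply Rcont_mult; auto.
  apply (Ccont_circle (fun w => / (1 - Cconj z * w))); [lra|].
  destruct (Cder_kernel (Cconj z) (polar 1 t)) as [l Hl].
  - rewrite Cmod_mult, Cmod_polar by lra. lra.
  - eapply Cder_cont; eauto. }
destruct (cI_cInt _ C0) as [I0 E0]. destruct (cI_cInt _ C1) as [I1 E1]. destruct (cI_cInt _ C2) as [I2 E2].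
rewrite (mean_value F rho 1) in E0 by (auto; lra).
unfold ker in E1 at 2. rewrite (cauchy_formula F rho z) in E1 by auto.
rewrite (mean_kernel F rho (Cconj z)) in E2 by auto.
assert (X : forall t, F (polar 1 t) * RtoC (pois z t) =
  F (polar 1 t) * ker z t + (F (polar 1 t) * / (1 - Cconj z * polar 1 t) + (- (1)) * F (polar 1 t))).
{ intros t. rewrite pois_RtoC by auto. ring. }
assert (I3 := cintg_scal (- (1)) _ I0).
assert (I4 := cintg_add _ _ I2 I3). assert (I5 := cintg_add _ _ I1 I4).
split.
- destruct I5 as [a b]. split; [revert a|revert b]; apply intg_ext; intros; rewrite X; reflexivity.
- rewrite (cI_ext _ _ (fun t _ => X t)).
  rewrite (cI_add _ _ I1 I4), (cI_add _ _ I2 I3), (cI_scal _ _ I0), E0, E1, E2. ring.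
Qed.

Lemma I_pois (z : C) : (Cmod z < 1)%R -> I (pois z) = (2 * PI)%R.
Proof.
intros Hz. destruct (poisson_formula (fun _ => 1) 2 z) as [_ E]; auto; [lra| |].
- intros w _. exists 0. apply Cder_const.
- apply (f_equal fst) in E. simpl in E.
  rewrite (I_ext (fun t => 1 * pois z t - 0 * 0)%R (pois z)) in E by (intros; ring). lra.
Qed.

(** * Inequalities for real powers and cosines *)

Lemma pw_pos (x s : R) : (0 < x)%R -> (0 < pw x s)%R.
Proof. intros H. rewrite pw_exp by auto. apply exp_pos. Qed.

Lemma pw_mono (x y s : R) : (0 <= x)%R -> (x <= y)%R -> (0 < s)%R -> (pw x s <= pw y s)%R.
Proof.
intros Hx Hxy Hs. destruct (Rle_lt_or_eq_dec 0 x Hx) as [Hp|<-].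
- rewrite !pw_exp by lra. destruct (Rle_lt_or_eq_dec x y Hxy) as [L|<-]; [|lra].
  apply Rlt_le, exp_increasing, Rmult_lt_compat_l; auto. apply ln_increasing; auto.
- rewrite pw_0 by lra. apply pw_ge0.
Qed.

Lemma pw_mult (x y s : R) : (0 <= x)%R -> (0 <= y)%R -> s <> 0%R -> pw (x * y) s = (pw x s * pw y s)%R.
Proof.
intros Hx Hy Hs.
destruct (Rle_lt_or_eq_dec 0 x Hx) as [Px|<-]; [|rewrite Rmult_0_l, pw_0 by auto; ring].
destruct (Rle_lt_or_eq_dec 0 y Hy) as [Py|<-]; [|rewrite Rmult_0_r, pw_0 by auto; ring].
rewrite !pw_exp by (auto; apply Rmult_lt_0_compat; auto).
rewrite ln_mult, <- exp_plus by auto. f_equal; ring.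
Qed.

(** Shows that square integrable functions on the circle have integrable [q]-th powers. *)
Lemma pw_le_1_sqr (x q : R) : (0 <= x)%R -> (0 < q <= 2)%R -> (pw x q <= 1 + x * x)%R.
Proof.
intros Hx Hq. destruct (Rle_dec x 1) as [H|H].
- apply Rle_trans with (pw 1 q); [apply pw_mono; lra|].
  rewrite pw_exp, ln_1, Rmult_0_r, exp_0 by lra. nra.
- apply Rle_trans with (x * x)%R; [|lra]. rewrite pw_exp by lra.
  rewrite <- (exp_ln x) at 2 3 by lra. rewrite <- exp_plus.
  assert (L : (0 < ln x)%R) by (rewrite <- ln_1; apply ln_increasing; lra).
  destruct (Rle_lt_or_eq_dec q 2 ltac:(lra)) as [L2| ->].
  + apply Rlt_le, exp_increasing. nra.
  + right. f_equal. ring.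
Qed.

(** Follows from [1 + x <= exp x], used at [(q - 1) ln t] and at [- ln t]. It is the tangent line of
    [t^q] at 1, from which Jensen's inequality is obtained. *)
Lemma bernoulli_pw (t q : R) : (0 <= t)%R -> (1 < q)%R -> (1 + q * (t - 1) <= pw t q)%R.
Proof.
intros Ht Hq. destruct (Rle_lt_or_eq_dec 0 t Ht) as [Hp|<-]; [|rewrite pw_0 by lra; lra].
rewrite pw_exp by auto.
replace (exp (q * ln t)) with (t * exp ((q - 1) * ln t))%R.
2:{ rewrite <- (exp_ln t) at 1 by auto. rewrite <- exp_plus. f_equal; ring. }
assert (E1 := exp_ineq1_le ((q - 1) * ln t)).
assert (E2 := exp_ineq1_le (- ln t)).
rewrite exp_Ropp, exp_ln in E2 by auto.
assert (E3 : (t - 1 <= t * ln t)%R).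
{ apply (Rmult_le_compat_l t) in E2; [|lra]. rewrite Rinv_r in E2 by lra. lra. }
apply Rle_trans with (t * (1 + (q - 1) * ln t))%R; [|apply Rmult_le_compat_l; lra]. nra.
Qed.

Lemma cos_obtuse (eta th : R) : (0 < eta)%R ->
  (PI / 2 + eta <= th <= 3 * (PI / 2) - eta)%R -> (cos th <= - sin eta)%R.
Proof.
intros He H. assert (Hpi := PI_RGT_0).
replace th with ((th - PI) + PI)%R by ring. rewrite neg_cos. apply Ropp_le_contravar.
rewrite <- cos_shift.
destruct (Rle_dec 0 (th - PI)) as [P|N].
- apply cos_decr_1; lra.
- rewrite <- (cos_neg (th - PI)). apply cos_decr_1; lra.
Qed.

(* Near [|x| = PI/2] the angle [q x + al y] stays in the open left half plane, because
   [1 < q - al] and [q + al < 3]. *)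
Lemma cos_comparison (q al : R) : (1 < q < 2)%R -> (0 <= al < q - 1)%R ->
  exists A B, (0 <= A)%R /\ (0 < B)%R /\
    forall x y, (- PI / 2 < x < PI / 2)%R -> (- PI / 2 < y < PI / 2)%R ->
      (1 <= A * pw (cos x) q - B * cos (q * x + al * y))%R.
Proof.
intros Hq Hal. assert (Hpi := PI_RGT_0).
(* The first bound will give [x0 < PI / 2]; the second keeps the angle [q x + al y] below
   [3 PI / 2 - eta]. *)
set (eta := Rmin ((q - 1 - al) * (PI / 4)) ((3 - q - al) * (PI / 2))).
assert (He : (0 < eta)%R) by (apply Rmin_pos; apply Rmult_lt_0_compat; lra).
assert (E1 : (eta <= (q - 1 - al) * (PI / 4))%R) by apply Rmin_l.
assert (E2 : (eta <= (3 - q - al) * (PI / 2))%R) by apply Rmin_r.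
(* [x0] solves [q x - al * PI / 2 = PI / 2 + eta]: from there on, even the least favourable [y]
   gives an obtuse angle. *)
set (x0 := ((PI / 2 * (1 + al) + eta) / q)%R).
assert (X0 : (q * x0 = PI / 2 * (1 + al) + eta)%R) by (unfold x0; field; lra).
assert (X1 : (0 < x0 < PI / 2)%R).
{ split; apply (Rmult_lt_reg_l q); try lra; rewrite ?Rmult_0_r, X0; nra. }
assert (S : (0 < sin eta)%R) by (apply sin_gt_0; nra).
assert (C0 : (0 < cos x0)%R) by (apply cos_gt_0; lra).
(* For [x >= x0] this makes the term with [B] contribute at least 1. For [x < x0] the cosine may be
   as large as 1, and [A] makes up for the loss, [cos x] being bounded below by [cos x0]. *)
set (B := (/ sin eta)%R). assert (HB : (0 < B)%R) by (apply Rinv_0_lt_compat; auto).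
assert (Pc := pw_pos (cos x0) q C0).
exists ((1 + B) / pw (cos x0) q)%R, B.
assert (HA : (0 < (1 + B) / pw (cos x0) q)%R) by (apply Rdiv_lt_0_compat; lra).
split; [lra|]. split; auto. intros x y Hx Hy.
assert (Key : forall x y, (0 <= x < PI / 2)%R -> (- PI / 2 < y < PI / 2)%R ->
  (1 <= (1 + B) / pw (cos x0) q * pw (cos x) q - B * cos (q * x + al * y))%R).
{ clear x y Hx Hy. intros x y Hx Hy.
  assert (Cx : (0 < cos x)%R) by (apply cos_gt_0; lra).
  assert (Y1 : (- (al * (PI / 2)) <= al * y <= al * (PI / 2))%R) by nra.
  destruct (Rle_dec x0 x) as [L|N].
  - assert (D : (cos (q * x + al * y) <= - sin eta)%R).
    { apply cos_obtuse; auto. assert (q * x0 <= q * x)%R by (apply Rmult_le_compat_l; lra).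
      assert (q * x <= q * (PI / 2))%R by (apply Rmult_le_compat_l; lra). lra. }
    assert (B * cos (q * x + al * y) <= B * - sin eta)%R by (apply Rmult_le_compat_l; lra).
    replace (B * - sin eta)%R with (-1)%R in H by (unfold B; field; lra).
    assert (0 <= (1 + B) / pw (cos x0) q * pw (cos x) q)%R
      by (apply Rmult_le_pos; [lra|apply pw_ge0]). lra.
  - assert (M : (pw (cos x0) q <= pw (cos x) q)%R).
    { apply pw_mono; try lra. apply cos_decr_1; lra. }
    assert (1 + B <= (1 + B) / pw (cos x0) q * pw (cos x) q)%R.
    { apply Rle_trans with ((1 + B) / pw (cos x0) q * pw (cos x0) q)%R.
      - right; field; lra.
      - apply Rmult_le_compat_l; lra. }
    assert (K := COS_bound (q * x + al * y)). nra. }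
destruct (Rle_dec 0 x) as [P|N]; [apply Key; lra|].
assert (K := Key (- x)%R (- y)%R ltac:(lra) ltac:(lra)).
rewrite cos_neg in K. replace (q * - x + al * - y)%R with (- (q * x + al * y))%R in K by ring.
rewrite cos_neg in K. exact K.
Qed.

(** * Poisson integrals as real parts, and Stein's inequality *)

Lemma fst_Cz_RtoC (v : R -> R) (z : C) :
  fst (Cz (fun t => RtoC (v t)) z) = (/ (2 * PI) * I (fun t => v t * fst (ker z t)))%R.
Proof.
unfold Cz. simpl. rewrite Rmult_0_l, Rminus_0_r. f_equal. apply I_ext. intros t _. ring.
Qed.

Lemma cintg_RtoC (v : R -> R) : intg v -> cintg (fun t => RtoC (v t)).
Proof. intros H. split; simpl; auto. apply intg_const. Qed.

Lemma ker_0 (t : R) : ker 0 t = 1.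
Proof. unfold ker. replace (1 - 0 * Cconj (polar 1 t)) with (RtoC 1) by ring. apply C_ext; simpl; field. Qed.

Lemma Cz_0 (v : R -> R) : intg v -> Cz (fun t => RtoC (v t)) 0 = RtoC (/ (2 * PI) * I v).
Proof.
intros Hv. unfold Cz. rewrite (cI_ext _ (fun t => RtoC (v t))).
- unfold cI. simpl. change (I (fun t : R => v t)) with (I v). rewrite I_const. apply C_ext; simpl; ring.
- intros t _. rewrite ker_0. ring.
Qed.

(* Holomorphic, with the Poisson integral of [v] as its real part. *)
Definition Hz (v : R -> R) (z : C) : C :=
  2 * Cz (fun t => RtoC (v t)) z - RtoC (/ (2 * PI) * I v).

Lemma intg_pois (v : R -> R) (z : C) : intg v -> (Cmod z < 1)%R -> intg (fun t => v t * pois z t)%R.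
Proof.
intros Hv Hz. destruct (cintg_ker (fun t => RtoC (v t)) z (cintg_RtoC v Hv) Hz) as [h _].
apply (intg_ext (fun t => 2 * fst (RtoC (v t) * ker z t)%C - v t)%R).
- intros t _. unfold pois. simpl. ring.
- apply intg_sub; auto. apply (intg_scal 2 (fun t => fst (RtoC (v t) * ker z t)%C)); auto.
Qed.

Lemma fst_Hz (v : R -> R) (z : C) : intg v -> (Cmod z < 1)%R ->
  fst (Hz v z) = (/ (2 * PI) * I (fun t => v t * pois z t))%R.
Proof.
intros Hv Hz'. destruct (cintg_ker (fun t => RtoC (v t)) z (cintg_RtoC v Hv) Hz') as [h _].
assert (h' : intg (fun t => v t * fst (ker z t))%R) by (revert h; apply intg_ext; intros; simpl; ring).
rewrite (I_ext (fun t => v t * pois z t)%R (fun t => 2 * (v t * fst (ker z t)) - v t)%R)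
  by (intros; unfold pois; ring).
rewrite (I_sub (fun t => 2 * (v t * fst (ker z t)))%R v); [|apply intg_scal; auto|auto].
rewrite (I_scal 2 (fun t => v t * fst (ker z t))%R) by auto.
unfold Hz, Cminus. change (fst (2 * Cz (fun t => RtoC (v t)) z + - RtoC (/ (2 * PI) * I v)))
  with (2 * fst (Cz (fun t => RtoC (v t)) z) - 0 * snd (Cz (fun t => RtoC (v t)) z) + - (/ (2 * PI) * I v))%R.
rewrite fst_Cz_RtoC. ring.
Qed.

Lemma Cder_Hz (v : R -> R) (z : C) : intg v -> (Cmod z < 1)%R -> exists l, Cder (Hz v) z l.
Proof.
intros Hv Hz'. destruct (Cder_Cz _ z (cintg_RtoC v Hv) Hz') as [l Hl].
eexists. apply (Cder_plus (fun z => 2 * Cz (fun t => RtoC (v t)) z) (fun _ => - RtoC (/ (2 * PI) * I v)));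
  [|apply Cder_const].
apply (Cder_mult (fun _ => 2)); [apply Cder_const|exact Hl].
Qed.

Lemma Hz_re_pos (v : R -> R) (z : C) : intg v -> (forall t, inT t -> (0 <= v t)%R) -> (0 < I v)%R ->
  (Cmod z < 1)%R -> (0 < fst (Hz v z))%R.
Proof.
intros Hv v0 Iv Hz'. rewrite fst_Hz by auto. assert (P := two_PI_pos).
apply Rmult_lt_0_compat; [apply Rinv_0_lt_compat; auto|].
assert (Cz0 := Cmod_ge_0 z).
apply Rlt_le_trans with (I (fun t => (1 - Cmod z * Cmod z) / 4 * v t))%R.
- rewrite I_scal by auto. apply Rmult_lt_0_compat; auto. apply Rdiv_lt_0_compat; nra.
- apply I_le; [apply intg_scal; auto|apply intg_pois; auto|].
  intros t Ht. rewrite Rmult_comm. apply Rmult_le_compat_l; auto. apply pois_ge; auto.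
Qed.

(* [|1 - r e^(it)|^al]; on the circle, [|f|^p |g|^2 = |f g|^p W (a (2 - p))] for [g = (1 - z)^a]. *)
Definition W (al r t : R) : R := pw (Cmod (1 - polar r t)) al.

Lemma one_minus_polar_re (r t : R) : (0 <= r < 1)%R -> (0 < fst (1 - polar r t)%C)%R.
Proof. intros Hr. simpl. assert (K := COS_bound t). nra. Qed.

Lemma one_minus_re (z : C) : (Cmod z < 1)%R -> (0 < fst (1 - z)%C)%R.
Proof. intros Hz'. simpl. assert (K := re_le_Cmod z). unfold Re in K. apply Rabs_le_between in K. lra. Qed.

Lemma W_Cmod (al r t : R) : (0 <= r < 1)%R -> W al r t = Cmod (cpow (1 - polar r t) al).
Proof.
intros Hr. unfold W. rewrite Cmod_cpow, pw_exp; auto.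
apply Cmod_pos_of_re, one_minus_polar_re; auto.
Qed.

Lemma Cder_Phi (al : R) (z : C) : (Cmod z < 1)%R -> exists l, Cder (fun w => cpow (1 - w) al) z l.
Proof.
intros Hz'. apply (Cder_cpow (fun w => 1 - w) z (0 + - (1))); [apply one_minus_re; auto|].
apply (Cder_plus (fun _ => 1) (fun w => - w)); [apply Cder_const|].
exists (fun _ => - (1)). split; auto. split; [apply Ccont_const|].
exists 1%R; split; [lra|]. intros; ring.
Qed.

Lemma Rcont_disc (F : C -> C) (r t : R) : (0 <= r < 1)%R ->
  (forall z, (Cmod z < 1)%R -> exists l, Cder F z l) -> Rcont (fun t => F (polar r t)) t.
Proof.
intros Hr H. apply Ccont_circle; [lra|]. destruct (H (polar r t)) as [l Hl].
- rewrite Cmod_polar; lra.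
- eapply Cder_cont; eauto.
Qed.

Lemma W_cont (al r t : R) : (0 <= r < 1)%R -> continuity_pt (W al r) t.
Proof.
intros Hr. apply (continuity_pt_ext (fun t => Cmod (cpow (1 - polar r t) al))).
- intros s. symmetry. apply W_Cmod; auto.
- apply Rcont_continuity_Cmod. apply (Rcont_disc (fun w => cpow (1 - w) al)); auto. apply Cder_Phi.
Qed.

Lemma W_le (al r t : R) : (0 < al)%R -> (0 <= r <= 1)%R -> (0 <= W al r t <= pw 2 al)%R.
Proof.
intros Ha Hr. split; [apply pw_ge0|]. apply pw_mono; auto; [apply Cmod_ge_0|].
eapply Rle_trans; [apply Cmod_one_minus_le|]. rewrite Cmod_polar by lra. lra.
Qed.

Lemma carg_RtoC (x : R) : carg (RtoC x) = 0%R.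
Proof. unfold carg; simpl. unfold Rdiv. rewrite Rmult_0_l. apply atan_0. Qed.

Lemma Cder_prod_cpow (F : C -> C) (q al : R) :
  (forall z, (Cmod z < 1)%R -> exists l, Cder F z l) ->
  (forall z, (Cmod z < 1)%R -> (0 < fst (F z))%R) ->
  forall z, (Cmod z < 1)%R -> exists l, Cder (fun z => cpow (F z) q * cpow (1 - z) al) z l.
Proof.
intros DF PF z Hz'. destruct (DF z Hz') as [l Hl].
destruct (Cder_cpow F z l q (PF z Hz') Hl) as [m Hm].
destruct (Cder_Phi al z Hz') as [k Hk]. eexists.
apply (Cder_mult (fun z => cpow (F z) q) (fun z => cpow (1 - z) al)); eauto.
Qed.

(** The cosine inequality is used at [x = arg F] and [y = arg (1 - z)] and multiplied by
    [|F|^q |1 - z|^al]; there [|F| cos x] is the real part of [F]. The subtracted term is the real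
    part of a holomorphic function, whose mean is its value at 0. This value is [(F 0)^q], because
    [F 0] is a positive real number. *)
Lemma stein_inequality (q al A B : R) : (0 < al)%R -> (0 < q)%R ->
  (forall x y, (- PI / 2 < x < PI / 2)%R -> (- PI / 2 < y < PI / 2)%R ->
      (1 <= A * pw (cos x) q - B * cos (q * x + al * y))%R) ->
  forall (F : C -> C) (r : R), (0 <= r < 1)%R ->
  (forall z, (Cmod z < 1)%R -> exists l, Cder F z l) ->
  (forall z, (Cmod z < 1)%R -> (0 < fst (F z))%R) ->
  snd (F 0) = 0%R ->
  intg (fun t => pw (Cmod (F (polar r t))) q * W al r t)%R /\
  intg (fun t => pw (fst (F (polar r t))) q * W al r t)%R /\
  (I (fun t => pw (Cmod (F (polar r t))) q * W al r t) + B * (2 * PI * pw (fst (F 0)) q)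
   <= A * I (fun t => pw (fst (F (polar r t))) q * W al r t))%R.
Proof.
intros Hal Hq HAB F r Hr DF PF F0.
assert (Hz1 : forall t, (Cmod (polar r t) < 1)%R) by (intros; rewrite Cmod_polar; lra).
set (f := fun z => cpow (F z) q * cpow (1 - z) al).
assert (Df : forall z, (Cmod z < 1)%R -> exists l, Cder f z l) by (apply Cder_prod_cpow; auto).
assert (Cf := fun t => Rcont_disc f r t Hr Df).
assert (PosF : forall t, (0 < Cmod (F (polar r t)))%R) by (intros; apply Cmod_pos_of_re, PF; auto).
assert (E1 : forall t, (pw (Cmod (F (polar r t))) q * W al r t)%R = Cmod (f (polar r t))).
{ intros t. unfold f. rewrite Cmod_mult, <- W_Cmod, Cmod_cpow, pw_exp by auto. reflexivity. }
assert (I1 : intg (fun t => pw (Cmod (F (polar r t))) q * W al r t)%R).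
{ apply (intg_ext (fun t => Cmod (f (polar r t)))); [intros; rewrite E1; auto|].
  apply intg_cont. intros t. apply Rcont_continuity_Cmod, Cf. }
assert (I2 : intg (fun t => pw (fst (F (polar r t))) q * W al r t)%R).
{ apply (intg_dom _ (fun t => pw (Cmod (F (polar r t))) q * W al r t)%R); auto.
  - apply mT_mul; [apply mT_pw|].
    + apply mT_cont. intros t. apply Rcont_continuity_fst, Rcont_disc; auto.
    + apply mT_cont. intros t. apply W_cont; auto.
  - intros t _. rewrite Rabs_pos_eq by (apply Rmult_le_pos; apply pw_ge0).
    apply Rmult_le_compat_r; [apply pw_ge0|]. apply pw_mono; auto.
    + apply Rlt_le, PF; auto.
    + eapply Rle_trans; [apply Rle_abs|]. exact (re_le_Cmod (F (polar r t))). }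
split; auto. split; auto.
destruct (cI_cInt _ Cf) as [[If1 _] Ecf].
rewrite (mean_value f 1 r Df) in Ecf by lra.
assert (M : I (fun t => fst (f (polar r t))) = (2 * PI * pw (fst (F 0)) q)%R).
{ apply (f_equal fst) in Ecf.
  change (I (fun t => fst (f (polar r t))) = (2 * PI * fst (f (RtoC 0)) - 0 * snd (f (RtoC 0)))%R) in Ecf.
  rewrite Rmult_0_l, Rminus_0_r in Ecf. rewrite Ecf. f_equal.
  unfold f. rewrite re_cpow_mult.
  assert (EF : F 0 = RtoC (fst (F 0))) by (apply C_ext; auto).
  assert (P0 : (0 < fst (F 0))%R) by (apply PF; rewrite Cmod_0; lra).
  rewrite EF at 1 2. rewrite carg_RtoC, Cmod_R, Rabs_pos_eq by lra.
  replace (1 - 0) with (RtoC 1) by ring. rewrite Cmod_1, carg_RtoC, ln_1.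
  rewrite !Rmult_0_r, exp_0, Rplus_0_r, cos_0, pw_exp by auto. ring. }
rewrite <- M.
rewrite <- (I_scal A _ I2), <- (I_scal B _ If1).
rewrite <- I_add; [|auto|apply intg_scal; auto].
apply I_le; [apply intg_add; auto; apply intg_scal; auto|apply intg_scal; auto|].
intros t _. unfold f. rewrite re_cpow_mult.
set (z := polar r t). assert (Hz2 : (Cmod z < 1)%R) by apply Hz1.
assert (K := HAB (carg (F z)) (carg (1 - z)) (carg_bound _) (carg_bound _)).
assert (R1 : fst (F z) = (Cmod (F z) * cos (carg (F z)))%R) by (symmetry; apply Cmod_cos_carg, PF; auto).
assert (C1 : (0 < cos (carg (F z)))%R) by (apply cos_gt_0; generalize (carg_bound (F z)); lra).
rewrite R1, pw_mult by (try lra; apply Cmod_ge_0).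
rewrite W_Cmod, Cmod_cpow by auto. fold z.
rewrite (pw_exp (Cmod (F z))) by apply PosF.
set (X := exp (q * ln (Cmod (F z)))). set (Y := exp (al * ln (Cmod (1 - z)))).
assert (HX : (0 < X)%R) by apply exp_pos. assert (HY : (0 < Y)%R) by apply exp_pos.
assert (HXY : (0 < X * Y)%R) by (apply Rmult_lt_0_compat; auto).
apply (Rmult_le_compat_l (X * Y)) in K; [|lra]. lra.
Qed.

(** * Jensen's inequality and the Poisson integral of the weight *)

(** Integrates against the Poisson kernel the tangent line of [x^q] at the mean [m], that is,
    Bernoulli's inequality at [v / m]. A vanishing mean is treated apart because of the division. *)
Lemma jensen_pois (v : R -> R) (q : R) (z : C) : (1 < q)%R -> intg v ->
  (forall t, inT t -> (0 <= v t)%R) -> intg (fun t => pw (v t) q) -> (Cmod z < 1)%R ->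
  (pw (fst (Hz v z)) q <= / (2 * PI) * I (fun t => pw (v t) q * pois z t))%R.
Proof.
intros Hq Iv v0 Ivq Hz'. rewrite fst_Hz by auto.
assert (Pp := two_PI_pos). assert (Ip : (0 < / (2 * PI))%R) by (apply Rinv_0_lt_compat; auto).
assert (J1 := intg_pois v z Iv Hz'). assert (J2 := intg_pois _ z Ivq Hz').
assert (J0 : intg (pois z)) by (apply intg_cont; intros; apply continuity_pois; auto).
set (m := (/ (2 * PI) * I (fun t => v t * pois z t))%R).
assert (Em : (I (fun t => v t * pois z t) = 2 * PI * m)%R) by (unfold m; field; apply PI_neq0).
assert (Hm : (0 <= m)%R).
{ unfold m. apply Rmult_le_pos; [lra|]. apply I_ge0. intros t Ht.
  apply Rmult_le_pos; auto. apply Rlt_le, pois_pos; auto. }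
destruct (Rle_lt_or_eq_dec 0 m Hm) as [Hp|E0].
2:{ rewrite <- E0, pw_0 by lra. apply Rmult_le_pos; [lra|]. apply I_ge0. intros t Ht.
    apply Rmult_le_pos; [apply pw_ge0|]. apply Rlt_le, pois_pos; auto. }
assert (K : (I (fun t => (pw m q * (1 - q)) * pois z t + (pw m q * q / m) * (v t * pois z t))
  <= I (fun t => pw (v t) q * pois z t))%R).
{ apply I_le; auto.
  - apply intg_add; apply intg_scal; auto.
  - intros t Ht. assert (P := pois_pos z t Hz').
    assert (Vm : (0 <= v t / m)%R) by (apply Rmult_le_pos; [auto|apply Rlt_le, Rinv_0_lt_compat; auto]).
    assert (B := bernoulli_pw (v t / m) q Vm Hq).
    replace (v t) with (m * (v t / m))%R at 2 by (field; lra).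
    rewrite pw_mult by (auto; apply Rgt_not_eq; lra).
    assert (Pm := pw_pos m q Hp).
    apply Rle_trans with (pw m q * (1 + q * (v t / m - 1)) * pois z t)%R.
    + right. field. lra.
    + apply Rmult_le_compat_r; [lra|]. apply Rmult_le_compat_l; lra. }
rewrite I_add in K by (apply intg_scal; auto).
rewrite !I_scal in K by auto. rewrite I_pois, Em in K by auto.
apply (Rmult_le_compat_l (/ (2 * PI))) in K; [|lra].
eapply Rle_trans; [|exact K]. right. field. split; [lra|]. apply PI_neq0.
Qed.

(** The Poisson kernel at radius [r] as a function of the difference of angles, the shape that
    [fubini_conv] asks for. *)
Definition kap (r x : R) : R := (2 * fst (/ (1 - polar r x))%C - 1)%R.

Lemma polar_conj (r s t : R) : polar r t * Cconj (polar 1 s) = polar r (t - s).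
Proof. apply C_ext; simpl; rewrite ?cos_minus, ?sin_minus; ring. Qed.

Lemma polar_neg (r x : R) : polar r (- x) = Cconj (polar r x).
Proof. apply C_ext; simpl; rewrite ?cos_neg, ?sin_neg; ring. Qed.

Lemma pois_kap (r s t : R) : pois (polar r t) s = kap r (t - s).
Proof. unfold pois, kap, ker. rewrite polar_conj. reflexivity. Qed.

Lemma kap_neg (r x : R) : kap r (- x) = kap r x.
Proof.
unfold kap. rewrite polar_neg.
replace (1 - Cconj (polar r x)) with (Cconj (1 - polar r x)) by (apply C_ext; simpl; ring).
unfold Cinv, Cconj. cbn [fst snd]. do 3 f_equal. ring.
Qed.

Lemma kap_cont (r x : R) : (0 <= r < 1)%R -> continuity_pt (kap r) x.
Proof.
intros Hr. unfold kap.
apply (continuity_pt_minus (fun x => 2 * fst (/ (1 - polar r x))%C)%R (fun _ => 1%R)).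
- apply (continuity_pt_scal (fun x => fst (/ (1 - polar r x))) 2 x), Rcont_continuity_fst.
  apply (Ccont_circle (fun w => / (1 - w))); [lra|].
  apply (Ccont_comp Cinv (fun w => 1 - w)).
  + apply (Ccont_plus (fun _ => 1) (fun w => - w)); [apply Ccont_const|].
    apply (Ccont_ext_loc (fun w => - (1) * w) _ _ 1); [lra|intros; ring|].
    apply Ccont_mult; [apply Ccont_const|apply Ccont_id].
  + apply Ccont_inv, one_minus_neq_0. rewrite Cmod_polar; lra.
- apply continuity_pt_const. intros a b; auto.
Qed.

Lemma kap_bound (r x : R) : (0 <= r < 1)%R -> (Rabs (kap r x) <= 2 / (1 - r) + 1)%R.
Proof.
intros Hr. unfold kap.
assert (N : 1 - polar r x <> 0) by (apply one_minus_neq_0; rewrite Cmod_polar; lra).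
assert (B : (Rabs (fst (/ (1 - polar r x))%C) <= / (1 - r))%R).
{ eapply Rle_trans; [exact (re_le_Cmod (/ (1 - polar r x)))|].
  rewrite Cmod_inv by auto. apply Rinv_le_contravar; [lra|].
  assert (K := Cmod_one_minus (polar r x)). rewrite Cmod_polar in K by lra. exact K. }
unfold Rminus at 1. eapply Rle_trans; [apply Rabs_triang|].
rewrite Rabs_Ropp, Rabs_R1, Rabs_mult, (Rabs_pos_eq 2) by lra. unfold Rdiv. lra.
Qed.

(** The argument of [1 - r e^(it)] is less than [PI / 2] in absolute value, so the real part of its
    power [al] is at least [cos (al * PI / 2)] times the modulus. That real part is reproduced by
    the Poisson kernel: [(1 - r w)^al] at [w = r e^(is)] gives the radius [r * r] on the right. *)
Lemma W_pois (al r s : R) : (0 < al < 1)%R -> (0 <= r < 1)%R ->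
  (I (fun t => W al r t * kap r (t - s)) <= / cos (al * (PI / 2)) * (2 * PI * W al (r * r) s))%R.
Proof.
intros Ha Hr. assert (Hpi := PI_RGT_0).
assert (C0 : (0 < cos (al * (PI / 2)))%R) by (apply cos_gt_0; nra).
assert (Hz' : (Cmod (polar r s) < 1)%R) by (rewrite Cmod_polar; lra).
set (F := fun w : C => cpow (1 - RtoC r * w) al).
(* Chosen with [1 < rho] and [r * rho < 1], so that [(1 - r w)^al] is holomorphic past the unit
   circle. *)
set (rho := (2 / (1 + r))%R).
assert (Hrho : (1 < rho)%R) by (unfold rho; apply (Rmult_lt_reg_r (1 + r)); [lra|]; field_simplify; lra).
assert (Hrr : (r * rho < 1)%R).
{ unfold rho. apply (Rmult_lt_reg_r (1 + r)); [lra|]. field_simplify; lra. }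
assert (DF : forall w, (Cmod w < rho)%R -> exists l, Cder F w l).
{ intros w Hw. destruct (Cder_Phi al (RtoC r * w)) as [l Hl].
  - rewrite Cmod_mult, Cmod_R, Rabs_pos_eq by lra.
    assert (P := Cmod_ge_0 w). assert (r * Cmod w <= r * rho)%R by (apply Rmult_le_compat_l; lra). lra.
  - eexists. apply (Cder_comp (fun w => cpow (1 - w) al) (fun w => RtoC r * w)); [|exact Hl].
    apply (Cder_mult (fun _ => RtoC r) (fun w => w)); [apply Cder_const|apply Cder_id]. }
destruct (poisson_formula F rho (polar r s) Hrho DF Hz') as [[IF _] EF].
apply (f_equal fst) in EF.
change (I (fun t => fst (F (polar 1 t) * RtoC (pois (polar r s) t))%C) =
  (2 * PI * fst (F (polar r s)) - 0 * snd (F (polar r s)))%R) in EF.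
assert (EFp : forall t, F (polar 1 t) = cpow (1 - polar r t) al).
{ intros t. unfold F. rewrite <- polar_mult, Rmult_1_r. reflexivity. }
assert (EFs : F (polar r s) = cpow (1 - polar (r * r) s) al).
{ unfold F. rewrite <- polar_mult. reflexivity. }
assert (X : forall t, fst (F (polar 1 t) * RtoC (pois (polar r s) t)) =
   (W al r t * cos (al * carg (1 - polar r t)%C) * kap r (t - s))%R).
{ intros t. rewrite EFp, pois_kap. replace (s - t)%R with (- (t - s))%R by ring. rewrite kap_neg.
  change (fst (cpow (1 - polar r t) al) * kap r (t - s) - snd (cpow (1 - polar r t) al) * 0
    = W al r t * cos (al * carg (1 - polar r t)%C) * kap r (t - s))%R.
  rewrite re_cpow, W_Cmod, Cmod_cpow by auto. ring. }
assert (Kp : forall t, (0 < kap r (t - s))%R).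
{ intros t. rewrite <- pois_kap. apply pois_pos. rewrite Cmod_polar; lra. }
assert (Iw : intg (fun t => W al r t * kap r (t - s))%R).
{ apply intg_cont. intros t. apply (continuity_pt_mult (W al r) (fun t => kap r (t - s))).
  - apply W_cont; auto.
  - apply (continuity_pt_comp (fun t => (t - s)%R) (kap r)); [reg|apply kap_cont; auto]. }
assert (L : (cos (al * (PI / 2)) * I (fun t => W al r t * kap r (t - s)) <= 2 * PI * W al (r * r) s)%R).
{ rewrite <- I_scal by auto.
  apply Rle_trans with (I (fun t => fst (F (polar 1 t) * RtoC (pois (polar r s) t))%C)).
  - apply I_le; auto; [apply intg_scal; auto|]. intros t _. rewrite X.
    assert (Cc : (cos (al * (PI / 2)) <= cos (al * carg (1 - polar r t)%C))%R).
    { assert (B := carg_bound (1 - polar r t)). set (x := carg _) in *.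
      destruct (Rle_dec 0 x) as [P|N].
      - apply cos_decr_1; nra.
      - rewrite <- (cos_neg (al * x)). apply cos_decr_1; nra. }
    assert (W0 := pw_ge0 (Cmod (1 - polar r t)) al). fold (W al r t) in W0.
    assert (Kt := Kp t). assert (0 <= W al r t * kap r (t - s))%R by (apply Rmult_le_pos; lra). nra.
  - rewrite EF, EFs, re_cpow. rewrite Rmult_0_l, Rminus_0_r.
    apply Rmult_le_compat_l; [lra|].
    assert (Hr2 : (0 <= r * r < 1)%R) by nra.
    rewrite W_Cmod, Cmod_cpow by auto.
    assert (K := COS_bound (al * carg (1 - polar (r * r) s)%C)).
    assert (E := exp_pos (al * ln (Cmod (1 - polar (r * r) s)))). nra. }
apply (Rmult_le_compat_l (/ cos (al * (PI / 2)))) in L; [|apply Rlt_le, Rinv_0_lt_compat; auto].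
rewrite <- Rmult_assoc, Rinv_l, Rmult_1_l in L by lra. exact L.
Qed.

Lemma I_nonneg_zero_Cz (v : R -> R) (z : C) : intg v -> (forall t, inT t -> (0 <= v t)%R) -> I v = 0%R ->
  (Cmod z < 1)%R -> Cz (fun t => RtoC (v t)) z = 0.
Proof.
intros Iv v0 E Hz'. unfold Cz.
assert (Z : cI (fun t => RtoC (v t) * ker z t) = 0).
{ apply Cmod_eq_0, Rle_antisym; [|apply Cmod_ge_0].
  eapply Rle_trans; [apply (cI_bound _ (fun t => / (1 - Cmod z) * v t)%R)|].
  - apply cintg_ker; auto. apply cintg_RtoC; auto.
  - apply intg_scal; auto.
  - intros t Ht. rewrite Cmod_mult, Cmod_R, Rabs_pos_eq, Rmult_comm by auto.
    apply Rmult_le_compat_r; auto. apply Cmod_ker_le; auto.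
  - rewrite I_scal, E by auto. lra. }
rewrite Z. ring.
Qed.

(** * Weighted bounds for the Cauchy transform below exponent 2 *)

(** The [q]-th power of a weighted norm, not the norm itself. *)
Definition normW (q al r : R) (u : R -> C) : R := I (fun t => pw (Cmod (u t)) q * W al r t)%R.

Lemma intg_weight (q al r : R) (f : R -> R) : (0 < al)%R -> (0 <= r <= 1)%R -> intg (fun t => pw (f t) q) ->
  mT (W al r) -> intg (fun t => pw (f t) q * W al r t)%R.
Proof.
intros Ha Hr H MW. apply (intg_dom _ (fun t => pw 2 al * pw (f t) q)%R).
- apply mT_mul; auto. apply intg_mT; auto.
- apply intg_scal; auto.
- intros t _. destruct (W_le al r t Ha Hr) as [A B].
  rewrite Rabs_pos_eq by (apply Rmult_le_pos; [apply pw_ge0|auto]).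
  rewrite Rmult_comm. apply Rmult_le_compat_r; [apply pw_ge0|auto].
Qed.

Lemma mT_W (al r : R) : (0 <= r)%R -> mT (W al r).
Proof.
intros Hr. apply mT_pw, mT_cont. intros t. apply Rcont_continuity_Cmod.
apply (Ccont_circle (fun w => 1 - w)); auto.
apply (Ccont_plus (fun _ => 1) (fun w => - w)); [apply Ccont_const|].
apply (Ccont_ext_loc (fun w => - (1) * w) _ _ 1); [lra|intros; ring|].
apply Ccont_mult; [apply Ccont_const|apply Ccont_id].
Qed.

(* The term [avg^q] produced by [stein_inequality] lets the constant [Cz v 0] be absorbed
   without any Hoelder inequality for the weight. *)
Lemma cauchy_bound_nonneg (q al : R) : (1 < q < 2)%R -> (0 < al < q - 1)%R -> exists K, (0 <= K)%R /\
  forall (v : R -> R), intg v -> (forall t, inT t -> (0 <= v t)%R) -> intg (fun t => pw (v t) q) ->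
  forall r, (0 <= r < 1)%R ->
  (normW q al r (fun t => Cz (fun s => RtoC (v s)) (polar r t)) <= K * I (fun t => pw (v t) q * W al (r * r) t))%R.
Proof.
intros Hq Ha. assert (Hpi := PI_RGT_0). assert (Pp := two_PI_pos).
destruct (cos_comparison q al Hq ltac:(lra)) as [A [B [HA [HB HAB]]]].
set (D := (/ cos (al * (PI / 2)))%R).
assert (HD : (0 < D)%R) by (apply Rinv_0_lt_compat, cos_gt_0; nra).
assert (P2 := pw_pos 2 al ltac:(lra)).
(* The summand 1 accounts for [Hz v]; the other accounts for the constant [m], whose [q]-th power is
   bounded by dividing the inequality by [B]. *)
exists ((1 + pw 2 al / B) * (A * D))%R. split.
{ apply Rmult_le_pos; [|apply Rmult_le_pos; lra].
  assert (0 < pw 2 al / B)%R by (apply Rdiv_lt_0_compat; auto). lra. }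
intros v Iv v0 Ivq r Hr. unfold normW.
assert (Hz1 : forall t, (Cmod (polar r t) < 1)%R) by (intros; rewrite Cmod_polar; lra).
assert (MW := mT_W al r ltac:(lra)).
assert (MW2 := mT_W al (r * r) ltac:(nra)).
assert (RHS0 : (0 <= I (fun t => pw (v t) q * W al (r * r) t))%R).
{ apply I_ge0. intros; apply Rmult_le_pos; apply pw_ge0. }
assert (Iv0 : (0 <= I v)%R) by (apply I_ge0; auto).
(* If the integral of [v] is 0, the real part of [Hz v] is not positive and Stein's argument does
   not apply, but then [Cz] vanishes. *)
destruct (Rle_lt_or_eq_dec 0 (I v) Iv0) as [Ip|E0].
2:{ rewrite (I_ext _ (fun _ => 0%R)).
    - rewrite I_const, Rmult_0_r. apply Rmult_le_pos; auto.
      apply Rmult_le_pos; [|apply Rmult_le_pos; lra].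
      assert (0 < pw 2 al / B)%R by (apply Rdiv_lt_0_compat; auto). lra.
    - intros t _. rewrite I_nonneg_zero_Cz, Cmod_0, pw_0 by (auto; lra). ring. }
assert (H0 : Hz v 0 = RtoC (/ (2 * PI) * I v)).
{ unfold Hz. rewrite Cz_0 by auto. ring. }
assert (S0 : snd (Hz v 0) = 0%R) by (rewrite H0; reflexivity).
destruct (stein_inequality q al A B ltac:(lra) ltac:(lra) HAB (Hz v) r Hr
  (fun z Hz' => Cder_Hz v z Iv Hz') (fun z Hz' => Hz_re_pos v z Iv v0 Ip Hz') S0) as [J1 [J2 Main]].
rewrite H0 in Main. set (m := (/ (2 * PI) * I v)%R) in *. simpl fst in Main.
assert (Hm : (0 < m)%R) by (apply Rmult_lt_0_compat; auto; apply Rinv_0_lt_compat; auto).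
set (X := I (fun t => pw (Cmod (Hz v (polar r t))) q * W al r t)%R) in *.
assert (X0 : (0 <= X)%R) by (apply I_ge0; intros; apply Rmult_le_pos; apply pw_ge0).
assert (Pm := pw_pos m q Hm).
(* Fubini moves the Poisson kernel from [v^q], where Jensen's inequality puts it, to the weight,
   where [W_pois] removes it. *)
destruct (fubini_conv (fun t => pw (v t) q) (W al r) (kap r) (2 / (1 - r) + 1) (pw 2 al) Ivq MW) as [F1 F2 F3].
{ intros t _. destruct (W_le al r t ltac:(lra) ltac:(lra)). rewrite Rabs_pos_eq; auto. }
{ intros x. apply kap_cont; auto. }
{ intros x. apply kap_bound; auto. }
assert (Y : (I (fun t => pw (fst (Hz v (polar r t))) q * W al r t) <= D * I (fun t => pw (v t) q * W al (r * r) t))%R).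
{ apply Rle_trans with (I (fun x => / (2 * PI) * (W al r x * I (fun t => pw (v t) q * kap r (x - t))))%R).
  - apply I_le; auto; [apply intg_scal; auto|]. intros t _.
    assert (J := jensen_pois v q (polar r t) ltac:(lra) Iv v0 Ivq (Hz1 t)).
    rewrite (I_ext _ (fun s => pw (v s) q * kap r (t - s))%R) in J by (intros; rewrite pois_kap; auto).
    rewrite (Rmult_comm (pw _ q)).
    replace (/ (2 * PI) * (W al r t * I (fun t0 => pw (v t0) q * kap r (t - t0))))%R with
      (W al r t * (/ (2 * PI) * I (fun t0 => pw (v t0) q * kap r (t - t0))))%R by ring.
    apply Rmult_le_compat_l; [apply pw_ge0|exact J].
  - rewrite I_scal by auto. rewrite F3, <- I_scal, <- I_scal by (auto; apply intg_weight; auto; try lra; nra).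
    apply I_le; [apply intg_scal; auto|apply intg_scal, intg_weight; auto; try lra; nra|].
    intros t _. assert (K := W_pois al r t ltac:(lra) Hr). fold D in K.
    apply (Rmult_le_compat_l (/ (2 * PI) * pw (v t) q)) in K.
    + eapply Rle_trans; [|eapply Rle_trans; [exact K|]].
      * right; ring.
      * right. field. apply PI_neq0.
    + apply Rmult_le_pos; [apply Rlt_le, Rinv_0_lt_compat; auto|apply pw_ge0]. }
assert (Main2 : (X + B * (2 * PI * pw m q) <= A * (D * I (fun t => pw (v t) q * W al (r * r) t)))%R).
{ eapply Rle_trans; [exact Main|]. apply Rmult_le_compat_l; auto. }
set (Z := I (fun t => pw (v t) q * W al (r * r) t)%R) in *.
assert (IW : intg (W al r)) by (apply intg_cont; intros; apply W_cont; auto).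
apply Rle_trans with (I (fun t => pw (Cmod (Hz v (polar r t))) q * W al r t + (2 * PI * pw m q) * (/ (2 * PI) * W al r t))%R).
- assert (Ib : intg (fun t => pw (Cmod (Hz v (polar r t))) q * W al r t + (2 * PI * pw m q) * (/ (2 * PI) * W al r t))%R).
  { apply intg_add; auto. apply intg_scal, intg_scal; auto. }
  assert (Pt : forall t, (pw (Cmod (Cz (fun s => RtoC (v s)) (polar r t))) q * W al r t <=
     pw (Cmod (Hz v (polar r t))) q * W al r t + (2 * PI * pw m q) * (/ (2 * PI) * W al r t))%R).
  { intros t. replace ((2 * PI * pw m q) * (/ (2 * PI) * W al r t))%R with (pw m q * W al r t)%R by (field; apply PI_neq0).
    rewrite <- Rmult_plus_distr_r. apply Rmult_le_compat_r; [apply pw_ge0|].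
    set (h := Hz v (polar r t)).
    (* The transform is the average of [h] and [m], hence its modulus is at most the larger of [|h|]
       and [m]. *)
    assert (E : Cz (fun s => RtoC (v s)) (polar r t) = RtoC (/ 2) * (h + RtoC m)).
    { unfold h, Hz. fold m. rewrite RtoC_inv by lra. field. }
    rewrite E, Cmod_mult, Cmod_R, Rabs_pos_eq by lra.
    assert (T := Cmod_triangle h (RtoC m)). rewrite Cmod_R, (Rabs_pos_eq m) in T by lra.
    assert (Ch := Cmod_ge_0 h). assert (Chm := Cmod_ge_0 (h + RtoC m)).
    assert (Q1 := pw_ge0 (Cmod h) q).
    destruct (Rle_dec (Cmod h) m) as [L|N].
    - apply Rle_trans with (pw m q); [apply pw_mono; lra|lra].
    - apply Rle_trans with (pw (Cmod h) q); [apply pw_mono; lra|lra]. }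
  apply I_le; auto. apply (intg_dom _ (fun t => pw (Cmod (Hz v (polar r t))) q * W al r t + (2 * PI * pw m q) * (/ (2 * PI) * W al r t))%R); auto.
  + apply mT_mul; auto. apply mT_pw, mT_cont. intros t. apply Rcont_continuity_Cmod.
    apply (Rcont_disc (Cz (fun s => RtoC (v s)))); auto. intros z Hz'. apply Cder_Cz; auto. apply cintg_RtoC; auto.
  + intros t _. rewrite Rabs_pos_eq; auto. apply Rmult_le_pos; apply pw_ge0.
- rewrite I_add by (auto; apply intg_scal, intg_scal; auto).
  rewrite I_scal by (apply intg_scal; auto). fold X.
  assert (Wb : (I (fun t => / (2 * PI) * W al r t) <= pw 2 al)%R).
  { apply Rle_trans with (I (fun _ => / (2 * PI) * pw 2 al)%R).
    - apply I_le; [apply intg_scal; auto|apply intg_const|]. intros t _.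
      apply Rmult_le_compat_l; [apply Rlt_le, Rinv_0_lt_compat; auto|]. apply W_le; lra.
    - rewrite I_const. right. field. apply PI_neq0. }
  assert (Q : (0 < 2 * PI * pw m q)%R) by (apply Rmult_lt_0_compat; auto).
  assert (B1 : (X <= A * (D * Z))%R) by (assert (0 < B * (2 * PI * pw m q))%R by (apply Rmult_lt_0_compat; auto); lra).
  assert (B2 : (2 * PI * pw m q <= / B * (A * (D * Z)))%R).
  { apply (Rmult_le_reg_l B); auto.
    replace (B * (/ B * (A * (D * Z))))%R with (A * (D * Z))%R by (field; lra). lra. }
  apply Rle_trans with (A * (D * Z) + / B * (A * (D * Z)) * pw 2 al)%R.
  + apply Rplus_le_compat; auto.
    apply Rmult_le_compat; [apply Rlt_le; exact Q| |exact B2|exact Wb]. apply I_ge0. intros t _.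
    apply Rmult_le_pos; [apply Rlt_le, Rinv_0_lt_compat; auto|apply pw_ge0].
  + right. field. lra.
Qed.

Lemma pw_sum2 (a b q : R) : (0 <= a)%R -> (0 <= b)%R -> (0 < q)%R ->
  (pw (a + b) q <= pw 2 q * (pw a q + pw b q))%R.
Proof.
intros Ha Hb Hq. assert (P2 := pw_pos 2 q ltac:(lra)).
assert (Pa := pw_ge0 a q). assert (Pb := pw_ge0 b q).
destruct (Rle_dec a b) as [L|N].
- apply Rle_trans with (pw (2 * b) q); [apply pw_mono; lra|].
  rewrite pw_mult by lra. nra.
- apply Rle_trans with (pw (2 * a) q); [apply pw_mono; lra|].
  rewrite pw_mult by lra. nra.
Qed.

Lemma intg_pw_of_sqr (f : R -> R) (q : R) : (0 < q <= 2)%R -> mT f -> (forall t, inT t -> (0 <= f t)%R) ->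
  intg (fun t => f t * f t)%R -> intg (fun t => pw (f t) q).
Proof.
intros Hq Mf f0 H. apply (intg_dom _ (fun t => 1 + f t * f t)%R).
- apply mT_pw; auto.
- apply (intg_add (fun _ => 1%R)); auto. apply intg_const.
- intros t Ht. rewrite Rabs_pos_eq by apply pw_ge0. apply pw_le_1_sqr; auto.
Qed.

Lemma intg_normW (q al r : R) (w : R -> C) : (0 < q <= 2)%R -> (0 < al)%R -> (0 <= r < 1)%R -> cintg w ->
  intg (fun t => pw (Cmod (Cz w (polar r t))) q * W al r t)%R.
Proof.
intros Hq Ha Hr Hw.
assert (Rc : forall t, Rcont (fun t => Cz w (polar r t)) t).
{ intros t. apply (Rcont_disc (Cz w)); auto. intros z Hz'. apply Cder_Cz; auto. }
apply intg_weight; auto; [lra| |apply mT_W; lra].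
apply intg_pw_of_sqr; auto.
- apply mT_cont. intros t. apply Rcont_continuity_Cmod; auto.
- intros; apply Cmod_ge_0.
- apply intg_cont. intros t. apply (continuity_pt_mult (fun t => Cmod (Cz w (polar r t)))
    (fun t => Cmod (Cz w (polar r t)))); apply Rcont_continuity_Cmod; auto.
Qed.

(** The crude inequality [(x + y)^q <= 2^q (x^q + y^q)] stands in for Minkowski's. *)
Lemma cauchy_bound_sum (q al r : R) (u v : R -> C) : (1 < q < 2)%R -> (0 < al)%R -> (0 <= r < 1)%R ->
  cintg u -> cintg v ->
  (normW q al r (fun t => Cz (fun s => (u s + v s)%C) (polar r t)) <=
   pw 2 q * (normW q al r (fun t => Cz u (polar r t)) + normW q al r (fun t => Cz v (polar r t))))%R.
Proof.
intros Hq Ha Hr Hu Hv. unfold normW.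
assert (Hz1 : forall t, (Cmod (polar r t) < 1)%R) by (intros; rewrite Cmod_polar; lra).
assert (It := fun w Hw => intg_normW q al r w ltac:(lra) Ha Hr Hw).
rewrite <- I_add, <- I_scal by (try apply intg_add; auto).
apply I_le.
- apply (It (fun s => u s + v s)). apply cintg_add; auto.
- apply intg_scal, intg_add; auto.
- intros t _. rewrite <- Rmult_plus_distr_r, <- Rmult_assoc.
  apply Rmult_le_compat_r; [apply pw_ge0|]. rewrite Cz_add by auto.
  eapply Rle_trans; [apply pw_mono; [apply Cmod_ge_0|apply Cmod_triangle|lra]|].
  apply pw_sum2; try apply Cmod_ge_0; lra.
Qed.

(** [u] is split into the positive and negative parts of its two components, each at most [|u|]. Two
    rounds of [cauchy_bound_sum] over the four pieces produce the factor [4 (2^q)^2]. *)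
Lemma cauchy_bound (q al : R) : (1 < q < 2)%R -> (0 < al < q - 1)%R -> exists K, (0 <= K)%R /\
  forall (u : R -> C), cintg u -> intg (fun t => pw (Cmod (u t)) q) ->
  forall r, (0 <= r < 1)%R ->
  (normW q al r (fun t => Cz u (polar r t)) <= K * I (fun t => pw (Cmod (u t)) q * W al (r * r) t))%R.
Proof.
intros Hq Ha. destruct (cauchy_bound_nonneg q al Hq Ha) as [K [HK H]].
assert (P2 := pw_pos 2 q ltac:(lra)).
exists (4 * (pw 2 q * pw 2 q) * K)%R. split; [repeat apply Rmult_le_pos; lra|].
intros u Hu Huq r Hr.
assert (MU : mT (fun t => Cmod (u t))) by (apply mT_Cmod, cintg_cmT; auto).
assert (MW2 := mT_W al (r * r) ltac:(nra)).
set (X := I (fun t => pw (Cmod (u t)) q * W al (r * r) t)%R).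
assert (IX : intg (fun t => pw (Cmod (u t)) q * W al (r * r) t)%R) by (apply intg_weight; auto; try lra; nra).
assert (B1 : forall (c : C) (f : R -> R), Cmod c = 1%R -> intg f -> (forall t, (0 <= f t)%R) ->
   (forall t, (f t <= Cmod (u t))%R) ->
   (normW q al r (fun t => Cz (fun s => (c * RtoC (f s))%C) (polar r t)) <= K * X)%R).
{ intros c f Hc Hf f0 fu.
  assert (Ifq : intg (fun t => pw (f t) q)).
  { apply (intg_dom _ (fun t => pw (Cmod (u t)) q)); auto.
    - apply mT_pw, intg_mT; auto.
    - intros t _. rewrite Rabs_pos_eq by apply pw_ge0. apply pw_mono; auto; lra. }
  replace (normW q al r (fun t => Cz (fun s => (c * RtoC (f s))%C) (polar r t)))
    with (normW q al r (fun t => Cz (fun s => RtoC (f s)) (polar r t))).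
  - eapply Rle_trans; [apply (H f Hf (fun t _ => f0 t) Ifq r Hr)|].
    apply Rmult_le_compat_l; auto. apply I_le; auto.
    + apply intg_weight; auto; try lra; nra.
    + intros t _. apply Rmult_le_compat_r; [apply pw_ge0|]. apply pw_mono; auto; lra.
  - unfold normW. apply I_ext. intros t _. rewrite Cz_scal.
    + rewrite Cmod_mult, Hc, Rmult_1_l; auto.
    + apply cintg_RtoC; auto.
    + rewrite Cmod_polar; lra. }
destruct Hu as [u1 u2].
set (v1 := fun t => Rmax (fst (u t)) 0). set (v2 := fun t => Rmax (- fst (u t)) 0).
set (v3 := fun t => Rmax (snd (u t)) 0). set (v4 := fun t => Rmax (- snd (u t)) 0).
assert (IM : forall f, intg f -> (forall t, (Rabs (f t) <= Cmod (u t))%R) ->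
   intg (fun t => Rmax (f t) 0) /\ (forall t, (0 <= Rmax (f t) 0)%R) /\ (forall t, (Rmax (f t) 0 <= Cmod (u t))%R)).
{ intros f If Hf. split; [|split].
  - apply (intg_dom _ (fun t => Rabs (f t))).
    + apply mT_max; [apply intg_mT; auto|apply mT_const].
    + apply intg_abs; auto.
    + intros t _. unfold Rmax, Rabs. destruct (Rle_dec (f t) 0); repeat destruct Rcase_abs; lra.
  - intros t. apply Rmax_r.
  - intros t. apply Rmax_lub; [|apply Cmod_ge_0]. eapply Rle_trans; [apply Rle_abs|auto]. }
assert (Io : forall f, intg f -> intg (fun t => - f t)%R).
{ intros f If. apply (intg_ext (fun t => (-1) * f t)%R); [intros; ring|]. apply intg_scal; auto. }
destruct (IM _ u1 (fun t => re_le_Cmod (u t))) as [a1 [b1 c1]].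
destruct (IM _ (Io _ u1)) as [a2 [b2 c2]]; [intros t; rewrite Rabs_Ropp; exact (re_le_Cmod (u t))|].
destruct (IM _ u2 (fun t => im_le_Cmod (u t))) as [a3 [b3 c3]].
destruct (IM _ (Io _ u2)) as [a4 [b4 c4]]; [intros t; rewrite Rabs_Ropp; exact (im_le_Cmod (u t))|].
assert (M1 : Cmod (- (1)) = 1%R) by apply Cmod_m1.
assert (MCi : Cmod (- Ci) = 1%R) by (rewrite Cmod_opp; apply Cmod_Ci).
assert (N1 := B1 1 v1 Cmod_1 a1 b1 c1). assert (N2 := B1 (- (1)) v2 M1 a2 b2 c2).
assert (N3 := B1 Ci v3 Cmod_Ci a3 b3 c3). assert (N4 := B1 (- Ci) v4 MCi a4 b4 c4).
assert (J : forall c f, intg f -> cintg (fun s => c * RtoC (f s))).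
{ intros c f If. apply cintg_scal, cintg_RtoC; auto. }
set (w1 := fun s => 1 * RtoC (v1 s)) in *. set (w2 := fun s => - (1) * RtoC (v2 s)) in *.
set (w3 := fun s => Ci * RtoC (v3 s)) in *. set (w4 := fun s => - Ci * RtoC (v4 s)) in *.
assert (J1 := J 1 v1 a1). assert (J2 := J (- (1)) v2 a2). assert (J3 := J Ci v3 a3). assert (J4 := J (- Ci) v4 a4).
assert (S := cauchy_bound_sum q al r (fun s => w1 s + w2 s) (fun s => w3 s + w4 s) Hq ltac:(lra) Hr
  (cintg_add _ _ J1 J2) (cintg_add _ _ J3 J4)).
assert (S1 := cauchy_bound_sum q al r w1 w2 Hq ltac:(lra) Hr J1 J2).
assert (S2 := cauchy_bound_sum q al r w3 w4 Hq ltac:(lra) Hr J3 J4).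
replace (normW q al r (fun t => Cz u (polar r t))) with
  (normW q al r (fun t => Cz (fun s => w1 s + w2 s + (w3 s + w4 s)) (polar r t))).
- eapply Rle_trans; [exact S|]. rewrite !Rmult_assoc.
  replace (4 * (pw 2 q * (pw 2 q * (K * X))))%R with (pw 2 q * (pw 2 q * (2 * (K * X)) + pw 2 q * (2 * (K * X))))%R by ring.
  apply Rmult_le_compat_l; [lra|].
  apply Rplus_le_compat; [eapply Rle_trans; [exact S1|]|eapply Rle_trans; [exact S2|]];
    apply Rmult_le_compat_l; lra.
- assert (Rm : forall x, (Rmax x 0 - Rmax (- x) 0 = x)%R).
  { intros x. unfold Rmax. destruct (Rle_dec x 0), (Rle_dec (- x) 0); lra. }
  assert (Ew : forall s, w1 s + w2 s + (w3 s + w4 s) = u s).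
  { intros s. unfold w1, w2, w3, w4, v1, v2, v3, v4.
    assert (R1 := Rm (fst (u s))). assert (R2 := Rm (snd (u s))).
    apply C_ext; simpl; lra. }
  unfold normW. apply I_ext. intros t _.
  replace (Cz (fun s => w1 s + w2 s + (w3 s + w4 s)) (polar r t)) with (Cz u (polar r t)); [reflexivity|].
  unfold Cz. rewrite (cI_ext (fun s => (w1 s + w2 s + (w3 s + w4 s)) * ker (polar r t) s)
    (fun s => u s * ker (polar r t) s)); [reflexivity|].
  intros s _. rewrite Ew. reflexivity.
Qed.

(** * Convergence tools for the passage to the boundary *)

(** Bounded mean squares prevent mass from concentrating. For [y = |X n - F|] one has
    [y <= min (y, N) + y^2 / N]; the truncated part tends to 0 by dominated convergence, and the
    rest is uniformly of order [M / N]. *)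
Lemma weak_cv (X : nat -> R -> R) (F : R -> R) (M : R) : (forall n, mT (X n)) -> mT F ->
  (forall n, intg (fun t => X n t * X n t)%R) -> (forall n, (I (fun t => X n t * X n t) <= M)%R) ->
  aeT (fun t => Un_cv (fun n => X n t) (F t)) -> intg F /\ Un_cv (fun n => I (X n)) (I F).
Proof.
intros MX MF IX BX Hcv.
destruct (fatou_le (fun n t => X n t * X n t)%R (fun t => F t * F t)%R M) as [IF2 BF2]; auto.
{ apply mT_mul; auto. }
{ intros; apply Rle_0_sqr. }
{ intros; apply Rle_0_sqr. }
{ revert Hcv. apply aeT_imp. intros t _ H. apply CV_mult; auto. }
assert (I1 : forall f, mT f -> intg (fun t => f t * f t)%R -> intg f).
{ intros f Mf If. apply (intg_dom _ (fun t => 1 + f t * f t)%R); auto.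
  - apply (intg_add (fun _ => 1%R)); auto. apply intg_const.
  - intros t _. apply Rabs_le. nra. }
assert (IF := I1 F MF IF2).
assert (IXn := fun n => I1 (X n) (MX n) (IX n)).
split; auto.
assert (M0 : (0 <= M)%R) by (eapply Rle_trans; [|exact BF2]; apply I_ge0; intros; apply Rle_0_sqr).
intros e He.
(* As [y^2 <= 2 (X n)^2 + 2 F^2], the tail is at most [4 M / N], which this choice puts below
   [e]. *)
set (N := (8 * M / e + 1)%R).
assert (HN : (0 < N)%R).
{ unfold N. assert (0 <= 8 * M / e)%R by (apply Rmult_le_pos; [lra|apply Rlt_le, Rinv_0_lt_compat; auto]). lra. }
assert (HN2 : (4 * M / N < e)%R).
{ apply (Rmult_lt_reg_r N); auto. replace (4 * M / N * N)%R with (4 * M)%R by (field; lra).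
  unfold N. replace (e * (8 * M / e + 1))%R with (8 * M + e)%R by (field; lra). lra. }
set (Y := fun n t => Rabs (X n t - F t)).
assert (IY : forall n, intg (Y n)) by (intros n; apply (intg_abs (fun t => X n t - F t)%R), intg_sub; auto).
set (Z := fun n t => Rmin (Y n t) N).
assert (MZ : forall n, mT (Z n)) by (intros n; apply mT_min; [apply intg_mT; auto|apply mT_const]).
assert (Y0 : forall n t, (0 <= Y n t)%R) by (intros; apply Rabs_pos).
assert (Z0 : forall n t, (0 <= Z n t <= N)%R) by (intros n t; split; [apply Rmin_glb; [apply Y0|lra]|apply Rmin_r]).
destruct (dct Z (fun _ => 0%R) (fun _ => N)) as [_ CZ]; auto.
{ apply mT_const. }
{ revert Hcv. apply aeT_imp. intros t _ H d Hd. destruct (H d Hd) as [n0 Hn0]. exists n0. intros n Hn.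
  assert (K := Hn0 n Hn). unfold R_dist in *. rewrite Rminus_0_r, Rabs_pos_eq by apply Z0.
  eapply Rle_lt_trans; [apply Rmin_l|exact K]. }
{ apply intg_const. }
{ intros n t _. rewrite Rabs_pos_eq; apply Z0. }
rewrite I_const, Rmult_0_r in CZ.
destruct (CZ (e - 4 * M / N)%R ltac:(lra)) as [n0 Hn0]. exists n0. intros n Hn.
assert (K := Hn0 n Hn). unfold R_dist in *. rewrite Rminus_0_r, Rabs_pos_eq in K by (apply I_ge0; intros; apply Z0).
assert (IZ : intg (Z n)).
{ apply (intg_dom _ (fun _ => N)); auto; [apply intg_const|]. intros t _. rewrite Rabs_pos_eq; apply Z0. }
rewrite <- I_sub by auto.
eapply Rle_lt_trans; [apply Rabs_I, intg_sub; auto|].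
change (I (Y n) < e)%R.
apply Rle_lt_trans with (I (fun t => Z n t + / N * (2 * (X n t * X n t) + 2 * (F t * F t))))%R.
- apply I_le; auto.
  + apply intg_add; auto. apply intg_scal, intg_add; apply intg_scal; auto.
  + intros t _. assert (YY : (Y n t * Y n t <= 2 * (X n t * X n t) + 2 * (F t * F t))%R).
    { unfold Y. rewrite <- Rabs_mult, Rabs_pos_eq by apply Rle_0_sqr.
      assert (Q := Rle_0_sqr (X n t + F t)). unfold Rsqr in Q. lra. }
    assert (Yt := Y0 n t). set (y := Y n t) in *.
    unfold Z. fold y. unfold Rmin. destruct (Rle_dec y N) as [L|NL].
    * assert (0 <= / N * (2 * (X n t * X n t) + 2 * (F t * F t)))%R.
      { apply Rmult_le_pos; [apply Rlt_le, Rinv_0_lt_compat; auto|nra]. } lra.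
    * assert (y <= / N * (2 * (X n t * X n t) + 2 * (F t * F t)))%R; [|lra].
      apply (Rmult_le_reg_l N); auto. rewrite <- Rmult_assoc, Rinv_r, Rmult_1_l by lra. nra.
- rewrite I_add; [|auto|apply intg_scal, intg_add; apply intg_scal; auto].
  rewrite (I_scal (/ N)) by (apply intg_add; apply intg_scal; auto).
  rewrite I_add by (apply intg_scal; auto). rewrite !I_scal by auto.
  assert (/ N * (2 * I (fun t => X n t * X n t) + 2 * I (fun t => F t * F t)) <= 4 * M / N)%R; [|lra].
  unfold Rdiv. rewrite Rmult_comm. apply Rmult_le_compat_r; [apply Rlt_le, Rinv_0_lt_compat; auto|].
  assert (B := BX n). lra.
Qed.

Lemma pw_cv (x : nat -> R) (l s : R) : (0 < s)%R -> (forall n, (0 <= x n)%R) -> (0 <= l)%R ->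
  Un_cv x l -> Un_cv (fun n => pw (x n) s) (pw l s).
Proof.
intros Hs x0 Hl H. destruct (Rle_lt_or_eq_dec 0 l Hl) as [Hp|<-].
- assert (Cc : continuity_pt (fun y => exp (s * ln y)) l).
  { apply derivable_continuous_pt. eexists.
    apply (derivable_pt_lim_comp (fun y => s * ln y)%R exp).
    - apply (derivable_pt_lim_scal ln s), derivable_pt_lim_ln; auto.
    - apply derivable_pt_lim_exp. }
  intros e He.
  destruct (Cc e He) as [d [Hd K]].
  destruct (H (Rmin d l)) as [n0 Hn0]; [apply Rmin_pos; auto|].
  exists n0. intros n Hn. assert (D := Hn0 n Hn). unfold R_dist in *.
  assert (D1 := Rlt_le_trans _ _ _ D (Rmin_l _ _)). assert (D2 := Rlt_le_trans _ _ _ D (Rmin_r _ _)).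
  apply Rabs_def2 in D2. rewrite !pw_exp by lra.
  destruct (Req_dec (x n) l) as [->|N]; [rewrite Rminus_diag, Rabs_R0; auto|].
  apply (K (x n)). split; [split; [exact Logic.I|auto]|exact D1].
- rewrite pw_0 by lra. intros e He.
  destruct (H (exp (ln e / s))) as [n0 Hn0]; [apply exp_pos|]. exists n0. intros n Hn.
  assert (D := Hn0 n Hn). unfold R_dist in *. rewrite Rminus_0_r in *.
  rewrite Rabs_pos_eq in D by auto. rewrite Rabs_pos_eq by apply pw_ge0.
  destruct (Rle_lt_or_eq_dec 0 (x n) (x0 n)) as [P|E]; [|rewrite <- E, pw_0 by lra; auto].
  rewrite pw_exp by auto. rewrite <- (exp_ln e) by auto. apply exp_increasing.
  apply ln_increasing in D; auto. rewrite ln_exp in D.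
  apply (Rmult_lt_compat_l s) in D; auto. replace (s * (ln e / s))%R with (ln e) in D by (field; lra). exact D.
Qed.

(** * Boundary values in the weighted Hardy space *)

Lemma holo_Cder (f : C -> C) : holo_on_disc f <-> forall z, (Cmod z < 1)%R -> exists l, Cder f z l.
Proof.
split; intros H z Hz'; destruct (H z Hz') as [l Hl]; exists l; apply Cder_is_derive; auto.
Qed.

(* The bound follows from continuity; carrying it along avoids a compactness argument. *)
Definition disc_algebra (phi : C -> C) : Prop :=
  holo_on_disc phi /\ cont_on_closed_disc phi /\
  exists B, (0 <= B)%R /\ forall w, (Cmod w <= 1)%R -> (Cmod (phi w) <= B)%R.

(** Zeros on the circle are allowed on a null set: the weights [(1 - z)^a] vanish at 1, and division
    by [g] still makes sense almost everywhere. *)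
Definition good_weight (g : C -> C) : Prop :=
  disc_algebra g /\ (forall z, (Cmod z < 1)%R -> g z <> 0) /\ aeT (fun t => g (polar 1 t) <> 0).

(* Freezing the radius outside [0, 1] turns radial limits into two-sided continuity at [1]. *)
Definition clip (r : R) : R := Rmax 0 (Rmin r 1).

Lemma clip_in (r : R) : (0 <= clip r <= 1)%R.
Proof. unfold clip, Rmax, Rmin. destruct (Rle_dec r 1), (Rle_dec 0 _); lra. Qed.

Lemma clip_id (r : R) : (0 <= r <= 1)%R -> clip r = r.
Proof. intros H. unfold clip. rewrite Rmin_left, Rmax_right; lra. Qed.

Lemma clip_near (r : R) : (Rabs (clip r - 1) <= Rabs (r - 1))%R.
Proof.
unfold clip, Rmax, Rmin. destruct (Rle_dec r 1), (Rle_dec 0 _); try lra; unfold Rabs; repeat destruct Rcase_abs; lra.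
Qed.

Lemma Cmod_polar_le (r s t : R) : (Cmod (polar r t - polar s t) <= Rabs (r - s))%R.
Proof.
replace (polar r t - polar s t) with (RtoC (r - s) * polar 1 t) by (apply C_ext; simpl; ring).
rewrite Cmod_mult, Cmod_R, Cmod_polar by lra. lra.
Qed.

Lemma DA_clip (phi : C -> C) (t : R) : disc_algebra phi -> Rcont (fun r => phi (polar (clip r) t)) 1.
Proof.
intros [_ [Hc _]] e He.
destruct (Hc (polar 1 t) ltac:(rewrite Cmod_polar; lra) e He) as [d [Hd K]].
exists d; split; auto. intros r Hr. rewrite (clip_id 1) by lra. apply K.
- assert (c := clip_in r). rewrite Cmod_polar; lra.
- eapply Rle_lt_trans; [apply Cmod_polar_le|]. eapply Rle_lt_trans; [apply clip_near|auto].
Qed.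

Lemma DA_circle (phi : C -> C) (t : R) : disc_algebra phi -> Rcont (fun s => phi (polar 1 s)) t.
Proof.
intros [_ [Hc _]] e He.
destruct (Hc (polar 1 t) ltac:(rewrite Cmod_polar; lra) e He) as [d1 [Hd1 K]].
destruct (Rcont_polar 1 t ltac:(lra) d1 Hd1) as [d [Hd K2]].
exists d; split; auto. intros s Hs. apply K; [rewrite Cmod_polar; lra|auto].
Qed.

Lemma DA_disc (phi : C -> C) (r t : R) : holo_on_disc phi -> (0 <= r < 1)%R -> Rcont (fun s => phi (polar r s)) t.
Proof. intros H Hr. apply Rcont_disc; auto. apply holo_Cder; auto. Qed.

Definition Ccv (u : nat -> C) (l : C) : Prop :=
  Un_cv (fun n => fst (u n)) (fst l) /\ Un_cv (fun n => snd (u n)) (snd l).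

Lemma Ccv_mult (u v : nat -> C) (a b : C) : Ccv u a -> Ccv v b -> Ccv (fun n => u n * v n) (a * b).
Proof.
intros [u1 u2] [v1 v2]. split; simpl.
- apply (CV_minus (fun n => fst (u n) * fst (v n))%R (fun n => snd (u n) * snd (v n))%R); apply CV_mult; auto.
- apply (CV_plus (fun n => fst (u n) * snd (v n))%R (fun n => snd (u n) * fst (v n))%R); apply CV_mult; auto.
Qed.

Lemma Un_cv_const (x : R) : Un_cv (fun _ => x) x.
Proof. intros e He. exists 0%nat. intros n _. unfold R_dist. rewrite Rminus_diag, Rabs_R0; auto. Qed.

Lemma Ccv_const (c : C) : Ccv (fun _ => c) c.
Proof. split; apply Un_cv_const. Qed.

Lemma Ccv_unique (u : nat -> C) (a b : C) : Ccv u a -> Ccv u b -> a = b.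
Proof. intros [u1 u2] [v1 v2]. apply C_ext; eapply UL_sequence; eauto. Qed.

Lemma Ccv_Cmod (u : nat -> C) (l : C) : Ccv u l -> Un_cv (fun n => Cmod (u n)) (Cmod l).
Proof.
intros [H1 H2] e He.
destruct (H1 (e / 2)%R ltac:(lra)) as [n1 K1]. destruct (H2 (e / 2)%R ltac:(lra)) as [n2 K2].
exists (Nat.max n1 n2). intros n Hn. unfold R_dist in *.
assert (A1 := K1 n ltac:(lia)). assert (A2 := K2 n ltac:(lia)).
apply Rle_lt_trans with (Cmod (u n - l)).
- apply Rabs_le. assert (T1 := Cmod_triangle (u n - l) l). assert (T2 := Cmod_triangle (l - u n) (u n)).
  replace (u n - l + l) with (u n) in T1 by ring. replace (l - u n + u n) with l in T2 by ring.
  rewrite (Cmod_sub_sym l) in T2. lra.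
- eapply Rle_lt_trans; [apply Cmod_le_abs|]. simpl. unfold Rminus in *. lra.
Qed.

(** The shift by 2 keeps the radius strictly between 0 and 1 already for [n = 0]. *)
Definition rs (n : nat) : R := (1 - / (INR n + 2))%R.

Lemma rs_in (n : nat) : (0 < rs n < 1)%R.
Proof.
unfold rs. assert (P := pos_INR n).
assert (0 < / (INR n + 2))%R by (apply Rinv_0_lt_compat; lra).
assert (/ (INR n + 2) < 1)%R by (rewrite <- Rinv_1; apply Rinv_lt_contravar; lra). lra.
Qed.

Lemma rs_cv : Un_cv rs 1.
Proof.
intros e He. destruct (archimed_cor1 e He) as [N [H1 H2]]. exists N. intros n Hn.
unfold R_dist, rs. replace (1 - / (INR n + 2) - 1)%R with (- / (INR n + 2))%R by ring.
rewrite Rabs_Ropp, Rabs_pos_eq.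
- eapply Rlt_trans; [|exact H1]. apply Rinv_lt_contravar.
  + apply Rmult_lt_0_compat; [apply lt_0_INR; auto|]. generalize (pos_INR n); lra.
  + apply le_INR in Hn. lra.
- apply Rlt_le, Rinv_0_lt_compat. generalize (pos_INR n); lra.
Qed.

Lemma Rcont_rs (u : R -> C) : Rcont u 1 -> Ccv (fun n => u (rs n)) (u 1%R).
Proof.
intros H. split; intros e He; destruct (H e He) as [d [Hd K]]; destruct (rs_cv d Hd) as [N HN];
  exists N; intros n Hn; (eapply Rle_lt_trans; [|apply (K (rs n)), (HN n Hn)]);
  [exact (re_le_Cmod (u (rs n) - u 1%R))|exact (im_le_Cmod (u (rs n) - u 1%R))].
Qed.

Lemma left_lim_rs (f : R -> R) (l : R) : left_lim f l -> Un_cv (fun n => f (rs n)) l.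
Proof.
intros H e He. destruct (H e He) as [d [Hd K]]. destruct (rs_cv d Hd) as [N HN].
exists N. intros n Hn. apply K. assert (D := HN n Hn). unfold R_dist in D. apply Rabs_def2 in D.
assert (R1 := rs_in n). lra.
Qed.

Lemma Rcont_left_lim (u v : R -> C) : Rcont u 1 -> (forall r, (0 < r < 1)%R -> v r = u r) ->
  left_lim (fun r => fst (v r)) (fst (u 1%R)) /\ left_lim (fun r => snd (v r)) (snd (u 1%R)).
Proof.
intros H E. split; intros e He; destruct (H e He) as [d [Hd K]]; exists (Rmin d 1);
  (split; [apply Rmin_pos; lra|]); intros r Hr; assert (M1 := Rmin_l d 1); assert (M2 := Rmin_r d 1);
  rewrite E by lra; (eapply Rle_lt_trans; [|apply (K r), Rabs_def1; lra]);
  [exact (re_le_Cmod (u r - u 1%R))|exact (im_le_Cmod (u r - u 1%R))].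
Qed.

Lemma DA_rs (phi : C -> C) (t : R) : disc_algebra phi -> Ccv (fun n => phi (polar (rs n) t)) (phi (polar 1 t)).
Proof.
intros H. assert (K := Rcont_rs _ (DA_clip phi t H)). simpl in K.
rewrite (clip_id 1) in K by lra. destruct K as [K1 K2].
split; [revert K1|revert K2]; apply Un_cv_ext; intros n; rewrite clip_id; auto; assert (R1 := rs_in n); lra.
Qed.

Lemma mT_Cmod_circle (g : C -> C) : disc_algebra g -> mT (fun t => Cmod (g (polar 1 t))).
Proof. intros H. apply mT_Cmod, cmT_cont. intros t. apply DA_circle; auto. Qed.

Lemma pdens_r_intg (g : C -> C) : disc_algebra g -> forall F, holo_on_disc F -> forall r, (0 <= r < 1)%R -> intg (pdens_r g F r).
Proof.
intros [Hg _] F HF r Hr. apply intg_cont. intros t. unfold pdens_r.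
apply (continuity_pt_mult (fun t => Cmod (F (polar r t)) * Cmod (F (polar r t)))%R
  (fun t => Cmod (g (polar r t)) * Cmod (g (polar r t)))%R).
- apply (continuity_pt_mult (fun t => Cmod (F (polar r t))) (fun t => Cmod (F (polar r t))));
  apply Rcont_continuity_Cmod, DA_disc; auto.
- apply (continuity_pt_mult (fun t => Cmod (g (polar r t))) (fun t => Cmod (g (polar r t))));
  apply Rcont_continuity_Cmod, DA_disc; auto.
Qed.

Definition Hardy_data (g : C -> C) (h : R -> C) (F : C -> C) (M : R) : Prop :=
  holo_on_disc F /\ (forall r, (0 <= r < 1)%R -> (I (pdens_r g F r) <= M)%R) /\
  aeT (fun t => left_lim (fun r => fst (F (polar r t))) (fst (h t)) /\
                left_lim (fun r => snd (F (polar r t))) (snd (h t))).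

Lemma Hp_iff (g : C -> C) (h : R -> C) : disc_algebra g ->
  Hp g 2 h <-> (cmT h /\ intg (pdens g 2 h) /\ exists F M, Hardy_data g h F M).
Proof.
intros Hg. rewrite (HpP g h (mT_Cmod_circle g Hg) (pdens_r_intg g Hg)). split.
- intros [ch ih [F [hF [M HM] cF]]]. split; auto. split; auto. exists F, M. split; auto.
- intros [ch [ih [F [M [hF [HM cF]]]]]]. constructor; auto. exists F. constructor; auto. exists M; auto.
Qed.

Lemma Lp_iff (g : C -> C) (p : R) (f : R -> C) : disc_algebra g -> Lp g p f <-> cmT f /\ intg (pdens g p f).
Proof. intros Hg. apply LpP, mT_Cmod_circle; auto. Qed.

(** The circular means of [|F g|^2] are bounded and [F g] converges radially almost everywhere, so
    [weak_cv] applies to both components. The multiplier may vary with [n], since [szego_intro]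
    integrates a disc algebra function on the circle of radius [rs n] itself. *)
Lemma radial_weak_cv (g F : C -> C) (h : R -> C) (M B : R) (psin : nat -> R -> C) (psi : R -> C) :
  disc_algebra g -> cmT h -> Hardy_data g h F M -> (forall n, cmT (psin n)) -> cmT psi ->
  (forall n t, inT t -> (Cmod (psin n t) <= B)%R) -> aeT (fun t => Ccv (fun n => psin n t) (psi t)) ->
  cintg (fun t => h t * g (polar 1 t) * psi t) /\
  Ccv (fun n => cI (fun t => F (polar (rs n) t) * g (polar (rs n) t) * psin n t))
      (cI (fun t => h t * g (polar 1 t) * psi t)).
Proof.
intros Hg ch [hF [HM cF]] cn cp Bn Cn.
assert (R0 : forall n, (0 <= rs n < 1)%R) by (intros n; assert (R1 := rs_in n); lra).
set (X := fun n t => F (polar (rs n) t) * g (polar (rs n) t) * psin n t).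
assert (CX : forall n, cmT (X n)).
{ intros n. apply (cmT_mult (fun t => F (polar (rs n) t) * g (polar (rs n) t)) (psin n)); auto.
  apply (cmT_mult (fun t => F (polar (rs n) t)) (fun t => g (polar (rs n) t))); apply cmT_cont; intros t;
  apply DA_disc; auto. apply Hg. }
assert (CL : cmT (fun t => h t * g (polar 1 t) * psi t)).
{ apply (cmT_mult (fun t => h t * g (polar 1 t)) psi); auto.
  apply (cmT_mult h (fun t => g (polar 1 t))); auto. apply cmT_cont; intros t. apply DA_circle; auto. }
assert (AX : aeT (fun t => Ccv (fun n => X n t) (h t * g (polar 1 t) * psi t))).
{ generalize (aeT_and _ _ cF Cn). apply aeT_imp. intros t _ [[L1 L2] L3].
  apply Ccv_mult; auto. apply Ccv_mult; [|apply DA_rs; auto].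
  split; [exact (left_lim_rs _ _ L1)|exact (left_lim_rs _ _ L2)]. }
assert (SX : forall n t, inT t -> (Cmod (X n t) * Cmod (X n t) <= (B * B) * pdens_r g F (rs n) t)%R).
{ intros n t Ht. unfold X. rewrite !Cmod_mult. unfold pdens_r. assert (K := Bn n t Ht).
  assert (P1 := Cmod_ge_0 (psin n t)).
  set (a := Cmod (F (polar (rs n) t))). set (b := Cmod (g (polar (rs n) t))). set (c := Cmod (psin n t)) in *.
  replace (a * b * c * (a * b * c))%R with ((c * c) * (a * a * (b * b)))%R by ring.
  apply Rmult_le_compat_r; [apply Rmult_le_pos; apply Rle_0_sqr|]. apply Rmult_le_compat; auto. }
assert (Ip := fun n => pdens_r_intg g Hg F hF (rs n) (R0 n)).
(* [pr] is the real or the imaginary part; the argument is the same for both. *)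
assert (G : forall (pr : C -> R), (forall z, (Rabs (pr z) <= Cmod z)%R) ->
  (forall u, cmT u -> mT (fun t => pr (u t))) ->
  (forall u l, Ccv u l -> Un_cv (fun n => pr (u n)) (pr l)) ->
  intg (fun t => pr (h t * g (polar 1 t) * psi t)%C) /\
  Un_cv (fun n => I (fun t => pr (X n t))) (I (fun t => pr (h t * g (polar 1 t) * psi t)%C))).
{ intros pr P1 P2 P3.
  assert (Sq : forall n t, inT t -> (pr (X n t) * pr (X n t) <= (B * B) * pdens_r g F (rs n) t)%R).
  { intros n t Ht. eapply Rle_trans; [|apply SX; auto]. assert (K := P1 (X n t)).
    rewrite <- (Rabs_pos_eq (pr _ * pr _)) by apply Rle_0_sqr. rewrite Rabs_mult.
    apply Rmult_le_compat; auto; apply Rabs_pos. }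
  assert (IS : forall n, intg (fun t => pr (X n t) * pr (X n t))%R).
  { intros n. apply (intg_dom _ (fun t => (B * B) * pdens_r g F (rs n) t)%R).
    - apply mT_mul; apply P2; auto.
    - apply intg_scal; auto.
    - intros t Ht. rewrite Rabs_pos_eq by apply Rle_0_sqr. auto. }
  apply (weak_cv (fun n t => pr (X n t)) (fun t => pr (h t * g (polar 1 t) * psi t)%C) ((B * B) * M)%R); auto.
  - intros n. apply Rle_trans with (I (fun t => (B * B) * pdens_r g F (rs n) t)%R).
    + apply I_le; auto. apply intg_scal; auto.
    + rewrite I_scal by auto. apply Rmult_le_compat_l; [apply Rle_0_sqr|apply HM; auto].
  - revert AX. apply aeT_imp. intros t _ H. apply (P3 (fun n => X n t)); auto. }
destruct (G fst) as [I1 C1]; [exact re_le_Cmod|intros u []; auto|intros u l []; auto|].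
destruct (G snd) as [I2 C2]; [exact im_le_Cmod|intros u []; auto|intros u l []; auto|].
split; split; auto.
Qed.

Lemma cmT_inv (u : R -> C) : cmT u -> cmT (fun t => / u t).
Proof.
intros [u1 u2].
assert (D : mT (fun t => / (fst (u t) ^ 2 + snd (u t) ^ 2))%R).
{ apply mT_inv. apply (mT_ext (fun t => fst (u t) * fst (u t) + snd (u t) * snd (u t))%R); [intros; ring|].
  apply mT_add; apply mT_mul; auto. }
split; simpl; unfold Rdiv; apply mT_mul; auto. apply mT_opp; auto.
Qed.

Lemma pdens2 (g : C -> C) (u : R -> C) (t : R) :
  pdens g 2 u t = (Cmod (u t * g (polar 1 t)) * Cmod (u t * g (polar 1 t)))%R.
Proof. unfold pdens. rewrite pw2, Cmod_mult by apply Cmod_ge_0. ring. Qed.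

(** Only an inequality, since the left side is 0 when [b = 0]. *)
Lemma Cmod_div_mult (a b : C) : (Cmod (a / b * b) <= Cmod a)%R.
Proof.
destruct (Ceq_dec b 0) as [->|N].
- replace (a / 0 * 0) with (RtoC 0) by ring. rewrite Cmod_0. apply Cmod_ge_0.
- replace (a / b * b) with a by (field; auto). lra.
Qed.

(** Multiplied by [g], the quotient is bounded by the supremum of [phi], which bounds all weighted
    means; radial limits exist wherever [g] does not vanish on the circle. These quotients are both
    the test functions for orthogonality and the explicit projections. *)
Lemma Hp_div (g phi : C -> C) : good_weight g -> disc_algebra phi -> Hp g 2 (fun t => phi (polar 1 t) / g (polar 1 t)).
Proof.
intros [Hg [Hnz Hae]] Hphi. apply Hp_iff; auto.
assert (Hphi' := Hphi). destruct Hphi' as [hphi [_ [B [HB0 HB]]]].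
assert (cg : cmT (fun t => g (polar 1 t))) by (apply cmT_cont; intros; apply DA_circle; auto).
assert (cp : cmT (fun t => phi (polar 1 t))) by (apply cmT_cont; intros; apply DA_circle; auto).
assert (ch : cmT (fun t => phi (polar 1 t) / g (polar 1 t))).
{ apply (cmT_mult (fun t => phi (polar 1 t)) (fun t => / g (polar 1 t))); auto. apply (cmT_inv (fun t => g (polar 1 t))); auto. }
assert (Sq : forall z, (Cmod z <= 1)%R -> (Cmod (phi z / g z * g z) * Cmod (phi z / g z * g z) <= B * B)%R).
{ intros z Hz'. assert (K := Cmod_div_mult (phi z) (g z)). assert (K2 := HB z Hz').
  apply Rmult_le_compat; try apply Cmod_ge_0; lra. }
split; auto. split.
{ apply (intg_dom _ (fun _ => B * B)%R).
  - apply mT_mul; [apply mT_pw, mT_Cmod; auto|]. apply mT_mul; apply mT_Cmod_circle; auto.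
  - apply intg_const.
  - intros t _. rewrite Rabs_pos_eq by apply pdens_ge0. rewrite pdens2. apply Sq. rewrite Cmod_polar; lra. }
assert (hF : holo_on_disc (fun z => phi z / g z)).
{ apply holo_Cder. intros z Hz'. destruct (proj1 (holo_Cder phi) hphi z Hz') as [l Hl].
  destruct (proj1 (holo_Cder g) (proj1 Hg) z Hz') as [m Hm]. eexists.
  apply (Cder_mult phi (fun z => / g z)); [exact Hl|].
  apply (Cder_comp Cinv g); [exact Hm|apply Cder_inv; auto]. }
exists (fun z => phi z / g z), (2 * PI * (B * B))%R. split; auto. split.
- intros r Hr. rewrite <- I_const. apply I_le; [apply pdens_r_intg; auto|apply intg_const|].
  intros t _. unfold pdens_r.
  eapply Rle_trans; [|apply (Sq (polar r t)); rewrite Cmod_polar; lra].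
  rewrite !Cmod_mult. right; ring.
- revert Hae. apply aeT_imp. intros t _ Ht.
  assert (Rc : Rcont (fun r => phi (polar (clip r) t) * / g (polar (clip r) t)) 1).
  { apply Rcont_mult; [apply DA_clip; auto|].
    apply (Rcont_comp Cinv (fun r => g (polar (clip r) t))); [apply DA_clip; auto|].
    apply Ccont_inv. rewrite clip_id by lra. auto. }
  destruct (Rcont_left_lim _ (fun r => phi (polar r t) / g (polar r t)) Rc) as [L1 L2].
  + intros r Hr. rewrite clip_id by lra. reflexivity.
  + cbn beta in L1, L2. rewrite (clip_id 1) in L1, L2 by lra. split; [exact L1|exact L2].
Qed.

Lemma cintg_mult_g (g : C -> C) (u : R -> C) : disc_algebra g -> cmT u -> intg (pdens g 2 u) ->
  cintg (fun t => u t * g (polar 1 t)) /\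
  intg (fun t => Cmod (u t * g (polar 1 t)) * Cmod (u t * g (polar 1 t)))%R.
Proof.
intros Hg cu iu.
assert (S : intg (fun t => Cmod (u t * g (polar 1 t)) * Cmod (u t * g (polar 1 t)))%R).
{ revert iu. apply intg_ext. intros t _. apply pdens2. }
split; auto. apply (cintg_dom _ (fun t => 1 + Cmod (u t * g (polar 1 t)) * Cmod (u t * g (polar 1 t)))%R).
- apply (cmT_mult u (fun t => g (polar 1 t))); auto. apply cmT_cont; intros; apply DA_circle; auto.
- apply (intg_add (fun _ => 1%R)); auto. apply intg_const.
- intros t _. nra.
Qed.

(** * Orthogonality and the form of the projection *)

(** [w] has to match the weighted product only almost everywhere, which permits cancelling [g] off
    its zeros. *)
Lemma orth_iff (g : C -> C) (u : R -> C) (k : R -> C) (w : R -> C) :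
  cintg w -> cmT u -> cmT k -> disc_algebra g ->
  aeT (fun t => u t * Cconj (k t) * RtoC (Cmod (g (polar 1 t)) * Cmod (g (polar 1 t))) = w t) ->
  intg (fun t => Cmod (u t * g (polar 1 t)) * Cmod (k t * g (polar 1 t)))%R ->
  orth g u k <-> cI w = 0.
Proof.
intros [w1 w2] cu ck Hg Ha Hi.
assert (cz : cmT (fun t => u t * Cconj (k t) * RtoC (Cmod (g (polar 1 t)) * Cmod (g (polar 1 t))))).
{ apply (cmT_mult (fun t => u t * Cconj (k t)) (fun t => RtoC (Cmod (g (polar 1 t)) * Cmod (g (polar 1 t))))).
  - apply (cmT_mult u (fun t => Cconj (k t))); auto. apply cmT_conj; auto.
  - apply cmT_RtoC. apply mT_mul; apply mT_Cmod_circle; auto. }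
set (z := fun t => u t * Cconj (k t) * RtoC (Cmod (g (polar 1 t)) * Cmod (g (polar 1 t)))) in *.
assert (iz : cintg z).
{ apply (cintg_dom _ _ cz Hi). intros t _. unfold z.
  rewrite !Cmod_mult, Cmod_conj, Cmod_R, Rabs_mult, !(Rabs_pos_eq (Cmod _)) by apply Cmod_ge_0. right; ring. }
assert (E1 : forall t, odens1 g u k t = fst (z t)).
{ intros t. unfold odens1, z. simpl. ring. }
assert (E2 : forall t, odens2 g u k t = snd (z t)).
{ intros t. unfold odens2, z. simpl. ring. }
destruct iz as [z1 z2].
rewrite orthP; [|revert z1; apply intg_ext; intros; rewrite E1; auto|revert z2; apply intg_ext; intros; rewrite E2; auto].
rewrite (I_ext _ _ (fun t _ => E1 t)), (I_ext _ _ (fun t _ => E2 t)).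
rewrite (I_ae_ext (fun t => fst (z t)) (fun t => fst (w t)));
  [|apply intg_mT; auto|apply intg_mT; auto|revert Ha; apply aeT_imp; intros t _ E; unfold z; rewrite E; auto].
rewrite (I_ae_ext (fun t => snd (z t)) (fun t => snd (w t)));
  [|apply intg_mT; auto|apply intg_mT; auto|revert Ha; apply aeT_imp; intros t _ E; unfold z; rewrite E; auto].
unfold cI. split.
- intros [-> ->]. reflexivity.
- intros E. split; [exact (f_equal fst E)|exact (f_equal snd E)].
Qed.

Lemma RtoC_Cmod_sqr (z : C) : RtoC (Cmod z * Cmod z) = z * Cconj z.
Proof.
apply C_ext; simpl; [|ring].
unfold Cmod. rewrite sqrt_sqrt; [ring|]. apply Rplus_le_le_0_compat; apply pow2_ge_0.
Qed.

Lemma DA_of_Cder (phi : C -> C) (B : R) : (forall w, (Cmod w <= 1)%R -> exists l, Cder phi w l) -> (0 <= B)%R ->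
  (forall w, (Cmod w <= 1)%R -> (Cmod (phi w) <= B)%R) -> disc_algebra phi.
Proof.
intros H HB Hb. split; [|split].
- apply holo_Cder. intros z Hz'. apply H; lra.
- intros z Hz' e He. destruct (H z Hz') as [l Hl]. destruct (Cder_cont _ _ _ Hl e He) as [d [Hd K]].
  exists d; split; auto.
- exists B; auto.
Qed.

Lemma DA_kernel (z : C) : (Cmod z < 1)%R -> disc_algebra (fun w => / (1 - Cconj z * w)).
Proof.
intros Hz'. assert (P := Cmod_ge_0 z).
assert (L : forall w, (Cmod w <= 1)%R -> (Cmod (Cconj z * w) <= Cmod z)%R).
{ intros w Hw. rewrite Cmod_mult, Cmod_conj. assert (Pw := Cmod_ge_0 w). nra. }
apply (DA_of_Cder _ (/ (1 - Cmod z))).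
- intros w Hw. apply Cder_kernel. assert (K := L w Hw). lra.
- apply Rlt_le, Rinv_0_lt_compat. lra.
- intros w Hw. assert (K := L w Hw). rewrite Cmod_inv by (apply one_minus_neq_0; lra).
  apply Rinv_le_contravar; [lra|]. assert (K2 := Cmod_one_minus (Cconj z * w)). lra.
Qed.

Lemma cmT_circle (phi : C -> C) : disc_algebra phi -> cmT (fun t => phi (polar 1 t)).
Proof. intros H. apply cmT_cont. intros t. apply DA_circle; auto. Qed.

Lemma DA_bound_circle (phi : C -> C) : disc_algebra phi -> exists B, (0 <= B)%R /\ forall t, (Cmod (phi (polar 1 t)) <= B)%R.
Proof. intros [_ [_ [B [HB H]]]]. exists B; split; auto. intros t. apply H. rewrite Cmod_polar; lra. Qed.

Lemma cintg_bounded_mult (u v : R -> C) (B : R) : cintg u -> cmT v -> (forall t, inT t -> (Cmod (v t) <= B)%R) ->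
  cintg (fun t => u t * v t).
Proof.
intros Hu Hv HB. apply (cintg_dom _ (fun t => B * Cmod (u t))%R).
- apply (cmT_mult u v); auto. apply cintg_cmT; auto.
- apply intg_scal, intg_Cmod; auto.
- intros t Ht. rewrite Cmod_mult, Rmult_comm. apply Rmult_le_compat_r; [apply Cmod_ge_0|auto].
Qed.

Lemma cI_conj (u : R -> C) : cintg u -> cI (fun t => Cconj (u t)) = Cconj (cI u).
Proof.
intros [u1 u2]. apply C_ext; simpl; [reflexivity|].
rewrite (I_ext _ (fun t => (-1) * snd (u t))%R) by (intros; simpl; ring).
rewrite I_scal by auto. ring.
Qed.

Lemma Cconj_neq_0 (z : C) : z <> 0 -> Cconj z <> 0.
Proof. intros H. apply Cmod_gt_0. rewrite Cmod_conj. apply Cmod_gt_0; auto. Qed.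

Lemma Cconj_mult (a b : C) : Cconj (a * b) = Cconj a * Cconj b.
Proof. apply C_ext; simpl; ring. Qed.

Lemma Cconj_div (a b : C) : b <> 0 -> Cconj (a / b) = Cconj a / Cconj b.
Proof. intros H. unfold Cdiv. rewrite Cconj_mult, Cinv_conj; auto. Qed.

Lemma cmT_div_circle (g phi : C -> C) : disc_algebra g -> disc_algebra phi -> cmT (fun t => phi (polar 1 t) / g (polar 1 t)).
Proof.
intros Hg Hphi. apply (cmT_mult (fun t => phi (polar 1 t)) (fun t => / g (polar 1 t))).
- apply cmT_circle; auto.
- apply (cmT_inv (fun t => g (polar 1 t))), cmT_circle; auto.
Qed.

(** The test function is [phi / g]: on the circle [Cconj (phi / g) * |g|^2] is [g * Cconj phi], so
    the weight disappears and only the products [f g] and [h g] remain. *)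
Lemma szego_test (g phi : C -> C) (f h : R -> C) : good_weight g -> Lp g 2 f -> szego_proj g f h -> disc_algebra phi ->
  cI (fun t => f t * g (polar 1 t) * Cconj (phi (polar 1 t))) =
  cI (fun t => h t * g (polar 1 t) * Cconj (phi (polar 1 t))).
Proof.
intros Hok Lf [Hh Ho] Hphi. assert (Hok' := Hok). destruct Hok' as [Hg [_ Hae]].
apply (Lp_iff _ _ _ Hg) in Lf. destruct Lf as [cf If].
apply (Hp_iff _ _ Hg) in Hh. destruct Hh as [ch [Ih _]].
destruct (cintg_mult_g g f Hg cf If) as [If1 If2]. destruct (cintg_mult_g g h Hg ch Ih) as [Ih1 Ih2].
destruct (DA_bound_circle phi Hphi) as [B [HB0 HB]].
assert (cp : cmT (fun t => Cconj (phi (polar 1 t)))) by (apply (cmT_conj (fun t => phi (polar 1 t))), cmT_circle; auto).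
assert (HBc : forall t, inT t -> (Cmod (Cconj (phi (polar 1 t))) <= B)%R) by (intros; rewrite Cmod_conj; auto).
assert (J1 := cintg_bounded_mult _ _ B If1 cp HBc). assert (J2 := cintg_bounded_mult _ _ B Ih1 cp HBc).
cbn beta in J1, J2.
set (w := fun t => f t * g (polar 1 t) * Cconj (phi (polar 1 t)) +
   - (1) * (h t * g (polar 1 t) * Cconj (phi (polar 1 t)))).
assert (Iw : cintg w) by (apply cintg_add; auto; apply (cintg_scal (- (1)) _ J2)).
assert (cu : cmT (fun t => f t - h t)).
{ apply (cmT_ext (fun t => f t + - (1) * h t)); [intros; ring|]. apply cmT_add; auto.
  apply (cmT_mult (fun _ => - (1)) h); auto. apply cmT_const. }
assert (Z : cI w = 0).
{ apply (orth_iff g (fun t => f t - h t) (fun t => phi (polar 1 t) / g (polar 1 t)) w); auto.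
  - apply cmT_div_circle; auto.
  - revert Hae. apply aeT_imp. intros t _ Hn. rewrite RtoC_Cmod_sqr, Cconj_div by auto. unfold w.
    field. apply Cconj_neq_0; auto.
  - apply (intg_dom _ (fun t => B * (Cmod (f t * g (polar 1 t)) + Cmod (h t * g (polar 1 t))))%R).
    + apply mT_mul; apply mT_Cmod.
      * apply (cmT_mult (fun t => f t - h t) (fun t => g (polar 1 t))); auto. apply cmT_circle; auto.
      * apply (cmT_mult (fun t => phi (polar 1 t) / g (polar 1 t)) (fun t => g (polar 1 t))).
        -- apply cmT_div_circle; auto.
        -- apply cmT_circle; auto.
    + apply intg_scal, intg_add; apply intg_Cmod; auto.
    + intros t _. rewrite Rabs_pos_eq by (apply Rmult_le_pos; apply Cmod_ge_0).
      rewrite Rmult_comm. apply Rmult_le_compat; try apply Cmod_ge_0.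
      * eapply Rle_trans; [apply Cmod_div_mult|apply HB].
      * replace ((f t - h t) * g (polar 1 t)) with (f t * g (polar 1 t) + - (h t * g (polar 1 t))) by ring.
        eapply Rle_trans; [apply Cmod_triangle|]. rewrite Cmod_opp. lra.
  - apply Ho, Hp_div; auto. }
unfold w in Z. rewrite cI_add in Z by (auto; apply (cintg_scal (- (1)) _ J2)).
rewrite (cI_scal (- (1)) _ J2) in Z.
assert (Aux : forall A D : C, A + - (1) * D = 0 -> A = D).
{ intros A D E. replace A with (A + - (1) * D + D) by ring. rewrite E. ring. }
apply Aux. exact Z.
Qed.

Lemma Ccv_Ccont (f : C -> C) (u : nat -> C) (l : C) : Ccont f l -> Ccv u l -> Ccv (fun n => f (u n)) (f l).
Proof.
intros Hf [H1 H2].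
assert (G : forall e, (0 < e)%R -> exists N, forall n, (n >= N)%nat -> (Cmod (f (u n) - f l) < e)%R).
{ intros e He. destruct (Hf e He) as [d [Hd K]].
  destruct (H1 (d / 2)%R ltac:(lra)) as [n1 K1]. destruct (H2 (d / 2)%R ltac:(lra)) as [n2 K2].
  exists (Nat.max n1 n2). intros n Hn. apply K. unfold R_dist in *.
  assert (A1 := K1 n ltac:(lia)). assert (A2 := K2 n ltac:(lia)).
  eapply Rle_lt_trans; [apply Cmod_le_abs|]. simpl. unfold Rminus in *. lra. }
split; intros e He; destruct (G e He) as [N HN]; exists N; intros n Hn;
  (eapply Rle_lt_trans; [|apply (HN n Hn)]);
  [exact (re_le_Cmod (f (u n) - f l))|exact (im_le_Cmod (f (u n) - f l))].
Qed.

Lemma Ccv_rs_scal (z : C) : Ccv (fun n => RtoC (rs n) * z) z.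
Proof.
assert (E : Ccv (fun n => RtoC (rs n) * z) (1 * z)).
{ apply (Ccv_mult (fun n => RtoC (rs n)) (fun _ => z)); [|apply Ccv_const].
  split; simpl; [apply rs_cv|apply Un_cv_const]. }
rewrite Cmult_1_l in E. exact E.
Qed.

Lemma holo_mult (f g : C -> C) : holo_on_disc f -> holo_on_disc g -> holo_on_disc (fun z => f z * g z).
Proof.
rewrite !holo_Cder. intros Hf Hg z Hz'. destruct (Hf z Hz') as [l Hl]. destruct (Hg z Hz') as [m Hm].
eexists. apply Cder_mult; eauto.
Qed.

Lemma holo_dilate (f : C -> C) (r : R) : (0 < r < 1)%R -> holo_on_disc f ->
  (1 < / r)%R /\ forall w, (Cmod w < / r)%R -> exists l, Cder (fun w => f (RtoC r * w)) w l.
Proof.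
intros Hr Hf. split.
- rewrite <- Rinv_1. apply Rinv_lt_contravar; lra.
- intros w Hw. destruct (proj1 (holo_Cder f) Hf (RtoC r * w)) as [l Hl].
  + rewrite Cmod_mult, Cmod_R, Rabs_pos_eq by lra.
    apply (Rmult_lt_compat_l r) in Hw; [|lra]. rewrite Rinv_r in Hw; lra.
  + eexists. apply (Cder_comp f (fun w => RtoC r * w)); [|exact Hl].
    apply (Cder_mult (fun _ => RtoC r) (fun w => w)); [apply Cder_const|apply Cder_id].
Qed.

(** [szego_test] is applied to [/ (1 - Cconj z * w)], whose conjugate on the circle is the Cauchy
    kernel. The side of [f] is then the Cauchy transform of [f g]; on the side of [h], Cauchy's
    formula for dilations of [F g] and a limit give [F z * g z]. *)
Lemma szego_elim (g : C -> C) (f h : R -> C) : good_weight g -> Lp g 2 f -> szego_proj g f h ->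
  cmT h /\ intg (pdens g 2 h) /\ exists F M, Hardy_data g h F M /\
  forall z, (Cmod z < 1)%R -> F z * g z = Cz (fun t => f t * g (polar 1 t)) z.
Proof.
intros Hok Lf Hs. assert (Hok' := Hok). destruct Hok' as [Hg [_ Hae]].
assert (Hs' := Hs). destruct Hs' as [Hh _].
apply (Hp_iff _ _ Hg) in Hh. destruct Hh as [ch [Ih [F [M HF]]]].
split; auto. split; auto. exists F, M. split; auto. intros z Hz'.
assert (Pp := two_PI_pos).
assert (T := szego_test g (fun w => / (1 - Cconj z * w)) f h Hok Lf Hs (DA_kernel z Hz')). cbn beta in T.
assert (Ek : forall t, Cconj (/ (1 - Cconj z * polar 1 t)) = ker z t).
{ intros t. unfold ker. rewrite cauchy_kernel by auto. reflexivity. }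
rewrite (cI_ext _ (fun t => f t * g (polar 1 t) * ker z t)) in T by (intros; rewrite Ek; reflexivity).
rewrite (cI_ext (fun t => h t * _ * _) (fun t => h t * g (polar 1 t) * ker z t)) in T by (intros; rewrite Ek; reflexivity).
destruct (radial_weak_cv g F h M (/ (1 - Cmod z)) (fun _ => ker z) (ker z) Hg ch HF) as [_ CV].
{ intros _. apply cmT_ker; auto. }
{ apply cmT_ker; auto. }
{ intros _ t _. apply Cmod_ker_le; auto. }
{ apply aeT_all. intros t _. apply Ccv_const. }
assert (hFg : holo_on_disc (fun z => F z * g z)) by (apply holo_mult; [apply HF|apply Hg]).
(* Dilation by [rs n] makes [F g] holomorphic past the unit circle, as [cauchy_formula] requires. *)
assert (E : forall n, cI (fun t => F (polar (rs n) t) * g (polar (rs n) t) * ker z t) =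
   RtoC (2 * PI) * (F (RtoC (rs n) * z) * g (RtoC (rs n) * z))).
{ intros n. destruct (holo_dilate _ (rs n) (rs_in n) hFg) as [R1 D1].
  assert (Cf := cauchy_formula _ (/ rs n) z R1 D1 Hz'). rewrite <- Cf.
  destruct (cI_cInt (fun t => F (RtoC (rs n) * polar 1 t) * g (RtoC (rs n) * polar 1 t) * ker z t)) as [_ EE].
  - intros t. apply Rcont_mult; [|apply Rcont_ker; auto].
    apply (Rcont_circle (fun w => F (RtoC (rs n) * w) * g (RtoC (rs n) * w)) (/ rs n)); auto.
  - unfold ker in EE at 2. rewrite <- EE. apply cI_ext. intros t _.
    rewrite <- !polar_mult, Rmult_1_r. reflexivity. }
assert (CV2 : Ccv (fun n => RtoC (2 * PI) * (F (RtoC (rs n) * z) * g (RtoC (rs n) * z))) (RtoC (2 * PI) * (F z * g z))).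
{ apply Ccv_mult; [apply Ccv_const|].
  apply (Ccv_Ccont (fun z => F z * g z) (fun n => RtoC (rs n) * z) z); [|apply Ccv_rs_scal].
  destruct (proj1 (holo_Cder _) hFg z Hz') as [l Hl]. eapply Cder_cont; eauto. }
assert (EL : RtoC (2 * PI) * (F z * g z) = cI (fun t => h t * g (polar 1 t) * ker z t)).
{ eapply Ccv_unique; [exact CV2|]. destruct CV as [V1 V2].
  split; [revert V1|revert V2]; apply Un_cv_ext; intros n; rewrite E; reflexivity. }
unfold Cz. rewrite T, <- EL. rewrite Cmult_assoc, <- RtoC_mult, Rinv_l by lra. ring.
Qed.

(** The remainder [Cconj phi2 / g] is orthogonal to every [k] in the Hardy space: the pairing is the
    conjugate of the integral of [k g phi2], a limit of circular integrals of [F g phi2], and these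
    vanish by the mean value property since [phi2 0 = 0]. *)
Lemma szego_intro (g phi1 phi2 : C -> C) (f : R -> C) : good_weight g -> disc_algebra phi1 -> disc_algebra phi2 -> phi2 0 = 0 ->
  (forall t, f t = (phi1 (polar 1 t) + Cconj (phi2 (polar 1 t))) / g (polar 1 t)) ->
  szego_proj g f (fun t => phi1 (polar 1 t) / g (polar 1 t)).
Proof.
intros Hok H1 H2 P0 Ef. split; [apply Hp_div; auto|]. intros k Hk.
destruct Hok as [Hg [_ Hae]].
apply (Hp_iff _ _ Hg) in Hk. destruct Hk as [ck [Ik [F [M HF]]]].
destruct (DA_bound_circle phi2 H2) as [B [HB0 HB]].
destruct (cintg_mult_g g k Hg ck Ik) as [Ik1 Ik2].
assert (cp2 : cmT (fun t => phi2 (polar 1 t))) by (apply cmT_circle; auto).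
assert (Hb2 := H2). destruct Hb2 as [h2 [_ [B2 [B20 Hb2]]]].
destruct (radial_weak_cv g F k M B2 (fun n t => phi2 (polar (rs n) t)) (fun t => phi2 (polar 1 t)) Hg ck HF) as [Iz CV]; auto.
{ intros n. apply cmT_cont. intros t. apply DA_disc; auto. assert (R1 := rs_in n); lra. }
{ intros n t _. apply Hb2. assert (R1 := rs_in n). rewrite Cmod_polar; lra. }
{ apply aeT_all. intros t _. apply DA_rs; auto. }
assert (E : forall n, cI (fun t => F (polar (rs n) t) * g (polar (rs n) t) * phi2 (polar (rs n) t)) = 0).
{ intros n. assert (R1 := rs_in n).
  assert (hh : holo_on_disc (fun z => F z * g z * phi2 z)).
  { apply (holo_mult (fun z => F z * g z)); auto. apply holo_mult; [apply HF|apply Hg]. }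
  destruct (cI_cInt (fun t => F (polar (rs n) t) * g (polar (rs n) t) * phi2 (polar (rs n) t))) as [_ ->].
  - intros t. apply (DA_disc (fun z => F z * g z * phi2 z)); auto. lra.
  - rewrite (mean_value (fun z => F z * g z * phi2 z) 1 (rs n)); [rewrite P0; ring|apply holo_Cder; auto|lra]. }
assert (Z : cI (fun t => k t * g (polar 1 t) * phi2 (polar 1 t)) = 0).
{ eapply Ccv_unique; [exact CV|].
  assert (K := Ccv_const 0). destruct K as [K1 K2].
  split; [revert K1|revert K2]; apply Un_cv_ext; intros n; rewrite E; reflexivity. }
apply (orth_iff g _ k (fun t => Cconj (k t * g (polar 1 t) * phi2 (polar 1 t)))).
- destruct Iz as [z1 z2]. split; simpl; auto.
  apply (intg_ext (fun t => (-1) * snd (k t * g (polar 1 t) * phi2 (polar 1 t))%C)%R); [intros; simpl; ring|].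
  apply intg_scal; auto.
- apply (cmT_ext (fun t => Cconj (phi2 (polar 1 t)) * / g (polar 1 t))).
  + intros t _. rewrite Ef. unfold Cdiv. ring.
  + apply (cmT_mult (fun t => Cconj (phi2 (polar 1 t))) (fun t => / g (polar 1 t))).
    * apply (cmT_conj (fun t => phi2 (polar 1 t))); auto.
    * apply (cmT_inv (fun t => g (polar 1 t))), cmT_circle; auto.
- auto.
- auto.
- revert Hae. apply aeT_imp. intros t _ Hn. rewrite RtoC_Cmod_sqr, Ef, !Cconj_mult. field. auto.
- apply (intg_dom _ (fun t => B * Cmod (k t * g (polar 1 t)))%R).
  + apply mT_mul; apply mT_Cmod.
    * apply (cmT_ext (fun t => Cconj (phi2 (polar 1 t)) * / g (polar 1 t) * g (polar 1 t))).
      -- intros t _. rewrite Ef. unfold Cdiv. ring.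
      -- apply (cmT_mult (fun t => Cconj (phi2 (polar 1 t)) * / g (polar 1 t)) (fun t => g (polar 1 t)));
           [|apply cmT_circle; auto].
         apply (cmT_mult (fun t => Cconj (phi2 (polar 1 t))) (fun t => / g (polar 1 t))).
         ++ apply (cmT_conj (fun t => phi2 (polar 1 t))); auto.
         ++ apply (cmT_inv (fun t => g (polar 1 t))), cmT_circle; auto.
    * apply (cmT_mult k (fun t => g (polar 1 t))); auto. apply cmT_circle; auto.
  + apply intg_scal, intg_Cmod; auto.
  + intros t _. rewrite Rabs_pos_eq by (apply Rmult_le_pos; apply Cmod_ge_0).
    apply Rmult_le_compat_r; [apply Cmod_ge_0|].
    replace ((f t - phi1 (polar 1 t) / g (polar 1 t)) * g (polar 1 t)) with
      (Cconj (phi2 (polar 1 t)) / g (polar 1 t) * g (polar 1 t)) by (rewrite Ef; unfold Cdiv; ring).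
    eapply Rle_trans; [apply Cmod_div_mult|]. rewrite Cmod_conj. apply HB.
- rewrite (cI_conj _ Iz), Z. apply C_ext; simpl; ring.
Qed.

(** * Boundedness between the critical exponents *)

Lemma Cmod_dist (a b : C) : (Rabs (Cmod a - Cmod b) <= Cmod (a - b))%R.
Proof.
apply Rabs_le. assert (T1 := Cmod_triangle (a - b) b). assert (T2 := Cmod_triangle (b - a) a).
replace (a - b + b) with a in T1 by ring. replace (b - a + a) with b in T2 by ring.
rewrite (Cmod_sub_sym b) in T2. lra.
Qed.

Lemma W_cv (al t l : R) (x : nat -> R) : (0 < al)%R -> Un_cv x l -> Un_cv (fun n => W al (x n) t) (W al l t).
Proof.
intros Ha H. unfold W. apply pw_cv; auto; try (intros; apply Cmod_ge_0).
intros e He. destruct (H e He) as [N HN]. exists N. intros n Hn. unfold R_dist.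
eapply Rle_lt_trans; [apply Cmod_dist|].
replace (1 - polar (x n) t - (1 - polar l t)) with (polar l t - polar (x n) t) by ring.
rewrite Cmod_sub_sym. eapply Rle_lt_trans; [apply Cmod_polar_le|]. apply (HN n Hn).
Qed.

Lemma pw_plus (x s1 s2 : R) : (0 < x)%R -> pw x (s1 + s2) = (pw x s1 * pw x s2)%R.
Proof. intros Hx. rewrite !pw_exp by auto. rewrite <- exp_plus. f_equal. ring. Qed.

Lemma pw_pw (x s1 s2 : R) : (0 < x)%R -> pw (pw x s1) s2 = pw x (s1 * s2).
Proof. intros Hx. rewrite (pw_exp (pw x s1)) by (apply pw_pos; auto). rewrite !pw_exp, ln_exp by auto. f_equal. ring. Qed.

Lemma pw_1 (x : R) : (0 <= x)%R -> pw x 1 = x.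
Proof.
intros Hx. destruct (Rle_lt_or_eq_dec 0 x Hx) as [P|<-]; [|apply pw_0; lra].
rewrite pw_exp, Rmult_1_l, exp_ln; auto.
Qed.

Lemma pw_root (x p : R) : (0 <= x)%R -> (0 < p)%R -> pw (pw x (/ p)) p = x.
Proof.
intros Hx Hp. assert (Ip : (0 < / p)%R) by (apply Rinv_0_lt_compat; auto).
destruct (Rle_lt_or_eq_dec 0 x Hx) as [P|<-].
- rewrite pw_pw, Rinv_l, pw_1; lra.
- rewrite !pw_0; lra.
Qed.

Lemma fatou_lim (f : nat -> R -> R) (F : R -> R) (L : nat -> R) (l : R) : (forall n, intg (f n)) -> mT F ->
  (forall n t, inT t -> (0 <= f n t)%R) -> (forall t, inT t -> (0 <= F t)%R) ->
  aeT (fun t => Un_cv (fun n => f n t) (F t)) -> (forall n, (I (f n) <= L n)%R) -> Un_cv L l ->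
  intg F /\ (I F <= l)%R.
Proof.
intros If MF f0 F0 Hcv HL CL.
assert (G : forall e, (0 < e)%R -> intg F /\ (I F <= l + e)%R).
{ intros e He. destruct (CL e He) as [N HN].
  apply (fatou_le (fun n => f (n + N)%nat) F (l + e)%R); auto.
  - revert Hcv. apply aeT_imp. intros t _ H. intros d Hd. destruct (H d Hd) as [n0 Hn0].
    exists n0. intros n Hn. apply Hn0. lia.
  - intros n. eapply Rle_trans; [apply HL|].
    assert (K := HN (n + N)%nat ltac:(lia)). unfold R_dist in K. apply Rabs_def2 in K. lra. }
split; [apply (G 1%R); lra|]. apply Rnot_lt_le. intros Hlt.
destruct (G ((I F - l) / 2)%R ltac:(lra)) as [_ K]. lra.
Qed.

Definition modulus_W (a : R) (g : C -> C) : Prop :=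
  forall r t, (0 <= r <= 1)%R -> Cmod (g (polar r t)) = W a r t.

(** At a boundary zero of [g] the exponent [a (2 - q)] may have any sign, but both sides are 0: the
    left through [|g|^2], the right through [|f g|^q] with [q <> 0]. *)
Lemma pdens_W (a q : R) (g : C -> C) (f : R -> C) (t : R) : modulus_W a g -> (0 < a)%R -> (q <> 0)%R ->
  pdens g q f t = (pw (Cmod (f t * g (polar 1 t))) q * pw (Cmod (1 - polar 1 t)) (a * (2 - q)))%R.
Proof.
intros HW Ha Hq. unfold pdens. rewrite Cmod_mult, HW by lra. unfold W.
assert (P := Cmod_ge_0 (1 - polar 1 t)). set (x := Cmod (1 - polar 1 t)) in *.
destruct (Rle_lt_or_eq_dec 0 x P) as [Hp|<-].
- rewrite pw_mult by (auto; try apply Cmod_ge_0; apply pw_ge0).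
  rewrite pw_pw, Rmult_assoc by auto. f_equal.
  rewrite <- !pw_plus by auto. f_equal. ring.
- rewrite (pw_0 a) by lra. rewrite !Rmult_0_r, (pw_0 q) by auto. ring.
Qed.

Lemma pdens_W_circle (a q : R) (g : C -> C) (f : R -> C) (t : R) : modulus_W a g -> (0 < a)%R -> (q <> 0)%R ->
  pdens g q f t = (pw (Cmod (f t * g (polar 1 t))) q * W (a * (2 - q)) 1 t)%R.
Proof. apply pdens_W. Qed.

Lemma Ccv_projection (g : C -> C) (h : R -> C) (F : C -> C) (M : R) (u : R -> C) : disc_algebra g -> Hardy_data g h F M ->
  (forall z, (Cmod z < 1)%R -> F z * g z = Cz u z) ->
  aeT (fun t => Ccv (fun n => Cz u (polar (rs n) t)) (h t * g (polar 1 t))).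
Proof.
intros Hg [hF [_ cF]] E. revert cF. apply aeT_imp. intros t _ [L1 L2].
assert (K : Ccv (fun n => F (polar (rs n) t) * g (polar (rs n) t)) (h t * g (polar 1 t))).
{ apply Ccv_mult; [|apply DA_rs; auto]. split; [exact (left_lim_rs _ _ L1)|exact (left_lim_rs _ _ L2)]. }
destruct K as [K1 K2].
split; [revert K1|revert K2]; apply Un_cv_ext; intros n; rewrite E; auto;
  assert (R1 := rs_in n); rewrite Cmod_polar; lra.
Qed.

(** For a positive exponent the weights are bounded by [2^al] uniformly in the radius, so dominated
    convergence applies. *)
Lemma cv_weighted (q al : R) (f : R -> R) (x : nat -> R) : (0 < al)%R -> intg (fun t => pw (f t) q) ->
  (forall n, (0 <= x n <= 1)%R) -> Un_cv x 1 ->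
  intg (fun t => pw (f t) q * W al 1 t)%R /\
  Un_cv (fun n => I (fun t => pw (f t) q * W al (x n) t)%R) (I (fun t => pw (f t) q * W al 1 t)%R).
Proof.
intros Ha If Hx Cx.
apply (dct (fun n t => pw (f t) q * W al (x n) t)%R _ (fun t => pw 2 al * pw (f t) q)%R).
- intros n. apply mT_mul; [apply intg_mT; auto|apply mT_W, Hx].
- apply mT_mul; [apply intg_mT; auto|apply mT_W; lra].
- apply aeT_all. intros t _. apply CV_mult; [apply Un_cv_const|apply W_cv; auto].
- apply intg_scal; auto.
- intros n t _. destruct (W_le al (x n) t Ha (Hx n)).
  rewrite Rabs_pos_eq by (apply Rmult_le_pos; [apply pw_ge0|auto]).
  rewrite Rmult_comm. apply Rmult_le_compat_r; [apply pw_ge0|auto].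
Qed.

Lemma rs2_cv : Un_cv (fun n => rs n * rs n)%R 1.
Proof. rewrite <- (Rmult_1_l 1). apply CV_mult; apply rs_cv. Qed.

Lemma rs2_in (n : nat) : (0 <= rs n * rs n <= 1)%R.
Proof. assert (R1 := rs_in n). nra. Qed.

(** [cauchy_bound] passes to radius 1 by Fatou's lemma on the left, the radial limits of the
    transform of [f g] being [h g], and by [cv_weighted] on the right. *)
Lemma bounded_lt2 (a q : R) (g : C -> C) : good_weight g -> modulus_W a g -> (0 < a)%R -> (1 < q < 2)%R ->
  (a * (2 - q) < q - 1)%R -> szego_bounded g q.
Proof.
intros Hok HW Ha Hq Haq. set (al := (a * (2 - q))%R).
assert (Hal : (0 < al)%R) by (apply Rmult_lt_0_compat; lra).
destruct (cauchy_bound q al Hq (conj Hal Haq)) as [K [HK HB]].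
(* [szego_bounded] raises its constant to the power [q], hence the root. *)
exists (pw K (/ q)). split; [apply Rle_is_true, pw_ge0|].
intros f h Lf Lq Hs. assert (Hok' := Hok). destruct Hok' as [Hg [_ Hae]].
destruct (szego_elim g f h Hok Lf Hs) as [ch [Ih [F [M [HF EF]]]]].
apply (Lp_iff _ _ _ Hg) in Lf. destruct Lf as [cf If].
apply (Lp_iff _ _ _ Hg) in Lq. destruct Lq as [_ Iq].
destruct (cintg_mult_g g f Hg cf If) as [Iu Iu2].
set (u := fun t => f t * g (polar 1 t)) in *.
assert (Iuq : intg (fun t => pw (Cmod (u t)) q)).
{ apply intg_pw_of_sqr; auto; [lra|apply mT_Cmod, cintg_cmT; auto|intros; apply Cmod_ge_0]. }
destruct (cv_weighted q al (fun t => Cmod (u t)) (fun n => rs n * rs n)%R Hal Iuq rs2_in rs2_cv) as [IL CL].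
assert (Eh : forall t, pdens g q h t = (pw (Cmod (h t * g (polar 1 t))) q * W al 1 t)%R)
  by (intros; apply pdens_W_circle; auto; lra).
assert (Ef : forall t, pdens g q f t = (pw (Cmod (u t)) q * W al 1 t)%R)
  by (intros; apply pdens_W_circle; auto; lra).
assert (chg : cmT (fun t => h t * g (polar 1 t))) by (apply (cmT_mult h (fun t => g (polar 1 t))); auto; apply cmT_circle; auto).
destruct (fatou_lim (fun n t => pw (Cmod (Cz u (polar (rs n) t))) q * W al (rs n) t)%R
  (fun t => pw (Cmod (h t * g (polar 1 t))) q * W al 1 t)%R
  (fun n => K * I (fun t => pw (Cmod (u t)) q * W al (rs n * rs n) t))%R
  (K * I (fun t => pw (Cmod (u t)) q * W al 1 t))%R) as [IX BX].
- intros n. apply intg_normW; auto; [lra|]. assert (R1 := rs_in n); lra.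
- apply mT_mul; [apply mT_pw, mT_Cmod; auto|apply mT_W; lra].
- intros; apply Rmult_le_pos; apply pw_ge0.
- intros; apply Rmult_le_pos; apply pw_ge0.
- generalize (Ccv_projection g h F M u Hg HF EF). apply aeT_imp. intros t _ H.
  apply CV_mult; [|apply W_cv; auto; apply rs_cv].
  apply pw_cv; [lra|intros; apply Cmod_ge_0|apply Cmod_ge_0|].
  apply (Ccv_Cmod (fun n => Cz u (polar (rs n) t))); auto.
- intros n. apply (HB u Iu Iuq (rs n)). assert (R1 := rs_in n); lra.
- apply CV_mult; [apply Un_cv_const|exact CL].
- assert (Ihq : intg (pdens g q h)) by (revert IX; apply intg_ext; intros; rewrite Eh; auto).
  apply (pnorm_leP g q f h (pw K (/ q)) Iq Ihq). rewrite pw_root by lra.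
  rewrite (I_ext _ _ (fun t _ => Eh t)), (I_ext _ _ (fun t _ => Ef t)). exact BX.
Qed.

(** The real part of [(u - v) * Cconj v] is at most [(|u|^2 - |v|^2) / 2], and its integral is 0
    because [h] itself is an admissible test function. *)
Lemma bounded_2 (g : C -> C) : good_weight g -> szego_bounded g 2.
Proof.
intros Hok. exists 1%R. split; [apply Rle_is_true; exact Rle_0_1|].
intros f h Lf _ Hs. assert (Hok' := Hok). destruct Hok' as [Hg [_ Hae]].
assert (Hs' := Hs). destruct Hs' as [Hh Ho].
destruct (szego_elim g f h Hok Lf Hs) as [ch [Ih _]].
apply (Lp_iff _ _ _ Hg) in Lf. destruct Lf as [cf If].
apply (pnorm_leP g 2 f h 1 If Ih). rewrite pw_exp, ln_1, Rmult_0_r, exp_0, Rmult_1_l by lra.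
destruct (cintg_mult_g g f Hg cf If) as [If1 If2]. destruct (cintg_mult_g g h Hg ch Ih) as [Ih1 Ih2].
set (u := fun t => f t * g (polar 1 t)) in *. set (v := fun t => h t * g (polar 1 t)) in *.
set (w := fun t => (u t + - (1) * v t) * Cconj (v t)).
assert (cu := cintg_cmT _ If1). assert (cv := cintg_cmT _ Ih1).
assert (I2 : intg (fun t => Cmod (u t) * Cmod (u t) + 2 * (Cmod (v t) * Cmod (v t)))%R).
{ apply intg_add; auto. apply intg_scal; auto. }
assert (Pw : forall t, ((Cmod (u t) + Cmod (v t)) * Cmod (v t) <= Cmod (u t) * Cmod (u t) + 2 * (Cmod (v t) * Cmod (v t)))%R).
{ intros t. assert (Q := Rle_0_sqr (Cmod (u t) - Cmod (v t))). unfold Rsqr in Q.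
  assert (Q2 := Rle_0_sqr (Cmod (u t))). assert (Q3 := Rle_0_sqr (Cmod (v t))). unfold Rsqr in Q2, Q3. lra. }
assert (cuv : cmT (fun t => u t + - (1) * v t)).
{ apply cmT_add; auto. apply (cmT_mult (fun _ => - (1)) v); auto. apply cmT_const. }
assert (Buv : forall t, (Cmod (u t + - (1) * v t) <= Cmod (u t) + Cmod (v t))%R).
{ intros t. eapply Rle_trans; [apply Cmod_triangle|]. rewrite Cmod_mult, Cmod_m1. lra. }
assert (Iw : cintg w).
{ apply (cintg_dom _ (fun t => Cmod (u t) * Cmod (u t) + 2 * (Cmod (v t) * Cmod (v t)))%R); auto.
  - apply (cmT_mult (fun t => u t + - (1) * v t) (fun t => Cconj (v t))); auto. apply cmT_conj; auto.
  - intros t _. unfold w. rewrite Cmod_mult, Cmod_conj. eapply Rle_trans; [|apply Pw].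
    apply Rmult_le_compat_r; [apply Cmod_ge_0|auto]. }
assert (cfh : cmT (fun t => f t - h t)).
{ apply (cmT_ext (fun t => f t + - (1) * h t)); [intros; ring|]. apply cmT_add; auto.
  apply (cmT_mult (fun _ => - (1)) h); auto. apply cmT_const. }
assert (Eg : forall t, (f t - h t) * g (polar 1 t) = u t + - (1) * v t) by (intros; unfold u, v; ring).
assert (Z : cI w = 0).
{ apply (orth_iff g (fun t => f t - h t) h w); auto.
  - apply aeT_all. intros t _. rewrite RtoC_Cmod_sqr. unfold w, v, u. rewrite !Cconj_mult. ring.
  - apply (intg_dom _ (fun t => Cmod (u t) * Cmod (u t) + 2 * (Cmod (v t) * Cmod (v t)))%R); auto.
    + apply mT_mul; apply mT_Cmod.
      * apply (cmT_ext (fun t => u t + - (1) * v t)); auto.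
      * exact cv.
    + intros t _. rewrite Rabs_pos_eq by (apply Rmult_le_pos; apply Cmod_ge_0). rewrite Eg.
      eapply Rle_trans; [|apply Pw]. apply Rmult_le_compat_r; [apply Cmod_ge_0|apply Buv]. }
assert (Z1 : I (fun t => fst (w t)) = 0%R) by exact (f_equal fst Z).
assert (Iff : intg (fun t => Cmod (u t) * Cmod (u t) - Cmod (v t) * Cmod (v t))%R) by (apply intg_sub; auto).
assert (L : (I (fun t => fst (w t)) <= I (fun t => / 2 * (Cmod (u t) * Cmod (u t) - Cmod (v t) * Cmod (v t))))%R).
{ apply I_le; [apply Iw|apply intg_scal; auto|]. intros t _. unfold w.
  assert (E : forall z : C, (Cmod z * Cmod z = fst z * fst z + snd z * snd z)%R).
  { intros z. assert (K := f_equal fst (RtoC_Cmod_sqr z)). simpl in K. simpl. lra. }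
  rewrite !E. destruct (u t) as [u1 u2], (v t) as [v1 v2]. simpl.
  assert (Q1 := Rle_0_sqr (u1 - v1)). assert (Q2 := Rle_0_sqr (u2 - v2)). unfold Rsqr in Q1, Q2. lra. }
rewrite Z1, I_scal, I_sub in L by auto.
rewrite (I_ext (pdens g 2 h) (fun t => Cmod (v t) * Cmod (v t))%R) by (intros; apply pdens2).
rewrite (I_ext (pdens g 2 f) (fun t => Cmod (u t) * Cmod (u t))%R) by (intros; apply pdens2).
lra.
Qed.

(** If [x <= eps * y^(q - 1)], the first term suffices. Otherwise [y] is at most
    [(x / eps)^(p - 1)], because [(q - 1) * (p - 1) = 1], and the second term suffices with
    [c = (1 / eps)^(p - 1)]. *)
Lemma young_eps (p q eps : R) : (1 < q)%R -> (1 < p)%R -> ((p - 1) * (q - 1) = 1)%R -> (0 < eps)%R ->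
  exists c, (0 <= c)%R /\ forall x y, (0 <= x)%R -> (0 <= y)%R -> (x * y <= eps * pw y q + c * pw x p)%R.
Proof.
intros Hq Hp Hpq He. exists (pw (/ eps) (p - 1)). split; [apply pw_ge0|]. intros x y Hx Hy.
assert (Ie : (0 < / eps)%R) by (apply Rinv_0_lt_compat; auto).
assert (P1 := pw_ge0 y q). assert (P2 := pw_ge0 x p). assert (P3 := pw_ge0 (/ eps) (p - 1)).
destruct (Rle_lt_or_eq_dec 0 y Hy) as [Py|<-].
2:{ rewrite Rmult_0_r. apply Rplus_le_le_0_compat; apply Rmult_le_pos; lra. }
assert (Ey : (pw y q = pw y (q - 1) * y)%R).
{ rewrite <- (pw_1 y) at 3 by lra. rewrite <- pw_plus by auto. f_equal. ring. }
assert (P4 := pw_pos y (q - 1) Py).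
destruct (Rle_dec x (eps * pw y (q - 1))) as [L|N].
- apply Rle_trans with (eps * pw y q)%R.
  + rewrite Ey, <- Rmult_assoc. apply Rmult_le_compat_r; auto.
  + assert (0 <= pw (/ eps) (p - 1) * pw x p)%R by (apply Rmult_le_pos; auto). lra.
- assert (Px : (0 < x)%R) by (assert (0 < eps * pw y (q - 1))%R by (apply Rmult_lt_0_compat; auto); lra).
  assert (Yb : (y <= pw (/ eps * x) (p - 1))%R).
  { assert (E : pw (pw y (q - 1)) (p - 1) = y).
    { rewrite pw_pw by auto. replace ((q - 1) * (p - 1))%R with 1%R by lra. apply pw_1; lra. }
    rewrite <- E at 1. apply pw_mono; [lra| |lra]. apply (Rmult_le_reg_l eps); auto.
    rewrite <- Rmult_assoc, Rinv_r, Rmult_1_l by lra. lra. }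
  rewrite pw_mult in Yb by lra.
  assert (Ex : (pw x p = x * pw x (p - 1))%R).
  { rewrite <- (pw_1 x) at 2 by lra. rewrite <- pw_plus by auto. f_equal. ring. }
  apply (Rmult_le_compat_l x) in Yb; [|lra].
  assert (0 <= eps * pw y q)%R by (apply Rmult_le_pos; lra). rewrite Ex. lra.
Qed.

Lemma intg_mult_bounded (a b : R -> R) (B : R) : intg a -> mT b -> (forall t, inT t -> (Rabs (b t) <= B)%R) ->
  intg (fun t => a t * b t)%R.
Proof.
intros Ha Mb Hb. apply (intg_dom _ (fun t => B * Rabs (a t))%R).
- apply mT_mul; auto. apply intg_mT; auto.
- apply intg_scal, intg_abs; auto.
- intros t Ht. rewrite Rabs_mult, Rmult_comm. apply Rmult_le_compat_r; [apply Rabs_pos|auto].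
Qed.

Definition kc (r x : R) : C := / (1 - polar r x).

Lemma ker_kc (r s t : R) : ker (polar r t) s = kc r (t - s).
Proof. unfold ker, kc. rewrite polar_conj. reflexivity. Qed.

Lemma kc_conj (r x : R) : (0 <= r < 1)%R -> Cconj (kc r (- x)) = kc r x.
Proof.
intros Hr. unfold kc. rewrite polar_neg.
replace (1 - Cconj (polar r x)) with (Cconj (1 - polar r x)) by (apply C_ext; simpl; ring).
assert (N : 1 - polar r x <> 0) by (apply one_minus_neq_0; rewrite Cmod_polar; lra).
rewrite <- Cinv_conj by auto. apply C_ext; simpl; ring.
Qed.

Lemma kc_Rcont (r x : R) : (0 <= r < 1)%R -> Rcont (kc r) x.
Proof.
intros Hr. unfold kc. apply (Ccont_circle (fun w => / (1 - w))); [lra|].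
apply (Ccont_comp Cinv (fun w => 1 - w)).
- apply (Ccont_plus (fun _ => 1) (fun w => - w)); [apply Ccont_const|].
  apply (Ccont_ext_loc (fun w => - (1) * w) _ _ 1); [lra|intros; ring|].
  apply Ccont_mult; [apply Ccont_const|apply Ccont_id].
- apply Ccont_inv, one_minus_neq_0. rewrite Cmod_polar; lra.
Qed.

Lemma kc_bound (r x : R) : (0 <= r < 1)%R -> (Cmod (kc r x) <= / (1 - r))%R.
Proof.
intros Hr. unfold kc.
assert (N : 1 - polar r x <> 0) by (apply one_minus_neq_0; rewrite Cmod_polar; lra).
rewrite Cmod_inv by auto. apply Rinv_le_contravar; [lra|].
assert (K := Cmod_one_minus (polar r x)). rewrite Cmod_polar in K by lra. exact K.
Qed.

(** At a fixed radius the kernel is a function [kc] of [t - s] with [Cconj (kc (- x)) = kc x], so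
    the transform is self-adjoint. The real part consists of four products of real components, each
    an instance of [fubini_conv]. *)
Lemma cauchy_adjoint (u psi : R -> C) (B r : R) : cintg u -> cmT psi -> (forall t, inT t -> (Cmod (psi t) <= B)%R) ->
  (0 <= r < 1)%R ->
  fst (cI (fun t => Cz u (polar r t) * psi t)) =
  fst (cI (fun s => u s * Cconj (Cz (fun t => Cconj (psi t)) (polar r s)))).
Proof.
intros [u1 u2] [m1 m2] HB Hr.
set (k1 := fun x => fst (kc r x)). set (k2 := fun x => snd (kc r x)).
assert (C1 : forall x, continuity_pt k1 x) by (intros; apply Rcont_continuity_fst, kc_Rcont; auto).
assert (C2 : forall x, continuity_pt k2 x) by (intros; apply Rcont_continuity_snd, kc_Rcont; auto).
assert (D1 : forall x, (Rabs (k1 x) <= / (1 - r))%R).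
{ intros x. eapply Rle_trans; [exact (re_le_Cmod (kc r x))|apply kc_bound; auto]. }
assert (D2 : forall x, (Rabs (k2 x) <= / (1 - r))%R).
{ intros x. eapply Rle_trans; [exact (im_le_Cmod (kc r x))|apply kc_bound; auto]. }
assert (B1 : forall t, inT t -> (Rabs (fst (psi t)) <= B)%R).
{ intros t Ht. eapply Rle_trans; [exact (re_le_Cmod (psi t))|auto]. }
assert (B2 : forall t, inT t -> (Rabs (snd (psi t)) <= B)%R).
{ intros t Ht. eapply Rle_trans; [exact (im_le_Cmod (psi t))|auto]. }
assert (p1 : intg (fun t => fst (psi t))) by (apply (intg_dom _ (fun _ => B)); auto; apply intg_const).
assert (p2 : intg (fun t => snd (psi t))) by (apply (intg_dom _ (fun _ => B)); auto; apply intg_const).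
destruct (fubini_conv _ _ k1 _ _ u1 m1 B1 C1 D1) as [L11 R11 E11].
destruct (fubini_conv _ _ k2 _ _ u2 m1 B1 C2 D2) as [L21 R21 E21].
destruct (fubini_conv _ _ k2 _ _ u1 m2 B2 C2 D2) as [L12 R12 E12].
destruct (fubini_conv _ _ k1 _ _ u2 m2 B2 C1 D1) as [L22 R22 E22].
set (l11 := fun x => _) in L11. set (l21 := fun x => _) in L21.
set (l12 := fun x => _) in L12. set (l22 := fun x => _) in L22.
set (r11 := fun x => _) in R11. set (r21 := fun x => _) in R21.
set (r12 := fun x => _) in R12. set (r22 := fun x => _) in R22.
change (I l11 = I r11) in E11. change (I l21 = I r21) in E21.
change (I l12 = I r12) in E12. change (I l22 = I r22) in E22.
assert (Ia : forall a k t, intg a -> (forall x, continuity_pt k x) -> (forall x, (Rabs (k x) <= / (1 - r))%R) ->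
  intg (fun s => a s * k (t - s))%R).
{ intros a k t Ha Ck Bk. apply (intg_mult_bounded a (fun s => k (t - s)%R) (/ (1 - r))); auto.
  apply mT_cont. intros s. apply (continuity_pt_comp (fun s => (t - s)%R) k); [reg|auto]. }
assert (Ib : forall a k s, intg a -> (forall x, continuity_pt k x) -> (forall x, (Rabs (k x) <= / (1 - r))%R) ->
  intg (fun t => a t * k (t - s))%R).
{ intros a k s Ha Ck Bk. apply (intg_mult_bounded a (fun t => k (t - s)%R) (/ (1 - r))); auto.
  apply mT_cont. intros t. apply (continuity_pt_comp (fun t => (t - s)%R) k); [reg|auto]. }
set (c := (/ (2 * PI))%R).
assert (EL : forall t, fst (Cz u (polar r t) * psi t) = (c * ((l11 t - l21 t) - (l12 t + l22 t)))%R).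
{ intros t.
  assert (F : Cz u (polar r t) = RtoC c * (I (fun s => fst (u s) * k1 (t - s)) - I (fun s => snd (u s) * k2 (t - s)),
     I (fun s => fst (u s) * k2 (t - s)) + I (fun s => snd (u s) * k1 (t - s)))%R).
  { unfold Cz. fold c. f_equal. unfold cI.
    rewrite <- (I_sub (fun s => fst (u s) * k1 (t - s))%R (fun s => snd (u s) * k2 (t - s))%R) by (apply Ia; auto).
    rewrite <- (I_add (fun s => fst (u s) * k2 (t - s))%R (fun s => snd (u s) * k1 (t - s))%R) by (apply Ia; auto).
    apply C_ext; cbn [fst snd]; apply I_ext; intros s _; rewrite ker_kc; reflexivity. }
  rewrite F. unfold l11, l21, l12, l22. simpl. ring. }
assert (ER : forall s, fst (u s * Cconj (Cz (fun t => Cconj (psi t)) (polar r s))) =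
   (c * ((r11 s - r21 s) - (r12 s + r22 s)))%R).
{ intros s.
  assert (F : Cconj (Cz (fun t => Cconj (psi t)) (polar r s)) =
     RtoC c * (I (fun t => fst (psi t) * k1 (t - s)) - I (fun t => snd (psi t) * k2 (t - s)),
     I (fun t => fst (psi t) * k2 (t - s)) + I (fun t => snd (psi t) * k1 (t - s)))%R).
  { unfold Cz. fold c. rewrite Cconj_mult.
    assert (Ic : cintg (fun t => Cconj (psi t) * ker (polar r s) t)).
    { apply cintg_ker; [|rewrite Cmod_polar; lra]. split; simpl; auto.
      apply (intg_ext (fun t => (-1) * snd (psi t))%R); [intros; ring|apply intg_scal; auto]. }
    rewrite <- (cI_conj _ Ic).
    replace (Cconj (RtoC c)) with (RtoC c) by (apply C_ext; simpl; ring). f_equal.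
    rewrite (cI_ext _ (fun t => psi t * kc r (t - s))).
    - unfold cI.
      rewrite <- (I_sub (fun t => fst (psi t) * k1 (t - s))%R (fun t => snd (psi t) * k2 (t - s))%R) by (apply Ib; auto).
      rewrite <- (I_add (fun t => fst (psi t) * k2 (t - s))%R (fun t => snd (psi t) * k1 (t - s))%R) by (apply Ib; auto).
      reflexivity.
    - intros t _. rewrite ker_kc, Cconj_mult. replace (s - t)%R with (- (t - s))%R by ring.
      rewrite kc_conj by auto. f_equal. apply C_ext; simpl; ring. }
  rewrite F. unfold r11, r21, r12, r22. simpl. ring. }
unfold cI. cbn [fst].
rewrite (I_ext _ _ (fun t _ => EL t)), (I_ext _ _ (fun t _ => ER t)).
rewrite !I_scal by (apply intg_sub; [apply intg_sub|apply intg_add]; auto).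
rewrite (I_sub (fun t => l11 t - l21 t)%R (fun t => l12 t + l22 t)%R) by (try apply intg_sub; try apply intg_add; auto).
rewrite (I_sub (fun t => r11 t - r21 t)%R (fun t => r12 t + r22 t)%R) by (try apply intg_sub; try apply intg_add; auto).
rewrite (I_sub l11 l21), (I_add l12 l22), (I_sub r11 r21), (I_add r12 r22) by auto.
rewrite E11, E21, E12, E22. reflexivity.
Qed.

(** [|1 - e^(it)| <= |1 - r e^(it)| + (1 - r) <= 2 |1 - r e^(it)|]. This replaces the weight on the
    unit circle by the one at radius [r]. *)
Lemma W_1_le (al r t : R) : (0 < al)%R -> (0 <= r <= 1)%R -> (W al 1 t <= pw 2 al * W al r t)%R.
Proof.
intros Ha Hr. unfold W. rewrite <- pw_mult by (try apply Cmod_ge_0; lra).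
apply pw_mono; auto; [apply Cmod_ge_0|].
replace (1 - polar 1 t) with ((1 - polar r t) + (polar r t - polar 1 t)) by ring.
eapply Rle_trans; [apply Cmod_triangle|].
assert (K1 := Cmod_polar_le r 1 t). assert (K2 := Cmod_one_minus (polar r t)).
rewrite Cmod_polar in K2 by lra. rewrite Rabs_left1 in K1 by lra. lra.
Qed.

(* Duality against [k = h min(|h|,N)^(p-1) / |h|], whose [q]-th power is at most [h conj k]. *)
Lemma bounded_gt2 (a p q : R) (g : C -> C) : good_weight g -> modulus_W a g -> (0 < a)%R -> (1 < q < 2)%R -> (2 < p)%R ->
  ((p - 1) * (q - 1) = 1)%R -> (a * (2 - q) < q - 1)%R -> szego_bounded g p.
Proof.
intros Hok HW Ha Hq Hp Hpq Haq. set (al := (a * (2 - q))%R).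
assert (Hal : (0 < al)%R) by (apply Rmult_lt_0_compat; lra).
destruct (cauchy_bound q al Hq (conj Hal Haq)) as [K [HK HB]].
assert (P2 := pw_pos 2 al ltac:(lra)).
set (D := (pw 2 al * K)%R). assert (HD : (0 <= D)%R) by (apply Rmult_le_pos; lra).
(* Small enough that at most half of the integral to be estimated reappears on the right, where it
   is absorbed. *)
set (eps := (/ (2 * (D + 1)))%R). assert (He : (0 < eps)%R) by (apply Rinv_0_lt_compat; lra).
assert (HeD : (eps * D <= / 2)%R).
{ unfold eps. apply (Rmult_le_reg_l (2 * (D + 1))); [lra|].
  replace (2 * (D + 1) * (/ (2 * (D + 1)) * D))%R with D by (field; lra). lra. }
destruct (young_eps p q eps ltac:(lra) ltac:(lra) Hpq He) as [c [Hc Y]].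
exists (pw (2 * c) (/ p)). split; [apply Rle_is_true, pw_ge0|].
intros f h Lf Lq Hs. assert (Hok' := Hok). destruct Hok' as [Hg [_ Hae]].
destruct (szego_elim g f h Hok Lf Hs) as [ch [Ih [F [M [HF EF]]]]].
apply (Lp_iff _ _ _ Hg) in Lf. destruct Lf as [cf If].
apply (Lp_iff _ _ _ Hg) in Lq. destruct Lq as [_ Ip].
destruct (cintg_mult_g g f Hg cf If) as [Iu Iu2].
destruct (cintg_mult_g g h Hg ch Ih) as [Iv Iv2].
destruct (DA_bound_circle g Hg) as [Bg [HBg0 HBg]].
set (u := fun t => f t * g (polar 1 t)) in *.
assert (cg := cmT_circle g Hg).
set (G := fun t => (Cmod (g (polar 1 t)) * Cmod (g (polar 1 t)))%R).
assert (G0 : forall t, (0 <= G t)%R) by (intros; apply Rle_0_sqr).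
(* The weighted pairing of [h] with [k]; as [N] grows it increases to [|h|^p |g|^2]. *)
set (Xn := fun N t => (Cmod (h t) * pw (Rmin (Cmod (h t)) N) (p - 1) * G t)%R).
assert (MX : forall N, mT (Xn N)).
{ intros N. apply mT_mul; [apply mT_mul|apply mT_mul; apply mT_Cmod_circle; auto].
  - apply mT_Cmod; auto.
  - apply mT_pw, mT_min; [apply mT_Cmod; auto|apply mT_const]. }
assert (X0 : forall N t, (0 <= Xn N t)%R).
{ intros. apply Rmult_le_pos; auto. apply Rmult_le_pos; [apply Cmod_ge_0|apply pw_ge0]. }
assert (Main : forall N, (0 < N)%R -> intg (Xn N) /\ (I (Xn N) <= 2 * c * I (pdens g p f))%R).
{ intros N HN.
  set (m := fun t => Rmin (Cmod (h t)) N).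
  assert (m0 : forall t, (0 <= m t)%R) by (intros; apply Rmin_glb; [apply Cmod_ge_0|lra]).
  assert (mN : forall t, (m t <= N)%R) by (intros; apply Rmin_r).
  assert (mh : forall t, (m t <= Cmod (h t))%R) by (intros; apply Rmin_l).
  (* Where [h] vanishes, so does [k]; elsewhere the factor makes [|k| = m^(p - 1)]. *)
  set (k := fun t => h t * RtoC (pw (m t) (p - 1) * / Cmod (h t))).
  assert (ck : cmT k).
  { apply (cmT_mult h (fun t => RtoC (pw (m t) (p - 1) * / Cmod (h t)))); auto.
    apply cmT_RtoC, mT_mul; [apply mT_pw, mT_min; [apply mT_Cmod; auto|apply mT_const]|apply mT_inv, mT_Cmod; auto]. }
  assert (Ck : forall t, Cmod (k t) = pw (m t) (p - 1)).
  { intros t. unfold k. rewrite Cmod_mult, Cmod_R.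
    destruct (Rle_lt_or_eq_dec 0 (Cmod (h t)) (Cmod_ge_0 _)) as [L|E].
    - rewrite Rabs_pos_eq by (apply Rmult_le_pos; [apply pw_ge0|apply Rlt_le, Rinv_0_lt_compat; auto]).
      field. lra.
    - assert (m t = 0)%R by (apply Rle_antisym; [rewrite E; apply mh|apply m0]).
      rewrite H, <- E, pw_0 by lra. ring. }
  assert (Bk : forall t, (Cmod (k t) <= pw N (p - 1))%R) by (intros; rewrite Ck; apply pw_mono; auto; lra).
  set (v := fun t => k t * g (polar 1 t)).
  set (psi := fun t => Cconj (v t)).
  assert (cv : cmT v) by (apply (cmT_mult k (fun t => g (polar 1 t))); auto).
  assert (cpsi : cmT psi) by (apply (cmT_conj v); auto).
  assert (Bv : forall t, (Cmod (v t) <= pw N (p - 1) * Bg)%R).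
  { intros t. unfold v. rewrite Cmod_mult. apply Rmult_le_compat; try apply Cmod_ge_0; auto. }
  assert (Bpsi : forall t, inT t -> (Cmod (psi t) <= pw N (p - 1) * Bg)%R).
  { intros t _. unfold psi. rewrite Cmod_conj. auto. }
  assert (Ivv : cintg v).
  { apply (cintg_dom _ (fun _ => pw N (p - 1) * Bg)%R); auto. apply intg_const. }
  assert (Ivq : intg (fun t => pw (Cmod (v t)) q)).
  { apply intg_pw_of_sqr; auto; [lra|apply mT_Cmod; auto|intros; apply Cmod_ge_0|].
    apply (intg_mult_bounded (fun t => Cmod (v t)) (fun t => Cmod (v t)) (pw N (p - 1) * Bg));
      [apply intg_Cmod; auto|apply mT_Cmod; auto|].
    intros t _. rewrite Rabs_pos_eq by apply Cmod_ge_0. auto. }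
  assert (EX : forall t, h t * g (polar 1 t) * psi t = RtoC (Xn N t)).
  { intros t. unfold psi, v, k. rewrite !Cconj_mult.
    replace (Cconj (RtoC (pw (m t) (p - 1) * / Cmod (h t)))) with (RtoC (pw (m t) (p - 1) * / Cmod (h t)))
      by (apply C_ext; simpl; ring).
    replace (h t * g (polar 1 t) * (Cconj (h t) * RtoC (pw (m t) (p - 1) * / Cmod (h t)) * Cconj (g (polar 1 t))))
      with ((h t * Cconj (h t)) * (g (polar 1 t) * Cconj (g (polar 1 t))) * RtoC (pw (m t) (p - 1) * / Cmod (h t))) by ring.
    rewrite <- !RtoC_Cmod_sqr, <- !RtoC_mult. f_equal. unfold Xn, G. fold (m t).
    destruct (Rle_lt_or_eq_dec 0 (Cmod (h t)) (Cmod_ge_0 _)) as [L|E].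
    - field. lra.
    - rewrite <- E. ring. }
  destruct (radial_weak_cv g F h M (pw N (p - 1) * Bg) (fun _ => psi) psi Hg ch HF) as [IXc CV]; auto.
  { apply aeT_all. intros t _. apply Ccv_const. }
  assert (IX : intg (Xn N)).
  { destruct IXc as [z _]. revert z. apply intg_ext. intros t _. rewrite EX. reflexivity. }
  split; auto.
  assert (R0 : forall n, (0 <= rs n < 1)%R) by (intros n; assert (R1 := rs_in n); lra).
  assert (Z1 : forall n t, (Cmod (polar (rs n) t) < 1)%R) by (intros; rewrite Cmod_polar; apply R0).
  destruct CV as [CV _].
  assert (Ecz : forall z, Cz (fun t => Cconj (psi t)) z = Cz v z).
  { intros z. unfold Cz. rewrite (cI_ext _ (fun t => v t * ker z t)); [reflexivity|].
    intros t _. unfold psi. replace (Cconj (Cconj (v t))) with (v t) by (apply C_ext; simpl; ring). reflexivity. }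
  (* The adjoint moves the transform from [u] to the bounded function [v], to which the estimate
     with exponent [q < 2] applies. *)
  assert (CV1 : Un_cv (fun n => fst (cI (fun s => (u s * Cconj (Cz v (polar (rs n) s)))%C))) (I (Xn N))).
  { assert (EI : fst (cI (fun t => h t * g (polar 1 t) * psi t)) = I (Xn N)).
    { unfold cI. cbn [fst]. apply I_ext. intros t _. rewrite EX. reflexivity. }
    rewrite EI in CV. revert CV. apply Un_cv_ext. intros n.
    rewrite (cI_ext _ (fun t => Cz u (polar (rs n) t) * psi t)).
    - rewrite (cauchy_adjoint u psi _ (rs n) Iu cpsi Bpsi (R0 n)).
      rewrite (cI_ext _ (fun s => (u s * Cconj (Cz v (polar (rs n) s)))%C)); [reflexivity|].
      intros s _. rewrite Ecz. reflexivity.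
    - intros t _. rewrite EF by apply Z1. reflexivity. }
  destruct (cv_weighted q al (fun t => Cmod (v t)) (fun n => rs n * rs n)%R Hal Ivq rs2_in rs2_cv) as [IL CL].
  (* Since [(p - 1) q = p], one has [|k|^q = m * m^(p - 1) <= |h| * m^(p - 1)]. *)
  assert (IVX : (I (fun t => pw (Cmod (v t)) q * W al 1 t) <= I (Xn N))%R).
  { apply I_le; auto. intros t _.
    assert (EP := pdens_W_circle a q g k t HW Ha ltac:(lra)).
    change (pdens g q k t = (pw (Cmod (v t)) q * W al 1 t)%R) in EP.
    rewrite <- EP. unfold pdens, Xn. fold (G t).
    apply Rmult_le_compat_r; auto. rewrite Ck. fold (m t).
    destruct (Rle_lt_or_eq_dec 0 (m t) (m0 t)) as [L|E].
    - rewrite pw_pw by auto. replace ((p - 1) * q)%R with (1 + (p - 1))%R by lra.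
      rewrite pw_plus, pw_1 by lra. apply Rmult_le_compat_r; [apply pw_ge0|apply mh].
    - rewrite <- E, !pw_0 by lra. lra. }
  assert (Bn : forall n, (fst (cI (fun s => (u s * Cconj (Cz v (polar (rs n) s)))%C)) <=
     eps * (pw 2 al * (K * I (fun t => pw (Cmod (v t)) q * W al (rs n * rs n) t))) + c * I (pdens g p f))%R).
  { intros n.
    assert (Rc : forall t, Rcont (fun t => Cz v (polar (rs n) t)) t).
    { intros t. apply (Rcont_disc (Cz v)); auto. intros z Hz'. apply Cder_Cz; auto. }
    assert (In := intg_normW q al (rs n) v ltac:(lra) Hal (R0 n) Ivv).
    apply Rle_trans with (I (fun t => eps * (pw 2 al * (pw (Cmod (Cz v (polar (rs n) t))) q * W al (rs n) t)) + c * pdens g p f t))%R.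
    - apply (I_le (fun s => fst (u s * Cconj (Cz v (polar (rs n) s)))%C)).
      + destruct (I_RInt (fun t => Cmod (Cz v (polar (rs n) t)))) as [J _].
        { intros t. apply Rcont_continuity_Cmod; auto. }
        assert (Ic : cintg (fun s => (u s * Cconj (Cz v (polar (rs n) s)))%C)).
        { apply (cintg_bounded_mult u (fun s => Cconj (Cz v (polar (rs n) s))) (/ (2 * PI) * (2 * I (fun t => / (1 - rs n) * Cmod (v t))))%R Iu).
          - apply (cmT_conj (fun s => Cz v (polar (rs n) s))), cmT_cont; auto.
          - intros t _. rewrite Cmod_conj. unfold Cz. rewrite Cmod_mult, Cmod_R.
            assert (Ipp : (0 < / (2 * PI))%R) by (apply Rinv_0_lt_compat, two_PI_pos).
            rewrite Rabs_pos_eq by lra. apply Rmult_le_compat_l; [lra|].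
            apply cI_bound; [apply cintg_ker; auto|apply intg_scal, intg_Cmod; auto|].
            intros s _. rewrite Cmod_mult, Rmult_comm. apply Rmult_le_compat_r; [apply Cmod_ge_0|].
            assert (KK := Cmod_ker_le (polar (rs n) t) s (Z1 n t)). rewrite Cmod_polar in KK by apply R0. exact KK. }
        apply Ic.
      + apply intg_add; apply intg_scal; auto. apply intg_scal; auto.
      + intros t _. set (z := Cz v (polar (rs n) t)).
        eapply Rle_trans; [apply Rle_abs|]. eapply Rle_trans; [exact (re_le_Cmod (u t * Cconj z))|].
        rewrite Cmod_mult, Cmod_conj. unfold u. rewrite Cmod_mult.
        assert (Q0 : (0 <= eps * (pw 2 al * (pw (Cmod z) q * W al (rs n) t)) + c * pdens g p f t)%R).
        { apply Rplus_le_le_0_compat; [|apply Rmult_le_pos; [auto|apply pdens_ge0]].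
          repeat apply Rmult_le_pos; try apply pw_ge0; lra. }
        destruct (Rle_lt_or_eq_dec 0 (Cmod (g (polar 1 t))) (Cmod_ge_0 _)) as [L|E].
        2:{ rewrite <- E, Rmult_0_r, Rmult_0_l. exact Q0. }
        (* Young's inequality is used before multiplying by [|g|^2], with the transform divided by
           [|g|], so that its two terms become the densities with exponents [q] and [p]. *)
        assert (Yt := Y (Cmod (f t)) (Cmod z / Cmod (g (polar 1 t)))%R (Cmod_ge_0 _)
          ltac:(apply Rmult_le_pos; [apply Cmod_ge_0|apply Rlt_le, Rinv_0_lt_compat; auto])).
        apply (Rmult_le_compat_r (G t)) in Yt; [|auto].
        apply Rle_trans with (Cmod (f t) * (Cmod z / Cmod (g (polar 1 t))) * G t)%R.
        * right. unfold G. field. lra.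
        * eapply Rle_trans; [exact Yt|]. rewrite Rmult_plus_distr_r.
          apply Rplus_le_compat; [|right; unfold pdens, G; ring].
          rewrite !Rmult_assoc. apply Rmult_le_compat_l; [lra|].
          assert (EW : (pw (Cmod z / Cmod (g (polar 1 t))) q * G t = pw (Cmod z) q * W al 1 t)%R).
          { assert (EP := pdens_W_circle a q g (fun _ => z / g (polar 1 t)) t HW Ha ltac:(lra)).
            unfold pdens in EP. rewrite Cmod_div in EP by (apply Cmod_gt_0; auto). fold (G t) in EP. rewrite EP.
            do 3 f_equal. field. apply Cmod_gt_0; auto. }
          rewrite EW. replace (pw 2 al * (pw (Cmod z) q * W al (rs n) t))%R with
            (pw (Cmod z) q * (pw 2 al * W al (rs n) t))%R by ring.
          apply Rmult_le_compat_l; [apply pw_ge0|]. apply W_1_le; auto. assert (R1 := R0 n); lra.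
    - rewrite I_add by (apply intg_scal; auto; apply intg_scal; auto).
      rewrite !I_scal by (auto; apply intg_scal; auto).
      apply Rplus_le_compat_r. apply Rmult_le_compat_l; [lra|]. apply Rmult_le_compat_l; [lra|].
      apply (HB v Ivv Ivq (rs n) (R0 n)). }
  assert (Lim : (I (Xn N) <= eps * (pw 2 al * (K * I (fun t => pw (Cmod (v t)) q * W al 1 t))) + c * I (pdens g p f))%R).
  { assert (CR : Un_cv (fun n => eps * (pw 2 al * (K * I (fun t => pw (Cmod (v t)) q * W al (rs n * rs n) t))) + c * I (pdens g p f))%R
       (eps * (pw 2 al * (K * I (fun t => pw (Cmod (v t)) q * W al 1 t))) + c * I (pdens g p f))%R).
    { apply (CV_plus (fun n => eps * (pw 2 al * (K * I (fun t => pw (Cmod (v t)) q * W al (rs n * rs n) t))))%R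
        (fun _ => c * I (pdens g p f))%R); [|apply Un_cv_const].
      apply CV_mult; [apply Un_cv_const|]. apply CV_mult; [apply Un_cv_const|]. apply CV_mult; [apply Un_cv_const|exact CL]. }
    exact (Rle_cv_lim Bn CV1 CR). }
  assert (IX0 : (0 <= I (Xn N))%R) by (apply I_ge0; auto).
  (* Subtracting this half from both sides is legitimate because the truncation at [N] makes [Xn N]
     integrable. *)
  assert (S1 : (eps * (pw 2 al * (K * I (fun t => pw (Cmod (v t)) q * W al 1 t))) <= / 2 * I (Xn N))%R).
  { replace (eps * (pw 2 al * (K * I (fun t => pw (Cmod (v t)) q * W al 1 t))))%R with
      (eps * D * I (fun t => pw (Cmod (v t)) q * W al 1 t))%R by (unfold D; ring).
    apply Rmult_le_compat; auto.
    - apply Rmult_le_pos; lra.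
    - apply I_ge0. intros; apply Rmult_le_pos; apply pw_ge0. }
  lra. }
destruct (fatou_le (fun n => Xn (INR n + 1)%R) (pdens g p h) (2 * c * I (pdens g p f))%R) as [Ihp Bhp].
- intros n. apply Main. generalize (pos_INR n); lra.
- apply mT_mul; [apply mT_pw, mT_Cmod; auto|apply mT_mul; apply mT_Cmod_circle; auto].
- intros; apply X0.
- intros; apply pdens_ge0.
- apply aeT_all. intros t _. intros e Hee.
  destruct (INR_unbounded (Cmod (h t))) as [N HN]. exists N. intros n Hn.
  assert (E : Xn (INR n + 1)%R t = pdens g p h t).
  { unfold Xn, pdens. fold (G t). f_equal. apply le_INR in Hn. rewrite Rmin_left by lra.
    assert (P := Cmod_ge_0 (h t)). destruct (Rle_lt_or_eq_dec 0 _ P) as [L|E].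
    - rewrite <- (pw_1 (Cmod (h t))) at 1 by lra. rewrite <- pw_plus by auto. f_equal. ring.
    - rewrite <- E, !pw_0 by lra. ring. }
  rewrite E. unfold R_dist. rewrite Rminus_diag, Rabs_R0; auto.
- intros n. apply Main. generalize (pos_INR n); lra.
- apply (pnorm_leP g p f h (pw (2 * c) (/ p)) Ip Ihp). rewrite pw_root by lra. exact Bhp.
Qed.

(** * Unboundedness at and beyond the critical exponents *)

Lemma I_log_kernel (c d : R) : (0 < d)%R ->
  intg (fun t => c * (t / (t * t + d * d)))%R /\
  I (fun t => c * (t / (t * t + d * d)))%R =
    (c * (/ 2 * ln (2 * PI * (2 * PI) + d * d) - / 2 * ln (0 * 0 + d * d)))%R.
Proof.
intros Hd.
assert (P : forall t, (0 < t * t + d * d)%R) by (intros; nra).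
assert (Cc : forall t, continuity_pt (fun t => t / (t * t + d * d))%R t).
{ intros t. apply (continuity_pt_div (fun t => t) (fun t => t * t + d * d)%R); [reg|reg|]. apply Rgt_not_eq, P. }
destruct (I_RInt (fun t => t / (t * t + d * d))%R Cc) as [I1 E1].
split; [apply intg_scal; auto|]. rewrite I_scal, E1 by auto. f_equal.
apply is_RInt_unique.
apply (is_RInt_derive (fun t => / 2 * ln (t * t + d * d))%R).
- intros t _. auto_derive; [apply P|]. field. apply Rgt_not_eq, P.
- intros t _. apply continuity_pt_filterlim, Cc.
Qed.

(** The function [t / (t^2 + d^2)] lies below [1 / t], and its integral is at least [- ln d], which
    exceeds any bound as [d] tends to 0. *)
Lemma not_intg_inv (c : R) (F : R -> R) : (0 < c)%R -> intg F -> (forall t, inT t -> (0 <= F t)%R) ->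
  (forall t, (0 < t < 2 * PI)%R -> (c / t <= F t)%R) -> False.
Proof.
intros Hc IF F0 HF.
(* With this [d] the lower bound [- c * ln d] equals [I F + c]. *)
set (d := exp (- (I F / c) - 1)). assert (Hd : (0 < d)%R) by apply exp_pos.
destruct (I_log_kernel c d Hd) as [Ik Ek]. set (k := fun t => (c * (t / (t * t + d * d)))%R) in *.
assert (Le : (I k <= I F)%R).
(* The lower bound for [F] is known only in the open interval, so [F] is changed on a null set
   before comparing. *)
{ rewrite (I_ae_ext F (fun t => Rmax (F t) (k t))).
  - apply I_le; auto.
    + apply (intg_dom _ (fun t => Rabs (F t) + Rabs (k t))%R).
      * apply mT_max; apply intg_mT; auto.
      * apply intg_add; apply intg_abs; auto.
      * intros t _. assert (P1 := Rabs_pos (F t)). assert (P2 := Rabs_pos (k t)).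
        unfold Rmax. destruct (Rle_dec (F t) (k t)); lra.
    + intros t _. apply Rmax_r.
  - apply intg_mT; auto.
  - apply mT_max; apply intg_mT; auto.
  - generalize aeT_interior. apply aeT_imp. intros t _ Ht. symmetry. apply Rmax_left.
    eapply Rle_trans; [|apply HF; auto]. unfold k, Rdiv. apply Rmult_le_compat_l; [lra|].
    apply (Rmult_le_reg_r (t * t + d * d)); [nra|].
    rewrite Rmult_assoc, Rinv_l, Rmult_1_r by nra.
    apply (Rmult_le_reg_l t); [lra|]. rewrite <- Rmult_assoc, Rinv_r, Rmult_1_l by lra. nra. }
rewrite Ek in Le.
assert (L1 : (0 <= ln (2 * PI * (2 * PI) + d * d))%R).
{ rewrite <- ln_1. apply Rcomplements.ln_le; [lra|]. assert (K := PI2_1). nra. }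
rewrite Rmult_0_l, Rplus_0_l, ln_mult in Le by auto.
assert (L2 : ln d = (- (I F / c) - 1)%R) by (unfold d; apply ln_exp).
rewrite L2 in Le.
assert (Q : (c * (/ 2 * ln (2 * PI * (2 * PI) + d * d) - / 2 * (- (I F / c) - 1 + (- (I F / c) - 1))) =
  c * (/ 2 * ln (2 * PI * (2 * PI) + d * d)) + I F + c)%R) by (field; lra).
rewrite Q in Le.
assert (0 <= c * (/ 2 * ln (2 * PI * (2 * PI) + d * d)))%R by (repeat apply Rmult_le_pos; lra). lra.
Qed.

(** The chord has length [2 sin (t / 2)]. *)
Lemma chord_le (t : R) : (0 < t < 2 * PI)%R -> (0 < Cmod (1 - polar 1 t) <= t)%R.
Proof.
intros Ht.
assert (S1 : (0 < sin (t / 2))%R) by (apply sin_gt_0; lra).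
assert (S2 : (sin (t / 2) < t / 2)%R) by (apply sin_lt_x; lra).
assert (Ct : cos t = (1 - 2 * sin (t / 2) * sin (t / 2))%R).
{ replace t with (2 * (t / 2))%R at 1 by field. apply cos_2a_sin. }
assert (E : (Cmod (1 - polar 1 t) * Cmod (1 - polar 1 t) = 4 * (sin (t / 2) * sin (t / 2)))%R).
{ assert (K := f_equal fst (RtoC_Cmod_sqr (1 - polar 1 t))).
  change ((Cmod (1 - polar 1 t) * Cmod (1 - polar 1 t))%R =
    ((1 - 1 * cos t) * (1 - 1 * cos t) - (0 - 1 * sin t) * - (0 - 1 * sin t))%R) in K.
  rewrite K. assert (SC := sin2_cos2 t). unfold Rsqr in SC. rewrite Ct in *. nra. }
assert (P := Cmod_ge_0 (1 - polar 1 t)). set (x := Cmod (1 - polar 1 t)) in *.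
split; [|nra]. destruct (Rle_lt_or_eq_dec 0 x P) as [L|E0]; auto. rewrite <- E0 in E. nra.
Qed.

(** The exponent is split as [(1 - s) + (-1)]: the first power is smallest when the distance is 2,
    and the second is at least [1 / t] by [chord_le]. *)
Lemma pw_neg_lower (t s : R) : (0 < t < 2 * PI)%R -> (1 <= s)%R ->
  (pw 2 (1 - s) / t <= pw (Cmod (1 - polar 1 t)) (- s))%R.
Proof.
intros Ht Hs. destruct (chord_le t Ht) as [X1 X2]. set (x := Cmod (1 - polar 1 t)) in *.
assert (X3 : (x <= 2)%R).
{ unfold x. eapply Rle_trans; [apply Cmod_one_minus_le|]. rewrite Cmod_polar; lra. }
replace (- s)%R with ((1 - s) + (-1))%R by ring. rewrite pw_plus by auto.
unfold Rdiv. apply Rmult_le_compat.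
- apply pw_ge0.
- apply Rlt_le, Rinv_0_lt_compat; lra.
- rewrite !pw_exp by lra. assert (L : (ln x <= ln 2)%R) by (apply Rcomplements.ln_le; auto).
  destruct (Rle_lt_or_eq_dec ((1 - s) * ln 2) ((1 - s) * ln x)) as [Lt|Eq]; [nra| |rewrite Eq; lra].
  apply Rlt_le, exp_increasing; auto.
- rewrite pw_exp by auto. replace (-1 * ln x)%R with (- ln x)%R by ring.
  rewrite exp_Ropp, exp_ln by auto. apply Rinv_le_contravar; auto.
Qed.

Lemma DA_const (c : C) : disc_algebra (fun _ => c).
Proof.
apply (DA_of_Cder _ (Cmod c)).
- intros w _. exists 0. apply Cder_const.
- apply Cmod_ge_0.
- intros; lra.
Qed.

Lemma DA_sub_const (g : C -> C) (c : C) : disc_algebra g -> disc_algebra (fun w => g w - c).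
Proof.
intros [H1 [H2 [B [HB H3]]]]. split; [|split].
- apply holo_Cder. intros z Hz'. destruct (proj1 (holo_Cder g) H1 z Hz') as [l Hl].
  eexists. apply (Cder_plus g (fun _ => - c)); [exact Hl|apply Cder_const].
- intros z Hz' e He. destruct (H2 z Hz' e He) as [d [Hd K]]. exists d; split; auto. intros w Hw Hwz.
  change (Cmod (g w - c - (g z - c)) < e)%R.
  replace (g w - c - (g z - c)) with (g w - g z) by ring. apply K; auto.
- exists (B + Cmod c)%R. split; [generalize (Cmod_ge_0 c); lra|]. intros w Hw.
  eapply Rle_trans; [apply Cmod_triangle|]. rewrite Cmod_opp. apply Rplus_le_compat_r; auto.
Qed.

Lemma pdens_bounded_intg (g : C -> C) (p B : R) (f : R -> C) : disc_algebra g -> cmT f -> (0 <= B)%R ->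
  (forall t, (pdens g p f t <= B)%R) -> intg (pdens g p f).
Proof.
intros Hg cf HB Hb. apply (intg_dom _ (fun _ => B)).
- apply mT_mul; [apply mT_pw, mT_Cmod; auto|apply mT_mul; apply mT_Cmod_circle; auto].
- apply intg_const.
- intros t _. rewrite Rabs_pos_eq by apply pdens_ge0. auto.
Qed.

(** The density of [1 / g] is [|1 - z|^(- a (p - 2))], with exponent at most -1, whereas the test
    function has modulus 1 wherever [g] does not vanish. *)
Lemma unbounded_large (a p : R) (g : C -> C) : good_weight g -> modulus_W a g -> (0 < a)%R -> g 0 = 1 -> (2 < p)%R ->
  (1 <= a * (p - 2))%R -> ~ szego_bounded g p.
Proof.
intros Hok HW Ha Hg0 Hp Hs [K [_ HK]]. assert (Hok' := Hok). destruct Hok' as [Hg [Hnz Hae]].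
(* This is [Cconj g / g], written with [g - 1], which vanishes at 0, so that [szego_intro] yields
   the projection [1 / g]. *)
set (f := fun t => (1 + Cconj (g (polar 1 t) - 1)) / g (polar 1 t)).
set (h := fun t => 1 / g (polar 1 t)).
assert (Sz : szego_proj g f h).
{ apply (szego_intro g (fun _ => 1) (fun w => g w - 1) f Hok).
  - apply DA_const.
  - apply DA_sub_const; auto.
  - rewrite Hg0. ring.
  - intros t. reflexivity. }
destruct (DA_bound_circle g Hg) as [B [HB0 HB]].
assert (cg := cmT_circle g Hg).
assert (Ef : forall t, f t = Cconj (g (polar 1 t)) / g (polar 1 t)).
{ intros t. unfold f. f_equal. apply C_ext; simpl; ring. }
assert (cf : cmT f).
{ apply (cmT_ext (fun t => Cconj (g (polar 1 t)) * / g (polar 1 t))).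
  - intros t _. rewrite Ef. reflexivity.
  - apply (cmT_mult (fun t => Cconj (g (polar 1 t))) (fun t => / g (polar 1 t))).
    + apply (cmT_conj (fun t => g (polar 1 t))); auto.
    + apply (cmT_inv (fun t => g (polar 1 t))); auto. }
assert (Bf : forall q t, (0 < q)%R -> (pdens g q f t <= B * B)%R).
{ intros q t Hq. unfold pdens.
  assert (Pg := Cmod_ge_0 (g (polar 1 t))). assert (Bt := HB t).
  destruct (Ceq_dec (g (polar 1 t)) 0) as [E|N].
  - rewrite E, Cmod_0, Rmult_0_l, Rmult_0_r. apply Rmult_le_pos; auto.
  - rewrite Ef, Cmod_div, Cmod_conj by auto. unfold Rdiv. rewrite Rinv_r by (apply Rgt_not_eq, Cmod_gt_0; auto).
    rewrite pw_exp, ln_1, Rmult_0_r, exp_0, Rmult_1_l by lra. apply Rmult_le_compat; auto. }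
assert (BB : (0 <= B * B)%R) by (apply Rmult_le_pos; auto).
assert (L2 : Lp g 2 f).
{ apply (Lp_iff _ _ _ Hg). split; auto. apply (pdens_bounded_intg g 2 (B * B)); auto. intros; apply Bf; lra. }
assert (Ip : intg (pdens g p f)).
{ apply (pdens_bounded_intg g p (B * B)); auto. intros; apply Bf; lra. }
assert (Lp' : Lp g p f) by (apply (Lp_iff _ _ _ Hg); auto).
assert (ch : cmT h) by (apply (cmT_mult (fun _ => 1) (fun t => / g (polar 1 t))); [apply cmT_const|apply (cmT_inv (fun t => g (polar 1 t))); auto]).
assert (Ih := pnorm_le_intg g p f h K (mT_Cmod_circle g Hg) ch Ip (HK f h L2 Lp' Sz)).
apply (not_intg_inv (pw 2 (1 - a * (p - 2))) (pdens g p h)); auto.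
- apply pw_pos; lra.
- intros; apply pdens_ge0.
- intros t Ht. eapply Rle_trans; [apply (pw_neg_lower t (a * (p - 2)) Ht Hs)|].
  destruct (chord_le t Ht) as [X1 X2].
  rewrite (pdens_W a p g h t HW Ha) by lra.
  assert (Ng : g (polar 1 t) <> 0).
  { apply Cmod_gt_0. rewrite HW by lra. apply pw_pos; auto. }
  unfold h. replace (1 / g (polar 1 t) * g (polar 1 t)) with (RtoC 1) by (field; auto).
  rewrite Cmod_1. rewrite (pw_exp 1), ln_1, Rmult_0_r, exp_0, Rmult_1_l by lra.
  right. f_equal. ring.
Qed.

(** Inside the disc the mean of the modulus of [(1 - z)^al] is at least its value 1 at the centre;
    the radius then tends to 1. *)
Lemma I_W_ge (al : R) : (0 < al)%R -> (2 * PI <= I (W al 1))%R.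
Proof.
intros Ha.
assert (G : forall r, (0 <= r < 1)%R -> (2 * PI <= I (W al r))%R).
{ intros r Hr.
  assert (Cf : forall t, Rcont (fun t => cpow (1 - polar r t) al) t).
  { intros t. apply (Rcont_disc (fun w => cpow (1 - w) al)); auto. apply Cder_Phi. }
  destruct (cI_cInt _ Cf) as [[I1 _] E].
  rewrite (mean_value (fun w => cpow (1 - w) al) 1 r) in E by (try lra; apply Cder_Phi).
  apply (f_equal fst) in E.
  change (I (fun t => fst (cpow (1 - polar r t) al)) =
    (2 * PI * fst (cpow (1 - RtoC 0) al) - 0 * snd (cpow (1 - RtoC 0) al))%R) in E.
  rewrite re_cpow in E. replace (1 - 0) with (RtoC 1) in E by ring.
  rewrite Cmod_1, carg_RtoC, ln_1, !Rmult_0_r, exp_0, cos_0, Rmult_0_l, Rmult_1_r, Rminus_0_r, Rmult_1_r in E.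
  rewrite <- E. apply I_le; auto.
  - apply intg_cont. intros; apply W_cont; auto.
  - intros t _. rewrite W_Cmod by auto. eapply Rle_trans; [apply Rle_abs|].
    exact (re_le_Cmod (cpow (1 - polar r t) al)). }
destruct (cv_weighted 1 al (fun _ => 1%R) rs Ha) as [_ CV].
- apply intg_const.
- intros n. assert (R1 := rs_in n). lra.
- apply rs_cv.
- rewrite (I_ext _ (W al 1)) in CV by (intros; rewrite pw_1 by lra; ring).
  refine (Rle_cv_lim _ (Un_cv_const (2 * PI)) CV). intros n.
  rewrite (I_ext _ (W al (rs n))) by (intros; rewrite pw_1 by lra; ring).
  apply G. assert (R1 := rs_in n). lra.
Qed.

Lemma pw_mono0 (x y s : R) : (0 < x)%R -> (x <= y)%R -> (0 <= s)%R -> (pw x s <= pw y s)%R.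
Proof.
intros Hx Hxy Hs. destruct (Rle_lt_or_eq_dec 0 s Hs) as [P|<-]; [apply pw_mono; lra|].
rewrite !pw_exp, !Rmult_0_l by lra. lra.
Qed.

Lemma kap_eq (r t : R) : (0 <= r < 1)%R -> kap r t = ((1 - r * r) / (Cmod (1 - polar r t) * Cmod (1 - polar r t)))%R.
Proof.
intros Hr. replace t with (t - 0)%R at 1 by ring. rewrite <- (pois_kap r 0 t).
rewrite pois_eq by (rewrite Cmod_polar; lra). rewrite Cmod_polar by lra.
rewrite polar_conj, Rminus_0_r. reflexivity.
Qed.

(* The test functions [P_r / g] with [P_r] the Poisson kernel; their projections are
   [1 / (g (1 - r z))]. *)
Lemma unbounded_small (a p : R) (g : C -> C) : good_weight g -> modulus_W a g -> (0 < a)%R -> (1 <= p < 2)%R ->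
  (p - 1 <= a * (2 - p))%R -> ~ szego_bounded g p.
Proof.
intros Hok HW Ha Hp Hs [K [_ HK]]. assert (Hok' := Hok). destruct Hok' as [Hg [Hnz Hae]].
set (al := (a * (2 - p))%R) in *. assert (Hal : (0 < al)%R) by (apply Rmult_lt_0_compat; lra).
(* [k1 r - 1] vanishes at 0, and adding its conjugate to [k1 r] gives the Poisson kernel, the
   decomposition that [szego_intro] expects. *)
set (k1 := fun (r : R) (w : C) => / (1 - Cconj (RtoC r) * w)).
set (f := fun r t => (k1 r (polar 1 t) + Cconj (k1 r (polar 1 t) - 1)) / g (polar 1 t)).
set (h := fun r t => k1 r (polar 1 t) / g (polar 1 t)).
assert (Dk : forall r, (0 <= r < 1)%R -> disc_algebra (k1 r)).
{ intros r Hr. apply DA_kernel. rewrite Cmod_R, Rabs_pos_eq; lra. }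
assert (Ek : forall r t, k1 r (polar 1 t) = / (1 - polar r t)).
{ intros r t. unfold k1. do 2 f_equal. apply C_ext; simpl; ring. }
assert (Sz : forall r, (0 <= r < 1)%R -> szego_proj g (f r) (h r)).
{ intros r Hr. apply (szego_intro g (k1 r) (fun w => k1 r w - 1) (f r) Hok).
  - apply Dk; auto.
  - apply DA_sub_const; auto.
  - unfold k1. replace (1 - Cconj (RtoC r) * 0) with (RtoC 1) by ring. apply C_ext; simpl; field.
  - intros t. reflexivity. }
set (x := fun t => Cmod (1 - polar 1 t)).
assert (gx : forall t, Cmod (g (polar 1 t)) = pw (x t) a) by (intros; apply HW; lra).
assert (x0 : forall t, (0 <= x t <= 2)%R).
{ intros t. split; [apply Cmod_ge_0|]. eapply Rle_trans; [apply Cmod_one_minus_le|]. rewrite Cmod_polar; lra. }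
assert (Ekap : forall r t, k1 r (polar 1 t) + Cconj (k1 r (polar 1 t) - 1) = RtoC (kap r t)).
{ intros r t. rewrite Ek. unfold kap. apply C_ext; simpl; ring. }
assert (Dens : forall (q : R) (u : C) (t : R), (0 < q)%R -> (0 < a * (2 - q))%R ->
   pdens g q (fun _ => u / g (polar 1 t)) t = (pw (Cmod u) q * pw (x t) (a * (2 - q)))%R).
{ intros q u t Hq Hq2. rewrite (pdens_W a q g _ t HW Ha) by lra. fold (x t).
  destruct (Rle_lt_or_eq_dec 0 (x t) (proj1 (x0 t))) as [L|E].
  - do 3 f_equal. field. apply Cmod_gt_0. rewrite gx. apply pw_pos; auto.
  - rewrite <- E, (pw_0 (a * (2 - q))) by lra. ring. }
assert (Df : forall r t, pdens g p (f r) t = (pw (Rabs (kap r t)) p * pw (x t) al)%R).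
{ intros r t. rewrite <- Cmod_R, <- Ekap. apply (Dens p _ t); fold al; lra. }
assert (Dh : forall r t, pdens g p (h r) t = (pw (Cmod (/ (1 - polar r t))) p * pw (x t) al)%R).
{ intros r t. rewrite <- Ek. apply (Dens p _ t); fold al; lra. }
assert (cf : forall r, (0 <= r < 1)%R -> cmT (f r)).
{ intros r Hr. apply (cmT_mult (fun t => k1 r (polar 1 t) + Cconj (k1 r (polar 1 t) - 1)) (fun t => / g (polar 1 t))).
  - apply cmT_add; [apply cmT_circle, Dk; auto|].
    apply (cmT_conj (fun t => k1 r (polar 1 t) - 1)), (cmT_circle (fun w => k1 r w - 1)), DA_sub_const, Dk; auto.
  - apply (cmT_inv (fun t => g (polar 1 t))), cmT_circle; auto. }
assert (ch : forall r, (0 <= r < 1)%R -> cmT (h r)) by (intros; apply cmT_div_circle; auto).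
assert (If : forall r, (0 <= r < 1)%R -> intg (pdens g p (f r))).
{ intros r Hr. apply (pdens_bounded_intg g p (pw (2 / (1 - r) + 1) p * pw 2 al)); auto.
  - apply Rmult_le_pos; apply pw_ge0.
  - intros t. rewrite Df. apply Rmult_le_compat; try apply pw_ge0.
    + apply pw_mono; [apply Rabs_pos|apply kap_bound; auto|lra].
    + apply pw_mono; auto; apply x0. }
assert (L2 : forall r, (0 <= r < 1)%R -> Lp g 2 (f r)).
{ intros r Hr. apply (Lp_iff _ _ _ Hg). split; auto.
  set (B := (2 / (1 - r) + 1)%R).
  apply (pdens_bounded_intg g 2 (B * B)); auto; [apply Rle_0_sqr|].
  intros t. rewrite pdens2.
  assert (Q : (Cmod (f r t * g (polar 1 t)) <= B)%R).
  { unfold f. eapply Rle_trans; [apply Cmod_div_mult|]. rewrite Ekap, Cmod_R. apply kap_bound; auto. }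
  apply Rmult_le_compat; auto; apply Cmod_ge_0. }
assert (Main : forall r, (0 <= r < 1)%R ->
  intg (pdens g p (h r)) /\ (I (pdens g p (h r)) <= pw K p * I (pdens g p (f r)))%R).
{ intros r Hr. assert (Lq : Lp g p (f r)) by (apply (Lp_iff _ _ _ Hg); auto).
  assert (H := HK (f r) (h r) (L2 r Hr) Lq (Sz r Hr)).
  assert (Ih := pnorm_le_intg g p (f r) (h r) K (mT_Cmod_circle g Hg) (ch r Hr) (If r Hr) H).
  split; auto. apply (pnorm_leP g p (f r) (h r) K (If r Hr) Ih); auto. }
(* The excess over the critical exponent. If [ep > 0], the norms of the test functions tend to 0
   while those of the projections stay away from 0. If [ep = 0], the former stay bounded, and the
   limit of the latter densities is not integrable. *)
set (ep := (al - (p - 1))%R). assert (Hep : (0 <= ep)%R) by (unfold ep; lra).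
assert (Kp : forall r t, (0 <= r < 1)%R -> (0 < kap r t)%R).
{ intros r t Hr. replace t with (t - 0)%R by ring. rewrite <- pois_kap. apply pois_pos. rewrite Cmod_polar; lra. }
(* Rests on [kap * x <= 4]: with [y = |1 - r e^(it)|], the kernel is at most [2 / y], as
   [1 - r <= y], and [x <= 2 y]. *)
assert (Ub : forall r t, (0 <= r < 1)%R -> (0 < x t)%R ->
  (pdens g p (f r) t <= pw 4 (p - 1) * (kap r t * pw (x t) ep))%R).
{ intros r t Hr Hx. rewrite Df, Rabs_pos_eq by (apply Rlt_le, Kp; auto). assert (P := Kp r t Hr).
  replace (pw (kap r t) p) with (kap r t * pw (kap r t) (p - 1))%R.
  2:{ rewrite <- (pw_1 (kap r t)) at 1 by lra. rewrite <- pw_plus by auto. f_equal. ring. }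
  replace (pw (x t) al) with (pw (x t) (p - 1) * pw (x t) ep)%R.
  2:{ rewrite <- pw_plus by auto. f_equal. unfold ep; ring. }
  replace (kap r t * pw (kap r t) (p - 1) * (pw (x t) (p - 1) * pw (x t) ep))%R with
    (pw (kap r t) (p - 1) * pw (x t) (p - 1) * (kap r t * pw (x t) ep))%R by ring.
  apply Rmult_le_compat_r; [apply Rmult_le_pos; [lra|apply pw_ge0]|].
  replace (pw (kap r t) (p - 1) * pw (x t) (p - 1))%R with (pw (kap r t * x t) (p - 1)).
  2:{ rewrite !pw_exp by (auto; apply Rmult_lt_0_compat; auto). rewrite ln_mult, <- exp_plus by auto. f_equal; ring. }
  apply pw_mono0; [apply Rmult_lt_0_compat; auto| |lra].
  rewrite kap_eq by auto. set (y := Cmod (1 - polar r t)).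
  assert (Y1 : (1 - r <= y)%R) by (unfold y; assert (KK := Cmod_one_minus (polar r t)); rewrite Cmod_polar in KK; lra).
  assert (Y2 : (x t <= 2 * y)%R).
  { unfold x. replace (1 - polar 1 t) with ((1 - polar r t) + (polar r t - polar 1 t)) by ring.
    eapply Rle_trans; [apply Cmod_triangle|]. fold y.
    assert (K1 := Cmod_polar_le r 1 t). rewrite Rabs_left1 in K1 by lra. lra. }
  apply (Rmult_le_reg_r (y * y)); [apply Rmult_lt_0_compat; lra|].
  replace ((1 - r * r) / (y * y) * x t * (y * y))%R with ((1 - r * r) * x t)%R by (field; lra).
  apply Rle_trans with ((1 - r) * 2 * (2 * y))%R; [|nra].
  apply Rmult_le_compat; try lra; nra. }
assert (Rn : forall n, (0 <= rs n < 1)%R) by (intros n; assert (R1 := rs_in n); lra).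
assert (Pk : (0 <= pw K p)%R) by apply pw_ge0.
assert (P4 : (0 <= pw 4 (p - 1))%R) by apply pw_ge0.
assert (Ikap : forall r, (0 <= r < 1)%R -> I (kap r) = (2 * PI)%R /\ intg (kap r)).
{ intros r Hr. assert (Hz' : (Cmod (polar r 0) < 1)%R) by (rewrite Cmod_polar; lra).
  split; [|apply intg_cont; intros; apply kap_cont; auto].
  rewrite <- (I_pois _ Hz'). apply I_ext. intros t _. rewrite pois_kap.
  replace (0 - t)%R with (- t)%R by ring. rewrite kap_neg. reflexivity. }
assert (AeX : aeT (fun t => (0 < x t)%R)).
{ generalize aeT_interior. apply aeT_imp. intros t _ Ht. apply chord_le; auto. }
destruct (Rle_lt_or_eq_dec 0 ep Hep) as [Lep|Eep].
(* [W_pois] asks for an exponent below 1; the surplus [ep - e'] is bounded by a constant, as the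
   distance is at most 2. *)
- set (e' := Rmin ep (/ 2)).
  assert (He' : (0 < e')%R) by (apply Rmin_pos; lra).
  assert (He1 : (e' <= ep)%R) by apply Rmin_l. assert (He2 : (e' <= / 2)%R) by apply Rmin_r.
  set (c1 := (pw 4 (p - 1) * (pw 2 (ep - e') * pw 2 e'))%R).
  assert (Hc1 : (0 <= c1)%R) by (unfold c1; apply Rmult_le_pos; [auto|apply Rmult_le_pos; apply pw_ge0]).
  set (D := (/ cos (e' * (PI / 2)))%R).
  assert (Uf : forall r, (0 <= r < 1)%R -> (I (pdens g p (f r)) <= c1 * (D * (2 * PI * W e' (r * r) 0)))%R).
  { intros r Hr.
    assert (IWk : intg (fun t => W e' r t * kap r (t - 0))%R).
    { apply intg_cont. intros t. apply (continuity_pt_mult (W e' r) (fun t => kap r (t - 0))).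
      - apply W_cont; auto.
      - apply (continuity_pt_comp (fun t => (t - 0)%R) (kap r)); [reg|apply kap_cont; auto]. }
    apply Rle_trans with (c1 * I (fun t => W e' r t * kap r (t - 0)))%R.
    - rewrite <- I_scal by auto.
      apply I_le; auto; [apply intg_scal; auto|]. intros t _.
      rewrite Rminus_0_r. assert (P := Kp r t Hr).
      destruct (Rle_lt_or_eq_dec 0 (x t) (proj1 (x0 t))) as [L|E].
      + eapply Rle_trans; [apply Ub; auto|]. unfold c1. rewrite !Rmult_assoc.
        apply Rmult_le_compat_l; [auto|].
        replace (pw (x t) ep) with (pw (x t) (ep - e') * pw (x t) e')%R.
        2:{ rewrite <- pw_plus by auto. f_equal. ring. }
        replace (kap r t * (pw (x t) (ep - e') * pw (x t) e'))%R with
          (pw (x t) (ep - e') * (pw (x t) e' * kap r t))%R by ring.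
        apply Rmult_le_compat; [apply pw_ge0|apply Rmult_le_pos; [apply pw_ge0|lra]| |].
        * apply pw_mono0; auto; [apply x0|lra].
        * rewrite <- Rmult_assoc. apply Rmult_le_compat_r; [lra|]. apply (W_1_le e' r t); auto; lra.
      + rewrite Df, <- E, (pw_0 al), Rmult_0_r by lra.
        apply Rmult_le_pos; [auto|apply Rmult_le_pos; [apply pw_ge0|lra]].
    - apply Rmult_le_compat_l; auto. apply W_pois; auto. lra. }
  assert (Lo : forall r, (0 <= r < 1)%R -> (pw (/ 2) p * (2 * PI) <= I (pdens g p (h r)))%R).
  { intros r Hr. apply Rle_trans with (pw (/ 2) p * I (W al 1))%R.
    - apply Rmult_le_compat_l; [apply pw_ge0|apply I_W_ge; auto].
    - assert (IW1 : intg (W al 1)).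
      { apply (intg_dom _ (fun _ => pw 2 al)); [apply mT_W; lra|apply intg_const|].
        intros t _. destruct (W_le al 1 t Hal ltac:(lra)). rewrite Rabs_pos_eq; auto. }
      rewrite <- I_scal by auto. apply I_le; [apply intg_scal; auto|apply Main; auto|].
      intros t _. rewrite Dh. apply Rmult_le_compat_r; [apply pw_ge0|].
      apply pw_mono; [lra| |lra].
      assert (N : 1 - polar r t <> 0) by (apply one_minus_neq_0; rewrite Cmod_polar; lra).
      rewrite Cmod_inv by auto. apply Rinv_le_contravar; [apply Cmod_gt_0; auto|].
      eapply Rle_trans; [apply Cmod_one_minus_le|]. rewrite Cmod_polar; lra. }
  (* At angle 0 the weight is [(1 - r^2)^e'], which tends to 0. *)
  assert (CV : Un_cv (fun n => pw K p * (c1 * (D * (2 * PI * W e' (rs n * rs n) 0))))%R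
     (pw K p * (c1 * (D * (2 * PI * W e' 1 0))))%R).
  { repeat (apply CV_mult; [apply Un_cv_const|]). apply W_cv; auto. apply rs2_cv. }
  assert (W0 : W e' 1 0 = 0%R).
  { unfold W. replace (1 - polar 1 0) with (RtoC 0).
    - rewrite Cmod_0, pw_0; lra.
    - apply C_ext; simpl; rewrite ?cos_0, ?sin_0; ring. }
  rewrite W0, !Rmult_0_r in CV.
  assert (Le := fun n => Rle_trans _ _ _ (Lo (rs n) (Rn n)) (Rle_trans _ _ _ (proj2 (Main (rs n) (Rn n)))
     (Rmult_le_compat_l _ _ _ Pk (Uf (rs n) (Rn n))))).
  assert (Fin := Rle_cv_lim Le (Un_cv_const _) CV).
  assert (Pp := two_PI_pos). assert (Ph := pw_pos (/ 2) p ltac:(lra)).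
  assert (0 < pw (/ 2) p * (2 * PI))%R by (apply Rmult_lt_0_compat; auto). lra.
- assert (Hp1 : (1 < p)%R) by (unfold ep in Eep; lra).
  assert (Uf : forall r, (0 <= r < 1)%R -> (I (pdens g p (f r)) <= pw 4 (p - 1) * (2 * PI))%R).
  { intros r Hr. destruct (Ikap r Hr) as [E1 E2]. rewrite <- E1, <- I_scal by auto.
    apply I_le; auto; [apply intg_scal; auto|]. intros t _. assert (P := Kp r t Hr).
    destruct (Rle_lt_or_eq_dec 0 (x t) (proj1 (x0 t))) as [L|E].
    - eapply Rle_trans; [apply Ub; auto|]. rewrite <- Eep.
      rewrite (pw_exp (x t)), Rmult_0_l, exp_0 by auto. right; ring.
    - rewrite Df, <- E, (pw_0 al), Rmult_0_r by lra. apply Rmult_le_pos; lra. }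
  (* Fatou's lemma would make the limit density integrable, but for [al = p - 1] it is [|1 - z|^(-
     p) |1 - z|^(p - 1) = 1 / |1 - z|]. *)
  destruct (fatou_le (fun n => pdens g p (h (rs n))) (fun t => pw (Cmod (/ (1 - polar 1 t))) p * pw (x t) al)%R
    (pw K p * (pw 4 (p - 1) * (2 * PI)))%R) as [IF _].
  + intros n. apply Main; auto.
  + apply mT_mul; apply mT_pw; [|apply mT_Cmod; split; simpl].
    * apply (mT_Cmod (fun t => / (1 - polar 1 t))), (cmT_inv (fun t => 1 - polar 1 t)).
      apply cmT_cont. intros t. apply (Rcont_plus (fun _ => 1) (fun t => - polar 1 t)); [apply Rcont_const|].
      apply (Rcont_comp (fun w => - w) (fun t => polar 1 t)); [apply Rcont_polar; lra|].
      apply (Ccont_ext_loc (fun w => - (1) * w) _ _ 1); [lra|intros; ring|].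
      apply Ccont_mult; [apply Ccont_const|apply Ccont_id].
    * apply mT_cont. intros t. reg.
    * apply mT_cont. intros t. reg.
  + intros; apply pdens_ge0.
  + intros; apply Rmult_le_pos; apply pw_ge0.
  + revert AeX. apply aeT_imp. intros t _ Hx.
    assert (CVt : Un_cv (fun n => pw (Cmod (/ (1 - polar (rs n) t))) p * pw (x t) al)%R
      (pw (Cmod (/ (1 - polar 1 t))) p * pw (x t) al)%R).
    { apply CV_mult; [|apply Un_cv_const]. apply pw_cv; [lra|intros; apply Cmod_ge_0|apply Cmod_ge_0|].
      apply (Ccv_Cmod (fun n => / (1 - polar (rs n) t))).
      apply (Ccv_Ccont Cinv (fun n => 1 - polar (rs n) t) (1 - polar 1 t)).
      - apply Ccont_inv. apply Cmod_gt_0; auto.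
      - split; simpl.
        + apply (CV_plus (fun _ => 1%R) (fun n => - (rs n * cos t))%R); [apply Un_cv_const|].
          apply (CV_opp (fun n => rs n * cos t)%R), CV_mult; [apply rs_cv|apply Un_cv_const].
        + apply (CV_plus (fun _ => 0%R) (fun n => - (rs n * sin t))%R); [apply Un_cv_const|].
          apply (CV_opp (fun n => rs n * sin t)%R), CV_mult; [apply rs_cv|apply Un_cv_const]. }
    revert CVt. apply Un_cv_ext. intros n. rewrite Dh. reflexivity.
  + intros n. eapply Rle_trans; [apply Main; auto|]. apply Rmult_le_compat_l; auto.
  + apply (not_intg_inv (pw 2 (1 - 1)) (fun t => pw (Cmod (/ (1 - polar 1 t))) p * pw (x t) al)%R); auto.
    * apply pw_pos; lra.
    * intros; apply Rmult_le_pos; apply pw_ge0.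
    * intros t Ht. eapply Rle_trans; [apply (pw_neg_lower t 1 Ht); lra|].
      destruct (chord_le t Ht) as [X1 X2]. fold (x t) in X1 |- *.
      rewrite Cmod_inv by (apply Cmod_gt_0; auto). fold (x t).
      replace (/ x t)%R with (pw (x t) (-1)).
      2:{ rewrite pw_exp by auto. replace (-1 * ln (x t))%R with (- ln (x t))%R by ring.
          rewrite exp_Ropp, exp_ln; auto. }
      rewrite pw_pw, <- pw_plus by auto. right. f_equal. unfold ep in Eep. lra.
Qed.

(** * The weight and the critical exponents *)

(** [cpow] never vanishes, so the value at 1 that continuity dictates is set by hand. *)
Definition one_minus_pow (a : R) (z : C) : C := if Ceq_dec z 1 then 0 else cpow (1 - z) a.

Lemma one_minus_re_closed (z : C) : (Cmod z <= 1)%R -> z <> 1 -> (0 < fst (1 - z)%C)%R.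
Proof.
intros Hz' N. destruct z as [x y]. assert (K := re_le_Cmod (x, y)). simpl in K.
apply Rabs_le_between in K. simpl. destruct (Req_dec x 1) as [E|E]; [|lra].
exfalso. apply N. rewrite E in *. apply C_ext; simpl; auto.
assert (S : (Cmod (1%R, y) * Cmod (1%R, y) <= 1)%R) by (assert (P := Cmod_ge_0 (1%R, y)); nra).
unfold Cmod in S. rewrite sqrt_sqrt in S by (simpl; nra). simpl in S. nra.
Qed.

Lemma Cmod_one_minus_pow (a : R) (z : C) : (0 < a)%R -> (Cmod z <= 1)%R ->
  Cmod (one_minus_pow a z) = pw (Cmod (1 - z)) a.
Proof.
intros Ha Hz'. unfold one_minus_pow. destruct (Ceq_dec z 1) as [->|N].
- replace (1 - 1) with (RtoC 0) by ring. rewrite Cmod_0, pw_0; auto; lra.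
- rewrite Cmod_cpow, pw_exp; auto. apply Cmod_pos_of_re, one_minus_re_closed; auto.
Qed.

Lemma Cder_one_minus_pow (a : R) (z : C) : (Cmod z <= 1)%R -> z <> 1 -> exists l, Cder (one_minus_pow a) z l.
Proof.
intros Hz' N.
destruct (Cder_cpow (fun w => 1 - w) z (0 + - (1)) a) as [l Hl].
- apply one_minus_re_closed; auto.
- apply (Cder_plus (fun _ => 1) (fun w => - w)); [apply Cder_const|].
  exists (fun _ => - (1)). split; auto. split; [apply Ccont_const|].
  exists 1%R. split; [lra|]. intros w _. ring.
- exists l. apply (Cder_ext_loc (fun w => cpow (1 - w) a) _ z l (Cmod (z - 1))); auto.
  + apply Cmod_sub_pos; auto.
  + intros w Hw. unfold one_minus_pow. destruct (Ceq_dec w 1) as [->|]; auto.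
    rewrite <- (Cmod_opp (z - 1)) in Hw. replace (- (z - 1)) with (1 - z) in Hw by ring. lra.
Qed.

Lemma one_minus_pow_cont (a : R) : (0 < a)%R -> cont_on_closed_disc (one_minus_pow a).
Proof.
intros Ha z Hz' e He. destruct (Ceq_dec z 1) as [->|N].
(* This is [e^(1 / a)], the modulus being [|1 - w|^a]. *)
- exists (exp (ln e / a)). split; [apply exp_pos|]. intros w Hw Hd.
  replace (one_minus_pow a 1) with (RtoC 0) by (unfold one_minus_pow; destruct (Ceq_dec 1 1); congruence).
  replace (one_minus_pow a w - 0) with (one_minus_pow a w) by ring.
  rewrite Cmod_one_minus_pow by auto.
  destruct (Ceq_dec w 1) as [->|Nw].
  + replace (1 - 1) with (RtoC 0) by ring. rewrite Cmod_0, pw_0; auto; lra.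
  + assert (P := Cmod_sub_pos 1 w ltac:(congruence)).
    rewrite <- (Cmod_opp (w - 1)) in Hd. replace (- (w - 1)) with (1 - w) in Hd by ring.
    rewrite pw_exp by auto. rewrite <- (exp_ln e) by auto. apply exp_increasing.
    apply ln_increasing in Hd; auto. rewrite ln_exp in Hd.
    apply (Rmult_lt_compat_l a) in Hd; auto. replace (a * (ln e / a))%R with (ln e) in Hd by (field; lra). auto.
- destruct (Cder_one_minus_pow a z Hz' N) as [l Hl].
  destruct (Cder_cont _ _ _ Hl e He) as [d [Hd K]]. exists d; split; auto.
Qed.

Lemma one_minus_pow_neq_0 (a : R) (z : C) : z <> 1 -> one_minus_pow a z <> 0.
Proof. intros N. unfold one_minus_pow. destruct (Ceq_dec z 1); [contradiction|apply cpow_neq_0]. Qed.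

Lemma one_minus_pow_good (a : R) : (0 < a)%R -> good_weight (one_minus_pow a).
Proof.
intros Ha. assert (N1 : forall z, (Cmod z < 1)%R -> z <> 1).
{ intros z Hz' ->. rewrite Cmod_1 in Hz'. lra. }
split; [split; [|split]|split].
- apply holo_Cder. intros z Hz'. apply Cder_one_minus_pow; [lra|auto].
- apply one_minus_pow_cont; auto.
- exists (pw 2 a). split; [apply pw_ge0|]. intros w Hw. rewrite Cmod_one_minus_pow by auto.
  apply pw_mono; auto; [apply Cmod_ge_0|]. eapply Rle_trans; [apply Cmod_one_minus_le|]. lra.
- intros z Hz'. apply one_minus_pow_neq_0; auto.
- apply (aeT_imp (fun t => 0 < t < 2 * PI)%R); [|apply aeT_interior].
  intros t _ Ht. apply one_minus_pow_neq_0. intros E. destruct (chord_le t Ht) as [L _].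
  rewrite E in L. replace (1 - 1) with (RtoC 0) in L by ring. rewrite Cmod_0 in L. lra.
Qed.

Lemma one_minus_pow_modulus (a : R) : (0 < a)%R -> modulus_W a (one_minus_pow a).
Proof. intros Ha r t Hr. apply Cmod_one_minus_pow; auto. rewrite Cmod_polar; lra. Qed.

Lemma one_minus_pow_0 (a : R) : one_minus_pow a 0 = 1.
Proof.
unfold one_minus_pow. destruct (Ceq_dec 0 1) as [E|_].
- exfalso. apply (f_equal fst) in E. simpl in E. lra.
- replace (1 - 0) with (RtoC 1) by ring. unfold cpow, clog.
  rewrite Cmod_1, ln_1, carg_RtoC. replace (RtoC a * (0, 0)) with (RtoC 0) by (apply C_ext; simpl; ring).
  apply cexp_0.
Qed.

(** Conjugacy reads [(p0 - 1) * (q0 - 1) = 1], so the conditions [a (p - 2) < 1] and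
    [a (2 - p) < p - 1] become equalities exactly at [p0] and [q0]. Both are monotone in [p], which
    settles all other exponents. *)
Lemma one_minus_pow_bounded_iff (p0 q0 p : R) : (2 < p0)%R -> (/ q0 + / p0 = 1)%R -> (1 <= p)%R ->
  szego_bounded (one_minus_pow (/ (p0 - 2))) p <-> (q0 < p < p0)%R.
Proof.
intros Hp0 Hq0 Hp. set (a := (/ (p0 - 2))%R).
assert (Ha : (0 < a)%R) by (apply Rinv_0_lt_compat; lra).
assert (Ea : (a * (p0 - 2) = 1)%R) by (unfold a; field; lra).
(* Since [/ 0 = 0], the value [q0 = 0] would force [p0 = 1]. *)
assert (Nq : q0 <> 0%R).
{ intros ->. rewrite Rinv_0 in Hq0. assert (E : (/ / p0 = 1)%R) by (rewrite <- Rinv_1; f_equal; lra).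
  rewrite Rinv_inv in E. lra. }
assert (Eq : (p0 + q0 = p0 * q0)%R).
{ transitivity ((p0 * q0) * (/ q0 + / p0))%R; [field; split; auto; lra|rewrite Hq0; ring]. }
assert (Hq : ((p0 - 1) * (q0 - 1) = 1)%R) by lra.
assert (Q1 : (1 < q0 < 2)%R) by (split; nra).
assert (Aq : (a * (2 - q0) = q0 - 1)%R).
{ replace (2 - q0)%R with ((p0 - 2) * (q0 - 1))%R by lra. rewrite <- Rmult_assoc, Ea. ring. }
assert (Lt : forall s, (q0 < s < 2)%R -> (a * (2 - s) < s - 1)%R) by (intros; nra).
assert (Ok := one_minus_pow_good a Ha). assert (HW := one_minus_pow_modulus a Ha).
split.
- intros HB. destruct (Rlt_le_dec q0 p) as [L1|L1]; [destruct (Rlt_le_dec p p0) as [L2|L2]; auto|]; exfalso; revert HB.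
  + apply (unbounded_large a); auto; [apply one_minus_pow_0|lra|nra].
  + apply (unbounded_small a); auto; [lra|nra].
- intros [L1 L2]. destruct (Rtotal_order p 2) as [L|[->|L]].
  + apply (bounded_lt2 a); auto; lra.
  + apply bounded_2; auto.
  (* The exponent conjugate to [p]; conjugation maps the interval from 2 to [p0] onto the one from
     [q0] to 2. *)
  + set (s := (1 + / (p - 1))%R).
    assert (Es : ((p - 1) * (s - 1) = 1)%R) by (unfold s; field; lra).
    assert (S1 : (q0 < s < 2)%R) by (split; nra).
    apply (bounded_gt2 a p s); auto; lra.
Qed.

End SzegoProjection.

From mathcomp Require Import all_boot all_order all_algebra.
From mathcomp Require Import all_classical all_reals all_analysis.
From mathcomp Require Import Rstruct Rstruct_topology.

Import Order.TTheory GRing.Theory Num.Theory.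
Local Open Scope ring_scope.

Theorem theorem1 :
  forall p0 : R, 2 < p0 ->
  forall q0 : R, q0^-1 + p0^-1 = 1 ->
  exists g : cplx -> cplx, admissible_weight g /\
    forall p : R, 1 <= p -> (szego_bounded g p <-> q0 < p < p0).
Proof.
move=> p0 p0_gt2 q0 q0_conj.
have {}p0_gt2 : (2 < p0)%coqR by apply/RltP.
have a_gt0 : (0 < / (p0 - 2))%coqR by apply/Rinv_0_lt_compat/Rlt_0_minus.
exists (SzegoProjection.one_minus_pow (/ (p0 - 2))%coqR); split.
  by have [[holo [cont _]] [nz _]] := SzegoProjection.one_minus_pow_good _ a_gt0.
move=> p /RleP p_ge1.
rewrite (SzegoProjection.one_minus_pow_bounded_iff p0 q0 p p0_gt2 _ p_ge1) //.
split; first by case=> /RltP-> /RltP->.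
by case/andP=> /RltP ? /RltP.
Qed.
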